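(* Let $\mathcal{C}$ be a pivotal finite tensor category over a field $\Bbbk$ with pivotal structure $\mathfrak{p}$. For a finite left $\mathcal{C}$-module category $\mathcal{M}$, the following are equivalent: (1) $\mathcal{M}$ admits a pivotal structure. (2) There exists a symmetric Frobenius algebra $A$ in $\mathcal{C}$ such that $\mathcal{M}$ is equivalent to $\mathcal{C}_A$ as a left $\mathcal{C}$-module category.
   Context: $\Bbbk$ is an arbitrary field. A finite abelian category is a $\Bbbk$-linear category equivalent to the category of finite-dimensional right modules over a finite-dimensional $\Bbbk$-algebra; functors are $\Bbbk$-linear. A finite tensor category is a finite abelian category $\mathcal{C}$ with a rigid monoidal structure (assumed strict) with bilinear $\otimes$ and simple unit object $\mathbf{1}$. The left dual $X^*$ comes with $\mathrm{ev}_X:X^*\otimes X\to\mathbf{1}$, $\mathrm{coev}_X:\mathbf{1}\to X\otimes X^*$; ${}^*X$ is the right dual. A pivotal structure on $\mathcal{C}$ is a monoidal natural isomorphism $\mathfrak{p}_X:X\to X^{**}$. A finite left $\mathcal{C}$-module category is a finite abelian category $\mathcal{M}$ with a (strict) left $\mathcal{C}$-module structure $\triangleright$, bilinear and right exact in each variable. For an algebra $A$ in $\mathcal{C}$, $\mathcal{C}_A$ is the finite left $\mathcal{C}$-module category of right $A$-modules with $X\triangleright M=X\otimes M$. Internal Hom: $\mathrm{Hom}_{\mathcal{M}}(X\triangleright M,N)\cong\mathrm{Hom}_{\mathcal{C}}(X,\underline{\mathrm{Hom}}(M,N))$, with counit $\underline{\mathrm{ev}}_{M,N}$. $\mathscr{P}_{\mathcal{C}}(\mathcal{M})$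 is the full subcategory of $\mathcal{C}$-projective objects, i.e. those $M$ with $\underline{\mathrm{Hom}}(M,-)$ exact. $\mathfrak{a}_{X,M,N}:X\otimes\underline{\mathrm{Hom}}(M,N)\to\underline{\mathrm{Hom}}(M,X\triangleright N)$ and $\mathfrak{b}_{M,N,X}:\underline{\mathrm{Hom}}(M,N)\otimes X^*\to\underline{\mathrm{Hom}}(X\triangleright M,N)$ are the isomorphisms corresponding by adjunction to $\mathrm{id}_X\triangleright\underline{\mathrm{ev}}_{M,N}$ and $\underline{\mathrm{ev}}_{M,N}\circ(\mathrm{id}\triangleright\mathrm{ev}_X\triangleright\mathrm{id}_M)$. The relative Serre functor $\mathbb{S}$ of $\mathcal{M}$ is a right exact endofunctor of $\mathcal{M}$ with a twisted left $\mathcal{C}$-module structure, i.e. a natural isomorphism $\mathfrak{s}_{X,M}:X^{**}\triangleright\mathbb{S}(M)\to\mathbb{S}(X\triangleright M)$ with $\mathfrak{s}_{\mathbf{1},M}=\mathrm{id}$ and $\mathfrak{s}_{X\otimes Y,M}=\mathfrak{s}_{X,Y\triangleright M}\circ(\mathrm{id}_{X^{**}}\triangleright\mathfrak{s}_{Y,M})$, for which there is a natural isomorphism $\phi_{M,P}:\underline{\mathrm{Hom}}(M,\mathbb{S}(P))\to\underline{\mathrm{Hom}}(P,M)^*$ ($M\in\mathcal{M}$, $P\in\mathscr{P}_{\mathcal{C}}(\mathcal{M})$) satisfying $\phi_{X\triangleright M,P}\circ\mathfrak{b}_{M,\mathbb{S}(P),X}=(\mathfrak{a}_{X,P,M}^{-1})^*\circ(\phi_{M,P}\otimes\mathrm{id}_{X^*})$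 and $\phi_{M,X\triangleright P}\circ\underline{\mathrm{Hom}}(M,\mathfrak{s}_{X,P})\circ\mathfrak{a}_{X^{**},M,\mathbb{S}(P)}=(\mathfrak{b}_{P,M,X}^{-1})^*\circ(\mathrm{id}_{X^{**}}\otimes\phi_{M,P})$. The pair $(\mathbb{S},\mathfrak{s})$ exists and is unique up to isomorphism of twisted left $\mathcal{C}$-module functors. A pivotal structure of $\mathcal{M}$ is an isomorphism of functors $\tilde{\mathfrak{p}}:\mathrm{id}_{\mathcal{M}}\to\mathbb{S}$ such that $\tilde{\mathfrak{p}}_{X\triangleright M}=\mathfrak{s}_{X,M}\circ(\mathfrak{p}_X\triangleright\tilde{\mathfrak{p}}_M)$ for all $X\in\mathcal{C}$, $M\in\mathcal{M}$. A Frobenius algebra in $\mathcal{C}$ is an algebra $A$ with multiplication $m_A$ equipped with a Frobenius form, i.e. a morphism $\lambda:A\to\mathbf{1}$ such that $\phi_A:=(\lambda m_A\otimes\mathrm{id}_{A^*})\circ(\mathrm{id}_A\otimes\mathrm{coev}_A):A\to A^*$ is an isomorphism. Its Nakayama isomorphism is $\nu_A=\phi_A^{-1}\circ\phi_A^*:A^{**}\to A$. $A$ is symmetric if $\nu_A\circ\mathfrak{p}_A=\mathrm{id}_A$. *)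

(* Defs.v *)
From HB Require Import structures.
From mathcomp Require Import all_boot all_order all_algebra.
From mathcomp Require Import boolp.

Set Implicit Arguments.
Unset Strict Implicit.
Unset Printing Implicit Defensive.

Import GRing.Theory.
Local Open Scope ring_scope.

Declare Scope kcat_scope.
Delimit Scope kcat_scope with kcat.
Local Open Scope kcat_scope.

Reserved Notation "g ∘ f" (at level 40, left associativity).
Reserved Notation "X ⊗ Y" (at level 35, right associativity).
Reserved Notation "f ⊠ g" (at level 35, right associativity).
Reserved Notation "X ▷ M" (at level 37, right associativity).
Reserved Notation "f ▶ g" (at level 37, right associativity).

Record kcat (k : fieldType) := KCat {
  ob :> Type;
  hom : ob -> ob -> lmodType k;
  idm : forall X, hom X X;
  comp : forall X Y Z, hom Y Z -> hom X Y -> hom X Z;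
  compm1 : forall X Y (f : hom X Y), comp f (idm X) = f;
  comp1m : forall X Y (f : hom X Y), comp (idm Y) f = f;
  compA : forall X Y Z W (h : hom Z W) (g : hom Y Z) (f : hom X Y),
    comp h (comp g f) = comp (comp h g) f;
  comp_linr : forall X Y Z (g : hom Y Z), linear (fun f : hom X Y => comp g f);
  comp_linl : forall X Y Z (f : hom X Y), linear (fun g : hom Y Z => comp g f)
}.
Arguments hom {k} C X Y : rename.
Arguments idm {k C} X : rename.
Arguments comp {k C X Y Z} g f : rename.

Notation "g ∘ f" := (comp g f) : kcat_scope.

Section Basic.
Variables (k : fieldType) (C : kcat k).

(* An equality of objects, seen as an isomorphism; it plays the role of the
   identity morphisms left implicit when working with strict structures. *)
Definition cst (X Y : C) (e : X = Y) : hom C X Y :=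
  match e with erefl => idm X end.

Definition is_inv (X Y : C) (f : hom C X Y) (g : hom C Y X) : bool :=
  (g ∘ f == idm X) && (f ∘ g == idm Y).

Definition iso (X Y : C) (f : hom C X Y) : Prop := exists g, is_inv f g.

(* The inverse of f; only meaningful when f is an isomorphism. *)
Definition invm (X Y : C) (f : hom C X Y) : hom C Y X :=
  if pselect (iso f) is left h then xchoose h else 0.

Definition mono (X Y : C) (f : hom C X Y) : Prop :=
  forall W (g h : hom C W X), f ∘ g = f ∘ h -> g = h.

Definition simple (X : C) : Prop :=
  idm X <> 0 /\
  forall Y (f : hom C Y X), mono f -> f = 0 \/ iso f.

Definition is_ker (X Y Z : C) (i : hom C X Y) (g : hom C Y Z) : Prop :=
  g ∘ i = 0 /\
  forall W (h : hom C W Y), g ∘ h = 0 -> exists! u : hom C W X, i ∘ u = h.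

Definition is_coker (X Y Z : C) (f : hom C X Y) (c : hom C Y Z) : Prop :=
  c ∘ f = 0 /\
  forall W (h : hom C Y W), h ∘ f = 0 -> exists! u : hom C Z W, u ∘ c = h.

Definition short_exact (X Y Z : C) (f : hom C X Y) (g : hom C Y Z) : Prop :=
  is_ker f g /\ is_coker f g.

End Basic.

Record functor (k : fieldType) (C D : kcat k) := Functor {
  fob :> C -> D;
  fmap : forall X Y, hom C X Y -> hom D (fob X) (fob Y);
  fmap1 : forall X, fmap (idm X) = idm (fob X);
  fmapM : forall X Y Z (g : hom C Y Z) (f : hom C X Y),
    fmap (g ∘ f) = fmap g ∘ fmap f;
  fmap_lin : forall X Y, linear (@fmap X Y)
}.
Arguments fmap {k C D} F {X Y} f : rename.

Section Functors.
Variables (k : fieldType).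

Definition idF (C : kcat k) : functor C C.
Proof. by exists id (fun X Y f => f). Defined.

Definition compF (C D E : kcat k) (G : functor D E) (F : functor C D) :
  functor C E.
Proof.
exists (fun X => G (F X)) (fun X Y f => fmap G (fmap F f)).
- by move=> X; rewrite !fmap1.
- by move=> X Y Z g f; rewrite !fmapM.
- by move=> X Y a f g; rewrite !fmap_lin.
Defined.

Definition nat_iso (C D : kcat k) (F G : functor C D)
    (t : forall X, hom D (F X) (G X)) : Prop :=
  (forall X, iso (t X)) /\
  (forall X Y (f : hom C X Y), t Y ∘ fmap F f = fmap G f ∘ t X).

Definition isomorphicF (C D : kcat k) (F G : functor C D) : Prop :=
  exists t, @nat_iso C D F G t.

Definition is_equivalence (C D : kcat k) (F : functor C D) : Prop :=
  exists G : functor D C,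
    isomorphicF (compF G F) (idF C) /\ isomorphicF (compF F G) (idF D).

Definition equivalent (C D : kcat k) : Prop :=
  exists F : functor C D, is_equivalence F.

Definition right_exact (C D : kcat k) (F : functor C D) : Prop :=
  forall X Y Z (f : hom C X Y) (c : hom C Y Z),
    is_coker f c -> is_coker (fmap F f) (fmap F c).

Definition exact (C D : kcat k) (F : functor C D) : Prop :=
  forall X Y Z (f : hom C X Y) (g : hom C Y Z),
    short_exact f g -> short_exact (fmap F f) (fmap F g).

End Functors.

Lemma linear_zero (k : fieldType) (U V : lmodType k) (f : U -> V) :
  linear f -> f 0 = 0.
Proof.
by move=> /(_ (-1) 0 0); rewrite scaler0 addr0 scaleN1r addNr.
Qed.

Section SubLmodule.
Variables (k : fieldType) (V : lmodType k) (P : {pred V}).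

Record subl (hP : submod_closed P) := SubL { slval : V; slP : slval \in P }.

Variable hP : submod_closed P.
HB.instance Definition _ := [isSub for @slval hP].
HB.instance Definition _ := [Choice of subl hP by <:].
HB.instance Definition _ :=
  GRing.SubChoice_isSubLmodule.Build k V P (subl hP)
    (GRing.submod_closed_semi hP).

End SubLmodule.

(* Unlike falgType, this allows the zero algebra, so that the zero category is
   a finite abelian category. *)
Record fdalg (k : fieldType) := FdAlg {
  fdalg_sort :> vectType k;
  amul : fdalg_sort -> fdalg_sort -> fdalg_sort;
  aone : fdalg_sort;
  amulA : associative amul;
  amul1l : left_id aone amul;
  amul1r : right_id aone amul;
  amul_linr : forall a, linear (amul a);
  amul_linl : forall b, linear (amul ^~ b)
}.

Record fdmod (k : fieldType) (A : fdalg k) := FdMod {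
  fdmod_sort :> vectType k;
  ract : fdmod_sort -> A -> fdmod_sort;
  ractA : forall v a b, ract v (amul a b) = ract (ract v a) b;
  ract1 : forall v, ract v (aone A) = v;
  ract_linr : forall v, linear (ract v);
  ract_linl : forall a, linear (ract ^~ a)
}.

Section ModCategory.
Variables (k : fieldType) (A : fdalg k).

Definition equivariant (V W : fdmod A) : pred 'Hom(V, W) :=
  fun f => `[< forall v a, f (ract v a) = ract (f v) a >].

Fact equivariant_closed (V W : fdmod A) : submod_closed (@equivariant V W).
Proof.
split=> [|c f g /asboolP fE /asboolP gE]; apply/asboolP => v a.
  by rewrite !zero_lfunE (linear_zero (ract_linl a)).
by rewrite !add_lfunE !scale_lfunE fE gE ract_linl.
Qed.

Definition fdmod_hom (V W : fdmod A) : lmodType k :=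
  subl (@equivariant_closed V W).

Fact fdmod_id_subproof (V : fdmod A) : \1%VF \in @equivariant V V.
Proof. by apply/asboolP => v a; rewrite !lfunE. Qed.

Fact fdmod_comp_subproof (U V W : fdmod A)
    (g : fdmod_hom V W) (f : fdmod_hom U V) :
  (slval g \o slval f)%VF \in @equivariant U W.
Proof.
case: g f => g /asboolP gE [f /asboolP fE] /=.
by apply/asboolP => v a; rewrite !lfunE /= fE gE.
Qed.

Definition mod_kcat : kcat k.
Proof.
exists (fdmod A) fdmod_hom (fun V => SubL _ (fdmod_id_subproof V))
  (fun U V W g f => SubL _ (fdmod_comp_subproof g f)).
- by move=> U V f; apply: val_inj; rewrite /= comp_lfun1r.
- by move=> U V f; apply: val_inj; rewrite /= comp_lfun1l.
- by move=> U V W X h g f; apply: val_inj; rewrite /= comp_lfunA.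
- move=> U V W g a f f'; apply: val_inj => /=.
  by rewrite comp_lfunDr comp_lfunZr.
- move=> U V W f a g g'; apply: val_inj => /=.
  by rewrite comp_lfunDl comp_lfunZl.
Defined.

End ModCategory.

Definition finite_abelian (k : fieldType) (C : kcat k) : Prop :=
  exists A : fdalg k, equivalent C (mod_kcat A).

Record moncat (k : fieldType) := MonCat {
  mon_kcat :> kcat k;
  tens : mon_kcat -> mon_kcat -> mon_kcat;
  tensm : forall X X' Y Y' : mon_kcat, hom mon_kcat X X' ->
    hom mon_kcat Y Y' -> hom mon_kcat (tens X Y) (tens X' Y');
  tunit : mon_kcat;
  tensA : forall X Y Z, tens (tens X Y) Z = tens X (tens Y Z);
  tens1l : forall X, tens tunit X = X;
  tens1r : forall X, tens X tunit = X;
  tensm1 : forall X Y, tensm (idm X) (idm Y) = idm (tens X Y);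
  tensmM : forall (X X' X'' Y Y' Y'' : mon_kcat)
      (f' : hom _ X' X'') (f : hom _ X X')
      (g' : hom _ Y' Y'') (g : hom _ Y Y'),
    tensm (f' ∘ f) (g' ∘ g) = tensm f' g' ∘ tensm f g;
  tensm_linr : forall X X' Y Y' (f : hom _ X X'),
    linear (fun g : hom _ Y Y' => tensm f g);
  tensm_linl : forall X X' Y Y' (g : hom _ Y Y'),
    linear (fun f : hom _ X X' => tensm f g);
  tensmA : forall X X' Y Y' Z Z'
      (f : hom _ X X') (g : hom _ Y Y') (h : hom _ Z Z'),
    cst (tensA X' Y' Z') ∘ tensm (tensm f g) h
      = tensm f (tensm g h) ∘ cst (tensA X Y Z);
  tensm1l : forall X X' (f : hom _ X X'),
    cst (tens1l X') ∘ tensm (idm tunit) f = f ∘ cst (tens1l X);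
  tensm1r : forall X X' (f : hom _ X X'),
    cst (tens1r X') ∘ tensm f (idm tunit) = f ∘ cst (tens1r X)
}.
Arguments tens {k C} X Y : rename.
Arguments tensm {k C X X' Y Y'} f g : rename.
Arguments tunit {k C} : rename.
Arguments tensA {k C} X Y Z : rename.
Arguments tens1l {k C} X : rename.
Arguments tens1r {k C} X : rename.

Notation "X ⊗ Y" := (tens X Y) : kcat_scope.
Notation "f ⊠ g" := (tensm f g) : kcat_scope.

(* The two zigzag identities, exhibiting L as a left dual of X. *)
Definition dual_pair (k : fieldType) (C : moncat k) (L X : C)
    (ev : hom C (L ⊗ X) tunit) (coev : hom C tunit (X ⊗ L)) : Prop :=
  cst (tens1r X) ∘ (idm X ⊠ ev) ∘ cst (tensA X L X) ∘ (coev ⊠ idm X)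
    = cst (tens1l X) /\
  cst (tens1l L) ∘ (ev ⊠ idm L) ∘ cst (esym (tensA L X L)) ∘ (idm L ⊠ coev)
    = cst (tens1r L).

Record fintens (k : fieldType) := FinTens {
  ft_moncat :> moncat k;
  ft_finite : finite_abelian ft_moncat;
  ft_simple : simple (tunit : ft_moncat);
  ldual : ft_moncat -> ft_moncat;
  ev : forall X, hom ft_moncat (ldual X ⊗ X) tunit;
  coev : forall X, hom ft_moncat tunit (X ⊗ ldual X);
  ldualP : forall X, dual_pair (ev X) (coev X);
  rdual : ft_moncat -> ft_moncat;
  rev : forall X, hom ft_moncat (X ⊗ rdual X) tunit;
  rcoev : forall X, hom ft_moncat tunit (rdual X ⊗ X);
  rdualP : forall X, dual_pair (rev X) (rcoev X)
}.
Arguments ldual {k C} X : rename.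
Arguments ev {k C} X : rename.
Arguments coev {k C} X : rename.

Section Duality.
Variables (k : fieldType) (C : fintens k).
Implicit Types X Y Z : C.

(* (f ⊗ id) ∘ (id ⊗ coev), with the strictness casts written out. *)
Definition transp Z X (f : hom C (Z ⊗ X) tunit) : hom C Z (ldual X) :=
  cst (tens1l (ldual X)) ∘ (f ⊠ idm (ldual X))
    ∘ cst (esym (tensA Z X (ldual X))) ∘ (idm Z ⊠ coev X)
    ∘ cst (esym (tens1r Z)).

Definition dualm X Y (f : hom C X Y) : hom C (ldual Y) (ldual X) :=
  transp (ev Y ∘ (idm (ldual Y) ⊠ f)).

(* The canonical isomorphisms 1 -> 1^*, Y^* ⊗ X^* -> (X ⊗ Y)^*, 1 -> 1^** and
   X^** ⊗ Y^** -> (X ⊗ Y)^**. They are suppressed in the usual strict notation,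
   but strictness of C does not make them identities. *)
Definition dual1 : hom C tunit (ldual tunit) := transp (cst (tens1l tunit)).

Definition dualM X Y : hom C (ldual Y ⊗ ldual X) (ldual (X ⊗ Y)) :=
  transp (ev Y ∘ (idm (ldual Y) ⊠ (cst (tens1l Y) ∘ (ev X ⊠ idm Y)
            ∘ cst (esym (tensA (ldual X) X Y))))
          ∘ cst (tensA (ldual Y) (ldual X) (X ⊗ Y))).

Definition ddual1 : hom C tunit (ldual (ldual tunit)) :=
  dualm (invm dual1) ∘ dual1.

Definition ddualM X Y :
    hom C (ldual (ldual X) ⊗ ldual (ldual Y)) (ldual (ldual (X ⊗ Y))) :=
  dualm (invm (dualM X Y)) ∘ dualM (ldual Y) (ldual X).

Definition ddualm X Y (f : hom C X Y) :
  hom C (ldual (ldual X)) (ldual (ldual Y)) := dualm (dualm f).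

Record pivotal := Pivotal {
  piv :> forall X, hom C X (ldual (ldual X));
  piv_iso : forall X, iso (piv X);
  piv_nat : forall X Y (f : hom C X Y), piv Y ∘ f = ddualm f ∘ piv X;
  piv1 : piv tunit = ddual1;
  pivM : forall X Y, piv (X ⊗ Y) = ddualM X Y ∘ (piv X ⊠ piv Y)
}.

End Duality.

Record modcat (k : fieldType) (C : moncat k) := ModCat {
  mod_cat :> kcat k;
  act : C -> mod_cat -> mod_cat;
  actm : forall (X X' : C) (M M' : mod_cat), hom C X X' ->
    hom mod_cat M M' -> hom mod_cat (act X M) (act X' M');
  actA : forall (X Y : C) M, act (X ⊗ Y) M = act X (act Y M);
  act1 : forall M, act tunit M = M;
  actm1 : forall (X : C) M, actm (idm X) (idm M) = idm (act X M);
  actmM : forall (X X' X'' : C) (M M' M'' : mod_cat)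
      (f' : hom C X' X'') (f : hom C X X')
      (g' : hom _ M' M'') (g : hom _ M M'),
    actm (f' ∘ f) (g' ∘ g) = actm f' g' ∘ actm f g;
  actm_linr : forall (X X' : C) M M' (f : hom C X X'),
    linear (fun g : hom _ M M' => actm f g);
  actm_linl : forall (X X' : C) M M' (g : hom _ M M'),
    linear (fun f : hom C X X' => actm f g);
  actmA : forall (X X' Y Y' : C) M M'
      (f : hom C X X') (g : hom C Y Y') (h : hom _ M M'),
    cst (actA X' Y' M') ∘ actm (f ⊠ g) h
      = actm f (actm g h) ∘ cst (actA X Y M);
  actm1l : forall M M' (f : hom _ M M'),
    cst (act1 M') ∘ actm (idm tunit) f = f ∘ cst (act1 M)
}.
Arguments act {k C M} X N : rename.
Arguments actm {k C M X X' N N'} f g : rename.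
Arguments actA {k C M} X Y N : rename.
Arguments act1 {k C M} N : rename.

Notation "X ▷ M" := (act X M) : kcat_scope.
Notation "f ▶ g" := (actm f g) : kcat_scope.

Section ActionFunctors.
Variables (k : fieldType) (C : moncat k) (M : modcat C).

Definition actFl (X : C) : functor M M.
Proof.
exists (fun N => X ▷ N) (fun N N' f => idm X ▶ f).
- by move=> N; rewrite actm1.
- by move=> N N' N'' g f; rewrite -actmM compm1.
- by move=> N N'; apply: actm_linr.
Defined.

Definition actFr (N : M) : functor C M.
Proof.
exists (fun X => X ▷ N) (fun X X' f => f ▶ idm N).
- by move=> X; rewrite actm1.
- by move=> X X' X'' g f; rewrite -actmM compm1.
- by move=> X X'; apply: actm_linl.
Defined.

End ActionFunctors.

Record finmod (k : fieldType) (C : moncat k) := FinMod {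
  fm_modcat :> modcat C;
  fm_finite : finite_abelian fm_modcat;
  fm_rexl : forall X : C, right_exact (actFl fm_modcat X);
  fm_rexr : forall N : fm_modcat, right_exact (actFr N)
}.

Definition mod_equivalent (k : fieldType) (C : moncat k) (M N : modcat C) :
    Prop :=
  exists (F : functor M N)
         (xi : forall (X : C) (P : M), hom N (X ▷ F P) (F (X ▷ P))),
  [/\ is_equivalence F,
      (forall X P, iso (xi X P)) /\
      (forall (X X' : C) (P P' : M) (f : hom C X X') (g : hom M P P'),
         xi X' P' ∘ (f ▶ fmap F g) = fmap F (f ▶ g) ∘ xi X P),
      forall P, fmap F (cst (act1 P)) ∘ xi tunit P = cst (act1 (F P))
    & forall (X Y : C) P,
        fmap F (cst (actA X Y P)) ∘ xi (X ⊗ Y) P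
          = xi X (Y ▷ P) ∘ (idm X ▶ xi Y P) ∘ cst (actA X Y (F P))].

Record ihom (k : fieldType) (C : moncat k) (M : modcat C) := IHom {
  ih :> M -> M -> C;
  iev : forall P N, hom M (ih P N ▷ P) N;
  icur : forall (X : C) P N, hom M (X ▷ P) N -> hom C X (ih P N);
  icurK : forall (X : C) P N (f : hom M (X ▷ P) N),
    iev P N ∘ (icur f ▶ idm P) = f;
  ievK : forall (X : C) P N (g : hom C X (ih P N)),
    icur (iev P N ∘ (g ▶ idm P)) = g
}.
Arguments iev {k C M} H P N : rename.
Arguments icur {k C M} H {X P N} f : rename.

Section InternalHom.
Variables (k : fieldType) (C : fintens k) (M : modcat C) (H : ihom M).

Definition ihomr (P N N' : M) (f : hom M N N') : hom C (H P N) (H P N') :=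
  icur H (f ∘ iev H P N).

Definition ihoml (P P' N : M) (f : hom M P P') : hom C (H P' N) (H P N) :=
  icur H (iev H P' N ∘ (idm (H P' N) ▶ f)).

Definition ihomF (P : M) : functor M C.
Proof.
exists (H P) (fun N N' f => ihomr P f).
- by move=> N; rewrite /ihomr comp1m -[RHS]ievK actm1 compm1.
- move=> N N' N'' g f; rewrite /ihomr -[RHS]ievK; congr icur.
  rewrite -{1}(compm1 (idm P)) actmM compA icurK.
  by rewrite -!compA icurK.
- move=> N N' a f g; rewrite /ihomr -[RHS]ievK; congr icur.
  by rewrite actm_linl comp_linr !icurK comp_linl.
Defined.

Definition cproj (P : M) : Prop := exact (ihomF P).

Definition ihA (X : C) (P N : M) : hom C (X ⊗ H P N) (H P (X ▷ N)) :=
  icur H ((idm X ▶ iev H P N) ∘ cst (actA X (H P N) P)).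

Definition ihB (P N : M) (X : C) : hom C (H P N ⊗ ldual X) (H (X ▷ P) N) :=
  icur H (iev H P N
    ∘ (idm (H P N) ▶ (cst (act1 P) ∘ (ev X ▶ idm P)
                        ∘ cst (esym (actA (ldual X) X P))))
    ∘ cst (actA (H P N) (ldual X) (X ▷ P))).

(* phi is only constrained at C-projective P; elsewhere its value is arbitrary
   (0 always exists). *)
Definition serre_iso (S : functor M M)
    (s : forall X N, hom M (ldual (ldual X) ▷ S N) (S (X ▷ N)))
    (phi : forall N P, hom C (H N (S P)) (ldual (H P N))) : Prop :=
  [/\ forall N P, cproj P -> iso (phi N P),
      forall N N' P (f : hom M N N'), cproj P ->
        phi N P ∘ ihoml (S P) f = dualm (ihomr P f) ∘ phi N' P,
      forall N P P' (g : hom M P P'), cproj P -> cproj P' ->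
        phi N P' ∘ ihomr N (fmap S g) = dualm (ihoml N g) ∘ phi N P,
      forall X N P, cproj P ->
        phi (X ▷ N) P ∘ ihB N (S P) X
          = dualm (invm (ihA X P N)) ∘ dualM X (H P N)
              ∘ (phi N P ⊠ idm (ldual X))
    & forall X N P, cproj P ->
        phi N (X ▷ P) ∘ ihomr N (s X P) ∘ ihA (ldual (ldual X)) N (S P)
          = dualm (invm (ihB P N X)) ∘ dualM (H P N) (ldual X)
              ∘ (idm (ldual (ldual X)) ⊠ phi N P)].

Record rel_serre := RelSerre {
  serre :> functor M M;
  serre_rex : right_exact serre;
  twist : forall X N, hom M (ldual (ldual X) ▷ serre N) (serre (X ▷ N));
  twist_iso : forall X N, iso (twist X N);
  twist_nat : forall X X' N N' (f : hom C X X') (g : hom M N N'),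
    twist X' N' ∘ (ddualm f ▶ fmap serre g)
      = fmap serre (f ▶ g) ∘ twist X N;
  twist1 : forall N,
    fmap serre (cst (act1 N)) ∘ twist tunit N ∘ (ddual1 C ▶ idm (serre N))
      = cst (act1 (serre N));
  twistM : forall X Y N,
    fmap serre (cst (actA X Y N)) ∘ twist (X ⊗ Y) N
        ∘ (ddualM X Y ▶ idm (serre N))
      = twist X (Y ▷ N) ∘ (idm (ldual (ldual X)) ▶ twist Y N)
          ∘ cst (actA (ldual (ldual X)) (ldual (ldual Y)) (serre N));
  serre_phi : exists phi, serre_iso twist phi
}.

Definition is_pivotal_structure (p : pivotal C) (S : rel_serre)
    (pt : forall N, hom M N (S N)) : Prop :=
  @nat_iso k M M (idF M) S pt /\
  forall X N, pt (X ▷ N) = twist S X N ∘ (p X ▶ pt N).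

End InternalHom.

(* Internal Homs and the relative Serre functor are unique up to canonical
   isomorphism, so the choices of H and S are immaterial. *)
Definition admits_pivotal_structure (k : fieldType) (C : fintens k)
    (p : pivotal C) (M : modcat C) : Prop :=
  exists (H : ihom M) (S : rel_serre H) (pt : forall N, hom M N (S N)),
    is_pivotal_structure p pt.

Record algebra (k : fieldType) (C : moncat k) := Algebra {
  alg :> C;
  algm : hom C (alg ⊗ alg) alg;
  algu : hom C tunit alg;
  algmA : algm ∘ (algm ⊠ idm alg)
    = algm ∘ (idm alg ⊠ algm) ∘ cst (tensA alg alg alg);
  algm1l : algm ∘ (algu ⊠ idm alg) = cst (tens1l alg);
  algm1r : algm ∘ (idm alg ⊠ algu) = cst (tens1r alg)
}.

Record rmodule (k : fieldType) (C : moncat k) (A : algebra C) := RModule {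
  rmod :> C;
  rho : hom C (rmod ⊗ A) rmod;
  rhoA : rho ∘ (rho ⊠ idm (A : C))
    = rho ∘ (idm rmod ⊠ algm A) ∘ cst (tensA rmod A A);
  rho1 : rho ∘ (idm rmod ⊠ algu A) = cst (tens1r rmod)
}.
Arguments rho {k C A} M : rename.

Section Casts.
Variables (k : fieldType) (C : kcat k).

Lemma cst_pi (X Y : C) (e e' : X = Y) : cst e = cst e'.
Proof. by rewrite (Prop_irrelevance e e'). Qed.

Lemma cst_trans (X Y Z : C) (e : X = Y) (e' : Y = Z) :
  cst e' ∘ cst e = cst (etrans e e').
Proof. by case: Z / e'; rewrite comp1m. Qed.

Lemma cst_id (X : C) (e : X = X) : cst e = idm X.
Proof. exact: (cst_pi e erefl). Qed.

Lemma cstK (X Y : C) (e : X = Y) (e' : Y = X) : cst e' ∘ cst e = idm X.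
Proof. by rewrite cst_trans cst_id. Qed.

End Casts.

Section RModules.
Variables (k : fieldType) (C : moncat k) (A : algebra C).
Implicit Types (M N P : rmodule A) (X Y Z : C).

Lemma cst_tensl X X' Y (e : X = X') :
  cst e ⊠ idm Y = cst (congr1 (fun Z => Z ⊗ Y) e).
Proof. by case: X' / e; rewrite tensm1. Qed.

Lemma cst_tensr X Y Y' (e : Y = Y') :
  idm X ⊠ cst e = cst (congr1 (fun Z => X ⊗ Z) e).
Proof. by case: Y' / e; rewrite tensm1. Qed.

Lemma rmodule_eq M N (e : (M : C) = N) :
  cst e ∘ rho M = rho N ∘ (cst e ⊠ idm (A : C)) -> M = N.
Proof.
case: M N e => M rM aM uM [N rN aN uN] /= e.
case: N / e rN aN uN => rN aN uN /=; rewrite tensm1 comp1m compm1 => erN.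
by case: rN / erN aN uN => aN uN; congr RModule; apply: Prop_irrelevance.
Qed.

Definition is_rmodm M N : pred (hom C M N) :=
  fun f => f ∘ rho M == rho N ∘ (f ⊠ idm (A : C)).

Fact is_rmodm_closed M N : submod_closed (@is_rmodm M N).
Proof.
split=> [|a f g /eqP fE /eqP gE]; apply/eqP.
  by rewrite (linear_zero (tensm_linl (idm _))) (linear_zero (comp_linl _))
    (linear_zero (comp_linr _)).
by rewrite comp_linl fE gE tensm_linl comp_linr.
Qed.

Definition rmod_hom M N : lmodType k := subl (@is_rmodm_closed M N).

Fact rmod_id_subproof M : idm (M : C) \in @is_rmodm M M.
Proof. by apply/eqP; rewrite tensm1 comp1m compm1. Qed.

Fact rmod_comp_subproof M N P (g : rmod_hom N P) (f : rmod_hom M N) :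
  slval g ∘ slval f \in @is_rmodm M P.
Proof.
case: g f => g /eqP gE [f /eqP fE] /=; apply/eqP.
by rewrite -compA fE compA gE -compA -tensmM comp1m.
Qed.

Definition rmod_kcat : kcat k.
Proof.
exists (rmodule A) rmod_hom (fun M => SubL _ (rmod_id_subproof M))
  (fun M N P g f => SubL _ (rmod_comp_subproof g f)).
- by move=> M N f; apply: val_inj; rewrite /= compm1.
- by move=> M N f; apply: val_inj; rewrite /= comp1m.
- by move=> M N P Q h g f; apply: val_inj; rewrite /= compA.
- by move=> M N P g a f f'; apply: val_inj; rewrite /= comp_linr.
- by move=> M N P f a g g'; apply: val_inj; rewrite /= comp_linl.
Defined.

Lemma slval_cst (M N : rmod_kcat) (e : M = N) (e' : rmod M = rmod N) :
  slval (cst e) = cst e'.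
Proof. by case: N / e e' => e'; rewrite [RHS]cst_id. Qed.

Lemma tensmMr X Y Y' Y'' (g' : hom C Y' Y'') (g : hom C Y Y') :
  idm X ⊠ (g' ∘ g) = (idm X ⊠ g') ∘ (idm X ⊠ g).
Proof. by rewrite -tensmM comp1m. Qed.

Lemma tensmMl X X' X'' Y (f' : hom C X' X'') (f : hom C X X') :
  (f' ∘ f) ⊠ idm Y = (f' ⊠ idm Y) ∘ (f ⊠ idm Y).
Proof. by rewrite -tensmM comp1m. Qed.

Definition act_rho X M : hom C ((X ⊗ M) ⊗ A) (X ⊗ M) :=
  (idm X ⊠ rho M) ∘ cst (tensA X M A).

Fact act_rhoA X M :
  act_rho X M ∘ (act_rho X M ⊠ idm (A : C))
    = act_rho X M ∘ (idm (X ⊗ M) ⊠ algm A) ∘ cst (tensA (X ⊗ M) A A).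
Proof.
rewrite /act_rho tensmMl -!compA (compA (cst _) (_ ⊠ _)) tensmA.
rewrite !compA -tensmMr rhoA -tensm1 -(compA (_ ⊠ rho M) (cst _)) tensmA.
rewrite !tensmMr cst_tensr cst_tensl -!compA !cst_trans.
by congr (_ ∘ (_ ∘ _)); apply: cst_pi.
Qed.

Fact act_rho1 X M :
  act_rho X M ∘ (idm (X ⊗ M) ⊠ algu A) = cst (tens1r (X ⊗ M)).
Proof.
rewrite /act_rho -tensm1 -compA tensmA compA -tensmMr rho1.
by rewrite cst_tensr cst_trans; apply: cst_pi.
Qed.

Definition rmod_act X (M : rmod_kcat) : rmod_kcat :=
  RModule (act_rhoA X M) (act_rho1 X M).

Fact rmod_actm_subproof X X' (M M' : rmod_kcat) (f : hom C X X')
    (g : hom rmod_kcat M M') :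
  f ⊠ slval g \in @is_rmodm (rmod_act X M) (rmod_act X' M').
Proof.
case: g => g /eqP gE /=; apply/eqP.
rewrite /= /act_rho compA -tensmM compm1 gE -compA tensmA compA -tensmM.
by rewrite comp1m.
Qed.

Definition rmod_actm X X' (M M' : rmod_kcat) (f : hom C X X')
    (g : hom rmod_kcat M M') : hom rmod_kcat (rmod_act X M) (rmod_act X' M') :=
  SubL _ (rmod_actm_subproof f g).

Fact rmod_actA X Y (M : rmod_kcat) :
  rmod_act (X ⊗ Y) M = rmod_act X (rmod_act Y M).
Proof.
apply: (@rmodule_eq (rmod_act (X ⊗ Y) M) (rmod_act X (rmod_act Y M))
  (tensA X Y M)); rewrite /= /act_rho.
rewrite -tensm1 compA tensmA tensmMr cst_tensr cst_tensl -!compA !cst_trans.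
by congr (_ ∘ _); apply: cst_pi.
Qed.

Fact rmod_act1 (M : rmod_kcat) : rmod_act tunit M = M.
Proof.
apply: (@rmodule_eq (rmod_act tunit M) M (tens1l M)); rewrite /= /act_rho.
rewrite compA tensm1l cst_tensl -!compA !cst_trans.
by congr (_ ∘ _); apply: cst_pi.
Qed.

(* C_A; the casts of rmod_act are equalities of modules, not just of objects. *)
Definition rmod_modcat : modcat C.
Proof.
exists rmod_kcat rmod_act rmod_actm rmod_actA rmod_act1.
- by move=> X M; apply: val_inj; rewrite /= tensm1.
- by move=> X X' X'' M M' M'' f' f g' g; apply: val_inj; rewrite /= tensmM.
- move=> X X' M M' f a g g'; apply: val_inj.
  by rewrite /= tensm_linr.
- move=> X X' M M' g a f f'; apply: val_inj.
  by rewrite /= tensm_linl.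
- move=> X X' Y Y' M M' f g h; apply: val_inj => /=.
  by rewrite !(slval_cst (rmod_actA _ _ _) (tensA _ _ _)) tensmA.
- move=> M M' f; apply: val_inj => /=.
  by rewrite !(slval_cst (rmod_act1 _) (tens1l _)) tensm1l.
Defined.

End RModules.

Section Frobenius.
Variables (k : fieldType) (C : fintens k).

Definition frob_iso (A : algebra C) (lam : hom C A tunit) :
  hom C A (ldual A) := transp (lam ∘ algm A).

Definition frobenius_form (A : algebra C) (lam : hom C A tunit) : Prop :=
  iso (frob_iso lam).

Definition nakayama (A : algebra C) (lam : hom C A tunit) :
    hom C (ldual (ldual A)) A :=
  invm (frob_iso lam) ∘ dualm (frob_iso lam).

Record frobenius := Frobenius {
  frob_alg :> algebra C;
  frob_form : hom C frob_alg tunit;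
  frob_formP : frobenius_form frob_form
}.

Definition symmetric_frobenius (p : pivotal C) (A : frobenius) : Prop :=
  nakayama (frob_form A) ∘ p A = idm (A : C).

End Frobenius.

(* Main.v *)
From HB Require Import structures.
From mathcomp Require Import all_boot all_order all_algebra.
From mathcomp Require Import boolp.
Require Import Defs.

(* If M carries a pivotal structure, let P be a projective generator of M. Then
   Hom(P,-) preserves cokernels, A = Hom(P,P) is an algebra, and Hom(P,-) is an
   equivalence from M to C_A. The Serre isomorphism phi evaluated at the pivotal
   structure of P is a form lambda on A; naturality of phi in its first variable
   gives phi(pt o a)(b) = lambda(ab), so that lambda is a Frobenius form, while
   naturality in its second variable, together with the compatibility of the
   pivotal structure with the twist, says that lambda is symmetric.

   Conversely, let A be symmetric Frobenius. Then C_A has the identity as its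
   Serre functor, twisted by the inverse of p, so that the identity is a pivotal
   structure. To find phi, use lambda to turn P^* into a left A-module and the
   evaluation of P into an A-linear map tau : P^* o P -> A. The map
   theta : N o P^* -> Hom_A(P,N), theta(n o q)(x) = n tau(q o x), identifies
   Hom_A(P,N) with N o_A P^* when P is C-projective, and phi is characterized by
   phi(y)(theta(n o q)) = q(y(n)), the pairing of P with P^* being taken through
   p. It is A-balanced because A is symmetric. Finally the structure is
   transported along the equivalence of M with C_A. *)

Set Implicit Arguments.
Unset Strict Implicit.
Unset Printing Implicit Defensive.

Import GRing.Theory.
Local Open Scope ring_scope.
Local Open Scope kcat_scope.

(** * Kernels, cokernels and equivalences *)

Section KcatTheory.
Variables (k : fieldType) (C : kcat k).
Implicit Types X Y Z W : C.

(** The object N ⊗_A P^* is never constructed. Instead, [theta] is shown to have the universal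
    property of the projection onto it ([theta_epi], [theta_coker]): existence in this property
    produces φ, and uniqueness reduces each axiom of [serre_iso] to an identity of pairings on X ⊗ N
    ⊗ P^*. The property rests on Hom_A(P,-) preserving the cokernel N ⊗ A -> N, whence the
    restriction to C-projective P. The maps τ are chosen separately for each P, yet they are
    compatible with morphisms and with the action of C: a morphism into A is determined by its
    pairing through λ, and identities about τ are checked after pairing. The same nondegeneracy
    makes X ⊗ A cofree and gives Hom_A(P, X ⊗ A) = X ⊗ P^*, the case from which θ is built. In the
    forward direction the key morphism is the evaluation A ▷ P -> P: naturality of φ along it, in
    one variable and then in the other, becomes a statement on the multiplication of A. *)

Lemma linear_sub (U V : lmodType k) (f : U -> V) (x y : U) :
  linear f -> f (x - y) = f x - f y.
Proof. by move=> fL; rewrite addrC -scaleN1r fL scaleN1r addrC. Qed.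

Lemma compm0 X Y Z (g : hom C Y Z) : g ∘ (0 : hom C X Y) = 0.
Proof. exact: linear_zero (comp_linr g). Qed.

Lemma comp0m X Y Z (f : hom C X Y) : (0 : hom C Y Z) ∘ f = 0.
Proof. exact: linear_zero (comp_linl f). Qed.

Lemma compmB X Y Z (g : hom C Y Z) (f f' : hom C X Y) :
  g ∘ (f - f') = g ∘ f - g ∘ f'.
Proof. exact: linear_sub (comp_linr g). Qed.

Lemma compBm X Y Z (g g' : hom C Y Z) (f : hom C X Y) :
  (g - g') ∘ f = g ∘ f - g' ∘ f.
Proof. exact: (linear_sub _ _ (comp_linl f)). Qed.

(** Composites are kept nested to the right; [reA] and its variants rewrite with an equation between
    two factors when a tail follows them. *)
Lemma reA X Y Z Y' (g : hom C Y Z) (f : hom C X Y)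
    (g' : hom C Y' Z) (f' : hom C X Y') :
  g ∘ f = g' ∘ f' -> forall W (x : hom C W X), g ∘ (f ∘ x) = g' ∘ (f' ∘ x).
Proof. by move=> e W x; rewrite !compA e. Qed.

Lemma reA1 X Y Z (g : hom C Y Z) (f : hom C X Y) (h : hom C X Z) :
  g ∘ f = h -> forall W (x : hom C W X), g ∘ (f ∘ x) = h ∘ x.
Proof. by move=> e W x; rewrite !compA e. Qed.

Lemma reAid X Y (g : hom C Y X) (f : hom C X Y) :
  g ∘ f = idm X -> forall W (x : hom C W X), g ∘ (f ∘ x) = x.
Proof. by move=> e W x; rewrite !compA e comp1m. Qed.

Lemma cstKA X Y (e : X = Y) (e' : Y = X) W (f : hom C W X) :
  cst e' ∘ (cst e ∘ f) = f.
Proof. exact: reAid (cstK e e') _ _. Qed.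

Lemma iso_intro X Y (f : hom C X Y) (g : hom C Y X) :
  g ∘ f = idm X -> f ∘ g = idm Y -> iso f.
Proof. by move=> e1 e2; exists g; rewrite /is_inv e1 e2 !eqxx. Qed.

Lemma invmK X Y (f : hom C X Y) : iso f -> invm f ∘ f = idm X.
Proof.
by move=> fI; rewrite /invm; case: pselect => // h; case/andP: (xchooseP h) => /eqP.
Qed.

Lemma invmVK X Y (f : hom C X Y) : iso f -> f ∘ invm f = idm Y.
Proof.
by move=> fI; rewrite /invm; case: pselect => // h; case/andP: (xchooseP h) => _ /eqP.
Qed.

Lemma iso_epi X Y Z (f : hom C X Y) (g h : hom C Y Z) :
  iso f -> g ∘ f = h ∘ f -> g = h.
Proof.
by move=> fI e; rewrite -(compm1 g) -(compm1 h) -(invmVK fI) !compA e.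
Qed.

Lemma iso_mono X Y Z (f : hom C Y Z) (g h : hom C X Y) :
  iso f -> f ∘ g = f ∘ h -> g = h.
Proof.
by move=> fI e; rewrite -(comp1m g) -(comp1m h) -(invmK fI) -!compA e.
Qed.

Lemma invm_uniq X Y (f : hom C X Y) (g : hom C Y X) :
  g ∘ f = idm X -> f ∘ g = idm Y -> invm f = g.
Proof.
move=> e1 e2; have fI := iso_intro e1 e2.
by apply: (iso_mono fI); rewrite e2 invmVK.
Qed.

Lemma iso_comp X Y Z (g : hom C Y Z) (f : hom C X Y) :
  iso g -> iso f -> iso (g ∘ f).
Proof.
move=> gI fI; apply: (@iso_intro _ _ _ (invm f ∘ invm g)).
  by rewrite -!compA (reAid (invmK gI)) invmK.
by rewrite -!compA (reAid (invmVK fI)) invmVK.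
Qed.

Lemma iso_id X : iso (idm X).
Proof. by apply: (@iso_intro _ _ _ (idm X)); rewrite comp1m. Qed.

Lemma iso_cst X Y (e : X = Y) : iso (cst e).
Proof. by case: Y / e; apply: iso_id. Qed.

Lemma iso_invm X Y (f : hom C X Y) : iso f -> iso (invm f).
Proof. by move=> fI; apply: (iso_intro (invmVK fI) (invmK fI)). Qed.

Lemma invm_comp X Y Z (g : hom C Y Z) (f : hom C X Y) :
  iso g -> iso f -> invm (g ∘ f) = invm f ∘ invm g.
Proof.
move=> gI fI; apply: invm_uniq.
  by rewrite -!compA (reAid (invmK gI)) invmK.
by rewrite -!compA (reAid (invmVK fI)) invmVK.
Qed.

Lemma is_ker_mono X Y Z (i : hom C X Y) (g : hom C Y Z) :
  is_ker i g -> mono i.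
Proof.
move=> [gi0 U] W h h' e.
have [|u [_ uU]] := U _ (i ∘ h); first by rewrite compA gi0 comp0m.
by rewrite -(uU h) // -(uU h').
Qed.

Lemma is_coker_epi X Y Z (f : hom C X Y) (c : hom C Y Z) :
  is_coker f c -> forall W (h h' : hom C Z W), h ∘ c = h' ∘ c -> h = h'.
Proof.
move=> [cf0 U] W h h' e.
have [|u [_ uU]] := U _ (h ∘ c); first by rewrite -compA cf0 compm0.
by rewrite -(uU h) // -(uU h').
Qed.

Lemma is_ker_intro X Y Z (i : hom C X Y) (g : hom C Y Z) :
  g ∘ i = 0 -> mono i ->
  (forall W (h : hom C W Y), g ∘ h = 0 -> exists u, i ∘ u = h) -> is_ker i g.
Proof.
move=> gi iM U; split=> // W h /U[u uE]; exists u; split=> // u' u'E.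
by apply: iM; rewrite uE u'E.
Qed.

Lemma is_coker_intro X Y Z (f : hom C X Y) (c : hom C Y Z) :
  c ∘ f = 0 -> (forall W (h h' : hom C Z W), h ∘ c = h' ∘ c -> h = h') ->
  (forall W (h : hom C Y W), h ∘ f = 0 -> exists u, u ∘ c = h) -> is_coker f c.
Proof.
move=> cf cE U; split=> // W h /U[u uE]; exists u; split=> // u' u'E.
by apply: cE; rewrite uE u'E.
Qed.

(* A split epimorphism is the cokernel of any morphism through which the
   complementary idempotent factors. *)
Lemma split_coker X Y Z (f : hom C X Y) (c : hom C Y Z) (s : hom C Z Y)
    (h : hom C Y X) :
  c ∘ f = 0 -> c ∘ s = idm Z -> f ∘ h = idm Y - s ∘ c -> is_coker f c.
Proof.
move=> cf cs fh; apply: is_coker_intro => // W.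
  by move=> u v e; rewrite -(compm1 u) -(compm1 v) -cs !compA e.
move=> u uf; exists (u ∘ s); apply/esym/eqP; rewrite -subr_eq0 -compA.
by rewrite -{1}(compm1 u) -compmB -fh compA uf comp0m.
Qed.

Lemma is_ker_iso X Y Z X' Y' Z' (i : hom C X Y) (g : hom C Y Z)
    (i' : hom C X' Y') (g' : hom C Y' Z')
    (a : hom C X X') (b : hom C Y Y') (c : hom C Z Z') :
  iso a -> iso b -> iso c -> b ∘ i = i' ∘ a -> c ∘ g = g' ∘ b ->
  is_ker i g -> is_ker i' g'.
Proof.
move=> aI bI cI e1 e2 kig; apply: is_ker_intro.
- by apply: (iso_epi aI); rewrite -compA -e1 compA -e2 -compA kig.1 compm0 comp0m.
- move=> W h h' e; apply: (iso_mono (iso_invm aI)).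
  apply: (is_ker_mono kig); apply: (iso_mono bI).
  by rewrite !(compA b) e1 -!compA !(reAid (invmVK aI)).
- move=> W h g'h; have [|u [uE _]] := kig.2 _ (invm b ∘ h).
    apply: (iso_mono cI); rewrite compm0 compA e2 -compA.
    by rewrite (reAid (invmVK bI)).
  by exists (a ∘ u); rewrite compA -e1 -compA uE (reAid (invmVK bI)).
Qed.

Lemma is_coker_iso X Y Z X' Y' Z' (i : hom C X Y) (g : hom C Y Z)
    (i' : hom C X' Y') (g' : hom C Y' Z')
    (a : hom C X X') (b : hom C Y Y') (c : hom C Z Z') :
  iso a -> iso b -> iso c -> b ∘ i = i' ∘ a -> c ∘ g = g' ∘ b ->
  is_coker i g -> is_coker i' g'.
Proof.
move=> aI bI cI e1 e2 kig; apply: is_coker_intro.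
- by apply: (iso_epi aI); rewrite -compA -e1 compA -e2 -compA kig.1 compm0 comp0m.
- move=> W h h' e; apply: (iso_epi cI).
  apply: (is_coker_epi kig); rewrite -!compA e2 !compA.
  by rewrite e.
- move=> W h g'h; have [|u [uE _]] := kig.2 _ (h ∘ b).
    by rewrite -compA e1 compA g'h comp0m.
  exists (u ∘ invm c); apply: (iso_epi bI).
  by rewrite -!compA -e2 (reAid (invmK cI)) uE.
Qed.

End KcatTheory.

Section FunctorTheory.
Variables (k : fieldType).

Lemma fmap0 (C D : kcat k) (F : functor C D) X Y : fmap F (0 : hom C X Y) = 0.
Proof. exact: linear_zero (@fmap_lin k C D F X Y). Qed.

Lemma fmap_iso (C D : kcat k) (F : functor C D) X Y (f : hom C X Y) :
  iso f -> iso (fmap F f).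
Proof.
move=> fI; apply: (@iso_intro _ _ _ _ _ (fmap F (invm f))).
  by rewrite -fmapM invmK // fmap1.
by rewrite -fmapM invmVK // fmap1.
Qed.

Lemma fmap_invm (C D : kcat k) (F : functor C D) X Y (f : hom C X Y) :
  iso f -> invm (fmap F f) = fmap F (invm f).
Proof.
by move=> fI; apply: invm_uniq; rewrite -fmapM ?invmK ?invmVK // fmap1.
Qed.

Definition full (C D : kcat k) (F : functor C D) : Prop :=
  forall X Y (g : hom D (F X) (F Y)), exists f, fmap F f = g.

Definition faithful (C D : kcat k) (F : functor C D) : Prop :=
  forall X Y (f f' : hom C X Y), fmap F f = fmap F f' -> f = f'.

Definition ess_surj (C D : kcat k) (F : functor C D) : Prop :=
  forall Y, exists X (f : hom D (F X) Y), iso f.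

Lemma retract_faithful (C D : kcat k) (F : functor C D) (G : functor D C) :
  isomorphicF (compF G F) (idF C) -> faithful F.
Proof.
move=> [t [tI tN]] X Y f f' e; apply: (iso_epi (tI X)).
by have := tN _ _ f; have := tN _ _ f' => /= <- <-; rewrite e.
Qed.

Lemma equivalence_sym (C D : kcat k) (F : functor C D) :
  is_equivalence F -> exists2 G : functor D C, is_equivalence G &
    isomorphicF (compF G F) (idF C) /\ isomorphicF (compF F G) (idF D).
Proof. by move=> [G [h1 h2]]; exists G => //; exists F. Qed.

Lemma equivalence_faithful (C D : kcat k) (F : functor C D) :
  is_equivalence F -> faithful F.
Proof. by move=> [G [h _]]; apply: retract_faithful h. Qed.

Lemma equivalence_full (C D : kcat k) (F : functor C D) :
  is_equivalence F -> full F.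
Proof.
move=> [G [[t [tI tN]] h]] X Y g.
(* The quasi-inverse G is faithful too, because F G is isomorphic to the identity; so the candidate
   is compared with g after applying G. *)
exists (t Y ∘ fmap G g ∘ invm (t X)); apply: (retract_faithful h).
apply: (iso_mono (tI Y)); have /= -> := tN _ _ (t Y ∘ fmap G g ∘ invm (t X)).
by rewrite -!compA (invmK (tI X)) compm1.
Qed.

Lemma equivalence_ess_surj (C D : kcat k) (F : functor C D) :
  is_equivalence F -> ess_surj F.
Proof. by move=> [G [_ [t [tI tN]]]] Y; exists (G Y), (t Y); apply: tI. Qed.

Lemma ff_iso (C D : kcat k) (F : functor C D) X Y (f : hom C X Y) :
  full F -> faithful F -> iso (fmap F f) -> iso f.
Proof.
move=> Ff Fi fI; have [g gE] := Ff _ _ (invm (fmap F f)).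
apply: (@iso_intro _ _ _ _ _ g); apply: Fi; rewrite fmapM fmap1 gE.
  exact: invmK.
exact: invmVK.
Qed.

(** G is chosen on objects only; full faithfulness of F then forces its values on morphisms and all
    its laws. *)
Lemma equivalence_intro (C D : kcat k) (F : functor C D) :
  full F -> faithful F -> ess_surj F -> is_equivalence F.
Proof.
move=> Ff Fi Fs.
have [G0 Gp] := choice Fs.
pose t X := projT1 (cid (Gp X)).
have tI X : iso (t X) by apply: projT2 (cid (Gp X)).
have pre X Y (g : hom D X Y) :
    exists f : hom C (G0 X) (G0 Y), fmap F f = invm (t Y) ∘ g ∘ t X.
  exact: Ff.
pose G1 X Y g := projT1 (cid (pre X Y g)).
have G1E X Y g : fmap F (G1 X Y g) = invm (t Y) ∘ g ∘ t X.
  exact: projT2 (cid (pre X Y g)).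
have e1 X : G1 X X (idm X) = idm (G0 X).
  by apply: Fi; rewrite G1E fmap1 compm1 invmK.
have eM X Y Z (g : hom D Y Z) (f : hom D X Y) :
    G1 _ _ (g ∘ f) = G1 _ _ g ∘ G1 _ _ f.
  by apply: Fi; rewrite fmapM !G1E -!compA (reAid (invmVK (tI _))).
have eL X Y : linear (G1 X Y).
  move=> a f g; apply: Fi.
  by rewrite fmap_lin !G1E comp_linr comp_linl.
exists (Functor e1 eM eL); split; last first.
  exists t; split=> // X Y f /=.
  by rewrite G1E -!compA (reAid (invmVK (tI _))).
have ex X : exists s : hom C (G0 (F X)) X, fmap F s = t (F X) by apply: Ff.
pose s X := projT1 (cid (ex X)).
have sE X : fmap F (s X) = t (F X) by apply: projT2 (cid (ex X)).
exists s; split=> [X|X Y f] /=.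
  by apply: (ff_iso Ff Fi); rewrite sE.
apply: Fi; rewrite !fmapM !sE G1E -!compA.
by rewrite (reAid (invmVK (tI _))).
Qed.

Lemma equivalence_ker (C D : kcat k) (F : functor C D) X Y Z
    (i : hom C X Y) (g : hom C Y Z) :
  is_equivalence F -> is_ker i g -> is_ker (fmap F i) (fmap F g).
Proof.
move=> FE [gi U]; have Ff := equivalence_full FE.
have Fi := equivalence_faithful FE; apply: is_ker_intro.
- by rewrite -fmapM gi fmap0.
- move=> W; have [W' [w wI]] := equivalence_ess_surj FE W.
  move=> h h' e; apply: (iso_epi wI).
  have [a aE] := Ff _ _ (h ∘ w); have [b bE] := Ff _ _ (h' ∘ w).
  rewrite -aE -bE; congr fmap; apply: (is_ker_mono (conj gi U)).
  by apply: Fi; rewrite !fmapM aE bE !compA e.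
- move=> W h gh; have [W' [w wI]] := equivalence_ess_surj FE W.
  have [a aE] := Ff _ _ (h ∘ w).
  have [|u [uE _]] := U _ a.
    by apply: Fi; rewrite fmapM aE compA gh comp0m fmap0.
  exists (fmap F u ∘ invm w); rewrite compA -fmapM uE aE -compA invmVK //.
  by rewrite compm1.
Qed.

Lemma equivalence_coker (C D : kcat k) (F : functor C D) X Y Z
    (i : hom C X Y) (g : hom C Y Z) :
  is_equivalence F -> is_coker i g -> is_coker (fmap F i) (fmap F g).
Proof.
move=> FE [gi U]; have Ff := equivalence_full FE.
have Fi := equivalence_faithful FE; apply: is_coker_intro.
- by rewrite -fmapM gi fmap0.
- move=> W; have [W' [w wI]] := equivalence_ess_surj FE W.
  move=> h h' e; apply: (iso_mono (iso_invm wI)).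
  have [a aE] := Ff _ _ (invm w ∘ h); have [b bE] := Ff _ _ (invm w ∘ h').
  rewrite -aE -bE; congr fmap; apply: (is_coker_epi (conj gi U)).
  by apply: Fi; rewrite !fmapM aE bE -!compA e.
- move=> W h gh; have [W' [w wI]] := equivalence_ess_surj FE W.
  have [a aE] := Ff _ _ (invm w ∘ h).
  have [|u [uE _]] := U _ a.
    by apply: Fi; rewrite fmapM aE -compA gh compm0 fmap0.
  exists (w ∘ fmap F u); rewrite -compA -fmapM uE aE compA invmVK //.
  by rewrite comp1m.
Qed.

End FunctorTheory.

(** * Finite-dimensional modules *)

Section ModuleKcat.
Variables (k : fieldType) (A : fdalg k).
Local Notation mods := (mod_kcat A).

Lemma hom_equivariant (V W : fdmod A) (f : hom mods V W) v a :
  slval f (ract v a) = ract (slval f v) a.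
Proof. by case: f => f /= /asboolP ->. Qed.

Lemma mods_hom_ext (V W : fdmod A) (f g : hom mods V W) :
  (forall v, slval f v = slval g v) -> f = g.
Proof. by move=> e; apply: val_inj; apply/lfunP. Qed.

Lemma mods_hom_app (V W : fdmod A) (f g : hom mods V W) :
  f = g -> forall v, slval f v = slval g v.
Proof. by move=> ->. Qed.

Lemma mods_hom_intro (V W : fdmod A) (f : V -> W) :
  linear f -> (forall v a, f (ract v a) = ract (f v) a) ->
  exists g : hom mods V W, forall v, slval g v = f v.
Proof.
move=> fL fA.
pose fl : {linear V -> W} := HB.pack f (GRing.isLinear.Build _ _ _ _ _ fL).
have gP : linfun fl \in @equivariant k A V W.
  by apply/asboolP => v a; rewrite !(lfunE fl) /= fA.
by exists (SubL _ gP) => v; apply: (lfunE fl).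
Qed.

Lemma ract0l (V : fdmod A) a : ract (0 : V) a = 0.
Proof. exact: linear_zero (ract_linl a). Qed.

Section Submodule.
Variables (V : fdmod A) (U : {vspace V}).
Hypothesis UA : forall v a, v \in U -> ract v a \in U.

Definition sub_ract (v : subvs_of U) (a : A) : subvs_of U := vsproj U (ract (vsval v) a).

Lemma vsval_sub_ract v a : vsval (sub_ract v a) = ract (vsval v) a.
Proof. by rewrite /sub_ract vsprojK // UA ?subvsP. Qed.

Definition submodule : fdmod A.
Proof.
exists (subvs_of U) sub_ract.
- by move=> v a b; apply: subvs_inj; rewrite !vsval_sub_ract ractA.
- by move=> v; apply: subvs_inj; rewrite !vsval_sub_ract ract1.
- by move=> v c a b; rewrite /sub_ract ract_linr linearP.
- by move=> a c u v; rewrite /sub_ract linearP ract_linl linearP.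
Defined.

Lemma submodule_incl : exists i : hom mods submodule V, forall v, slval i v = vsval v.
Proof.
apply: mods_hom_intro => [c u v|v a]; first exact: linearP.
exact: vsval_sub_ract.
Qed.

End Submodule.

Section Quotient.
Variables (V : fdmod A) (U : {vspace V}).
Hypothesis UA : forall v a, v \in U -> ract v a \in U.

(** V/U is realized on the complement of U cut out by the projection [\1 - projv U], whose kernel is
    U; the carrier thus remains a space of the form [subvs_of]. *)
Let r : 'End(V) := (\1 - projv U)%VF.
Let W := limg r.
Let pr (v : V) : subvs_of W := vsproj W (r v).

Let rE v : r v = v - projv U v.
Proof. by rewrite /r add_lfunE opp_lfunE id_lfunE. Qed.

Let prE v : vsval (pr v) = r v.
Proof. by rewrite /pr vsprojK // memv_img ?memvf. Qed.

Let pr0 v : (pr v = 0) <-> v \in U.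
Proof.
split=> [e|vU]; last by apply: subvs_inj; rewrite prE rE projv_id // subrr linear0.
have := prE v; rewrite e linear0 rE => /esym/eqP; rewrite subr_eq0 => /eqP ->.
exact: memv_proj.
Qed.

Let prL : linear pr.
Proof. by move=> c u v; rewrite /pr !linearP. Qed.

Let prval w : pr (vsval w) = w.
Proof.
have [v vE] : exists v, vsval w = r v.
  by have /memv_imgP[v _ ->] := subvsP w; exists v.
apply: subvs_inj; rewrite prE vE !rE linearB /= (projv_id (memv_proj U v)).
by rewrite subrr subr0.
Qed.

Let prB u v : u - v \in U -> pr u = pr v.
Proof.
move/pr0 => e; apply/eqP; rewrite -subr_eq0; apply/eqP; rewrite -e.
exact/esym/(linear_sub _ _ prL).
Qed.

Let pract (v : V) a : pr (ract (vsval (pr v)) a) = pr (ract v a).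
Proof.
apply: prB; rewrite -(linear_sub _ _ (ract_linl a)); apply: UA.
by apply/pr0; rewrite (linear_sub _ _ prL) prval subrr.
Qed.

Definition quotient_module : fdmod A.
Proof.
exists (subvs_of W) (fun w a => pr (ract (vsval w) a)).
- by move=> w a b; rewrite pract ractA.
- by move=> w; rewrite ract1 prval.
- by move=> w c a b; rewrite ract_linr prL.
- by move=> a c u v; rewrite linearP ract_linl prL.
Defined.

Lemma quotient_proj : exists q : hom mods V quotient_module,
  (forall v, slval q v = 0 <-> v \in U) /\ (forall w, exists v, slval q v = w).
Proof.
have [|v a|q qE] := @mods_hom_intro V quotient_module pr; first exact: prL.
  by rewrite /= pract.
exists q; split=> [v|w]; first by rewrite qE; apply: pr0.
by exists (vsval w); rewrite qE prval.
Qed.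

End Quotient.

Lemma mods_sub (V W : fdmod A) (f : hom mods V W) u v :
  slval f (u - v) = slval f u - slval f v.
Proof. exact: linearB. Qed.

(** For the cokernel part: a map killing the kernel is constant on the fibres of g, so composing it
    with any set-theoretic section of g gives a linear equivariant factorization. *)
Lemma mods_ker (V W : fdmod A) (g : hom mods V W) :
  exists (K : mods) (i : hom mods K V),
    is_ker i g /\ ((forall w, exists v, slval g v = w) -> is_coker i g).
Proof.
have UA v a : v \in lker (slval g) -> ract v a \in lker (slval g).
  by rewrite !memv_ker hom_equivariant => /eqP ->; rewrite ract0l.
have [i iE] := submodule_incl UA; exists (submodule UA), i.
have gi v : slval g (slval i v) = 0.
  by apply/eqP; rewrite -memv_ker iE; apply: subvsP.
have gi0 : g ∘ i = 0 by apply: mods_hom_ext => v; rewrite /= !lfunE /= gi.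
have ker_im v : slval g v = 0 -> exists u, slval i u = v.
  move=> gv; exists (vsproj (lker (slval g)) v).
  by rewrite iE vsprojK // memv_ker gv.
split.
  apply: is_ker_intro => //.
    move=> X h h' e; apply: mods_hom_ext => x; apply: subvs_inj; rewrite -!iE.
    by have := mods_hom_app e x; rewrite /= !lfunE.
  move=> X h gh.
  have hU x : slval h x \in lker (slval g).
    rewrite memv_ker; have := mods_hom_app gh x.
    by rewrite /= !lfunE /= => ->.
  have [||u uE] := @mods_hom_intro X (submodule UA) (fun x => vsproj (lker (slval g)) (slval h x)).
  - by move=> c x y; rewrite !linearP.
  - by move=> x a; apply: subvs_inj; rewrite vsval_sub_ract // !vsprojK // hom_equivariant.
  exists u; apply: mods_hom_ext => x.
  by rewrite /= lfunE /= iE uE vsprojK.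
move=> gS; apply: is_coker_intro => //.
  move=> X h h' e; apply: mods_hom_ext => w; have [v <-] := gS w.
  by have := mods_hom_app e v; rewrite /= !lfunE.
move=> X h hi; have [s sE] := choice gS.
have hE v v' : slval g v = slval g v' -> slval h v = slval h v'.
  move=> e; have [|u uE] := ker_im (v - v'); first by rewrite mods_sub e subrr.
  apply/eqP; rewrite -subr_eq0 -mods_sub -uE.
  by have := mods_hom_app hi u; rewrite /= !lfunE /= => ->.
have [||u uE] := @mods_hom_intro W X (fun w => slval h (s w)).
- move=> c x y /=; rewrite -[RHS]linearP; apply: hE.
  rewrite [RHS]linearP; apply: etrans (sE _) _.
  by congr (_ *: _ + _); apply/esym/sE.
- move=> x a /=; rewrite -hom_equivariant; apply: hE; rewrite hom_equivariant.
  by apply: etrans (sE _) _; congr (ract _ _); apply/esym/sE.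
exists u; apply: mods_hom_ext => v.
by rewrite /= lfunE /= uE; apply: hE; rewrite sE.
Qed.

Lemma mods_coker (V W : fdmod A) (f : hom mods V W) :
  exists (Q : mods) (q : hom mods W Q), is_coker f q /\
    (forall w, slval q w = 0 -> exists v, slval f v = w) /\
    (forall z, exists w, slval q w = z).
Proof.
have UA w a : w \in limg (slval f) -> ract w a \in limg (slval f).
  by move=> /memv_imgP[v _ ->]; rewrite -hom_equivariant memv_img ?memvf.
have [q [qE qS]] := quotient_proj UA; exists (quotient_module UA), q.
have qim w : slval q w = 0 -> exists v, slval f v = w.
  by move/qE => /memv_imgP[v _ ->]; exists v.
split=> //; have [K [i [[_ iU] iC]]] := mods_ker q.
have qf0 : q ∘ f = 0.
  apply: mods_hom_ext => v; rewrite /= !lfunE /=; apply/qE.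
  by rewrite memv_img ?memvf.
apply: is_coker_intro => //; first exact: is_coker_epi (iC qS).
move=> X h hf; have [|u [uE _]] := (iC qS).2 _ h; last by exists u.
apply: mods_hom_ext => x; rewrite /= !lfunE /=.
have [|v <-] := qim (slval i x).
  by have := mods_hom_app (iC qS).1 x; rewrite /= !lfunE.
by have := mods_hom_app hf v; rewrite /= !lfunE.
Qed.

(** Comparison with the concrete quotient of [mods_coker], for which exactness holds on elements,
    through the maps given by the two universal properties. *)
Lemma mods_coker_exact (V W Z : fdmod A) (f : hom mods V W) (c : hom mods W Z) :
  is_coker f c -> (forall w, slval c w = 0 -> exists v, slval f v = w) /\
    (forall z, exists w, slval c w = z).
Proof.
move=> cf; have [Q [q [qf [qim qS]]]] := mods_coker f.
have [u [uE _]] := cf.2 _ q qf.1; have [v [vE _]] := qf.2 _ c cf.1.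
have uEx w : slval u (slval c w) = slval q w.
  by have := mods_hom_app uE w; rewrite /= lfunE.
have vEx w : slval v (slval q w) = slval c w.
  by have := mods_hom_app vE w; rewrite /= lfunE.
have vu : v ∘ u = idm (Z : mods).
  by apply: (is_coker_epi cf); rewrite -compA uE vE comp1m.
split=> [w cw|z]; first by apply: qim; rewrite -uEx cw linear0.
have [w wE] := qS (slval u z); exists w; rewrite -vEx wE.
by have := mods_hom_app vu z; rewrite /= !lfunE.
Qed.

Definition regular_module : fdmod A.
Proof.
exists A (@amul _ A).
- by move=> v a b; apply: amulA.
- by move=> v; apply: amul1r.
- by move=> v; apply: amul_linr.
- by move=> a; apply: amul_linl.
Defined.

Lemma regular_hom (V : fdmod A) (v : V) :
  exists h : hom mods regular_module V, slval h (aone A) = v.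
Proof.
have [||h hE] := @mods_hom_intro regular_module V (fun a => ract v a).
- by move=> c a b; rewrite ract_linr.
- by move=> a b; rewrite -ractA.
by exists h; rewrite hE ract1.
Qed.

Lemma regular_hom_ext (V : fdmod A) (h h' : hom mods regular_module V) :
  slval h (aone A) = slval h' (aone A) -> h = h'.
Proof.
move=> e; apply: mods_hom_ext => a.
have aE : a = ract (aone A : regular_module) a by rewrite /= amul1l.
by rewrite aE !hom_equivariant e.
Qed.

End ModuleKcat.

(** * Kernels, cokernels and a projective generator in finite abelian categories *)

Section FiniteAbelian.
Variables (k : fieldType) (M : kcat k).
Hypothesis MF : finite_abelian M.

Lemma ff_reflect_ker (D : kcat k) (F : functor M D) (X Y Z : M) (i : hom M X Y) (g : hom M Y Z) :
  full F -> faithful F -> is_ker (fmap F i) (fmap F g) -> is_ker i g.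
Proof.
move=> Ff Fi [gi U]; apply: is_ker_intro.
- by apply: Fi; rewrite fmapM gi fmap0.
- move=> W h h' e; apply: Fi; apply: (is_ker_mono (conj gi U)).
  by rewrite -!fmapM e.
- move=> W h gh; have [|u [uE _]] := U _ (fmap F h); first by rewrite -fmapM gh fmap0.
  have [u' u'E] := Ff _ _ u; exists u'; apply: Fi.
  by rewrite fmapM u'E.
Qed.

Lemma ff_reflect_coker (D : kcat k) (F : functor M D) (X Y Z : M) (f : hom M X Y) (c : hom M Y Z) :
  full F -> faithful F -> is_coker (fmap F f) (fmap F c) -> is_coker f c.
Proof.
move=> Ff Fi [cf U]; apply: is_coker_intro.
- by apply: Fi; rewrite fmapM cf fmap0.
- move=> W h h' e; apply: Fi; apply: (is_coker_epi (conj cf U)).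
  by rewrite -!fmapM e.
- move=> W h hf; have [|u [uE _]] := U _ (fmap F h); first by rewrite -fmapM hf fmap0.
  have [u' u'E] := Ff _ _ u; exists u'; apply: Fi.
  by rewrite fmapM u'E.
Qed.

Lemma finite_abelian_ker (X Y : M) (g : hom M X Y) : exists K (i : hom M K X), is_ker i g.
Proof.
have [A [F FE]] := MF; have Ff := equivalence_full FE; have Fi := equivalence_faithful FE.
have [K0 [i0 [iK _]]] := mods_ker (fmap F g).
have [K [w wI]] := equivalence_ess_surj FE K0.
have [i iE] := Ff _ _ (i0 ∘ w).
exists K, i; apply: (ff_reflect_ker Ff Fi).
apply: is_ker_iso (iso_invm wI) (iso_id _) (iso_id _) _ _ iK.
  by rewrite iE -compA invmVK // comp1m compm1.
by rewrite comp1m compm1.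
Qed.

Lemma finite_abelian_coker (X Y : M) (f : hom M X Y) : exists Z (c : hom M Y Z), is_coker f c.
Proof.
have [A [F FE]] := MF; have Ff := equivalence_full FE; have Fi := equivalence_faithful FE.
have [Z0 [c0 [cC _]]] := mods_coker (fmap F f).
have [Z [w wI]] := equivalence_ess_surj FE Z0.
have [c cE] := Ff _ _ (invm w ∘ c0).
exists Z, c; apply: (ff_reflect_coker Ff Fi).
apply: is_coker_iso (iso_id _) (iso_id _) (iso_invm wI) _ _ cC.
  by rewrite comp1m compm1.
by rewrite cE compm1.
Qed.

(* P corresponds to the regular module. *)
Lemma finite_abelian_generator : exists P : M,
  [/\ forall (X Y Z : M) (f : hom M X Y) (c : hom M Y Z) (h : hom M P Z),
       is_coker f c -> exists h', c ∘ h' = h,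
     forall (X Y Z : M) (f : hom M X Y) (c : hom M Y Z) (h : hom M P Y),
       is_coker f c -> c ∘ h = 0 -> exists h', f ∘ h' = h
   & forall (Y Z : M) (g : hom M Y Z),
       (forall h : hom M P Z, exists h', g ∘ h' = h) ->
       exists K (i : hom M K Y), is_ker i g /\ is_coker i g].
Proof.
have [A [F FE]] := MF; have Ff := equivalence_full FE; have Fi := equivalence_faithful FE.
have [P [w wI]] := equivalence_ess_surj FE (regular_module A).
(* A morphism out of P amounts to an element, the image of 1 in the regular module; lifting it along
   g means finding a preimage of this element. *)
have lift X Y (g : hom M X Y) (h : hom M P Y) x :
    slval (fmap F g) x = slval (fmap F h ∘ invm w) (aone A) -> exists h', g ∘ h' = h.
  move=> e; have [t tE] := regular_hom (x : F X : fdmod A).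
  have [h' h'E] := Ff _ _ (t ∘ w); exists h'; apply: Fi; rewrite fmapM h'E compA.
  have -> : fmap F g ∘ t = fmap F h ∘ invm w.
    by apply: regular_hom_ext; rewrite -e /= lfunE /= tE.
  by rewrite -compA invmK // compm1.
exists P; split.
- move=> X Y Z f c h /(equivalence_coker FE)/mods_coker_exact[_ cS].
  have [y yE] := cS (slval (fmap F h ∘ invm w) (aone A)).
  exact: lift yE.
- move=> X Y Z f c h /(equivalence_coker FE)/mods_coker_exact[cE _] ch.
  have [|x xE] := cE (slval (fmap F h ∘ invm w) (aone A)); last exact: lift xE.
  have e : fmap F c ∘ (fmap F h ∘ invm w) = 0 by rewrite compA -fmapM ch fmap0 comp0m.
  by have := mods_hom_app e (aone A); rewrite /= !lfunE /= lfunE.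
- move=> Y Z g gP.
  (* Every element of F Z comes from some P -> Z, so these lifts make F g surjective, and a
     surjection is the cokernel of its kernel. *)
  have gS z : exists y, slval (fmap F g) y = z.
    have [t tE] := regular_hom (z : F Z : fdmod A).
    have [h hE] := Ff _ _ (t ∘ w); have [h' h'E] := gP h.
    exists (slval (fmap F h' ∘ invm w) (aone A)).
    have e : fmap F g ∘ (fmap F h' ∘ invm w) = t.
      by rewrite compA -fmapM h'E hE -compA invmVK // compm1.
    by have := mods_hom_app e (aone A); rewrite tE /= lfunE.
  have [K0 [i0 [iK /(_ gS) iC]]] := mods_ker (fmap F g).
  have [K [v vI]] := equivalence_ess_surj FE K0.
  have [i iE] := Ff _ _ (i0 ∘ v); exists K, i.
  have e1 : idm (F Y) ∘ i0 = fmap F i ∘ invm v.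
    by rewrite iE -compA invmVK // comp1m compm1.
  have e2 : idm (F Z) ∘ fmap F g = fmap F g ∘ idm (F Y) by rewrite comp1m compm1.
  split; [apply: (ff_reflect_ker Ff Fi) | apply: (ff_reflect_coker Ff Fi)].
    exact: is_ker_iso (iso_invm vI) (iso_id _) (iso_id _) e1 e2 iK.
  exact: is_coker_iso (iso_invm vI) (iso_id _) (iso_id _) e1 e2 iC.
Qed.

End FiniteAbelian.

Notation "X ◁ f" := (idm X ▶ f) (at level 37, right associativity) : kcat_scope.
Notation "f ▹ N" := (f ▶ idm N) (at level 37, no associativity) : kcat_scope.

(** * Right-nested tensor calculus *)

Arguments act : simpl never.
Arguments actm : simpl never.

Section ModuleCategory.
Variables (k : fieldType) (C : moncat k) (M : modcat C).
Implicit Types (X Y Z W : C) (N P Q : M).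

Lemma actlM X N P Q (g : hom M P Q) (f : hom M N P) :
  X ◁ (g ∘ f) = X ◁ g ∘ X ◁ f.
Proof. by rewrite -actmM comp1m. Qed.

Lemma actl_eq X N P P' Q (g : hom M P Q) (f : hom M N P) (g' : hom M P' Q)
    (f' : hom M N P') : g ∘ f = g' ∘ f' -> X ◁ g ∘ X ◁ f = X ◁ g' ∘ X ◁ f'.
Proof. by move=> e; rewrite -!actlM e. Qed.

Lemma actl_eq1 X N P Q (g : hom M P Q) (f : hom M N P) (h : hom M N Q) :
  g ∘ f = h -> X ◁ g ∘ X ◁ f = X ◁ h.
Proof. by move=> e; rewrite -!actlM e. Qed.

Lemma actl_eqid X N P (g : hom M P N) (f : hom M N P) :
  g ∘ f = idm N -> X ◁ g ∘ X ◁ f = idm (X ▷ N).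
Proof. by move=> e; rewrite -!actlM e actm1. Qed.

Lemma actrM X Y Z N (g : hom C Y Z) (f : hom C X Y) :
  (g ∘ f) ▹ N = g ▹ N ∘ f ▹ N.
Proof. by rewrite -actmM comp1m. Qed.

Lemma act_lr X Y N P (f : hom C X Y) (g : hom M N P) :
  f ▶ g = f ▹ P ∘ X ◁ g.
Proof. by rewrite -actmM comp1m compm1. Qed.

Lemma act_swap X Y N P (f : hom C X Y) (g : hom M N P) :
  f ▹ P ∘ X ◁ g = Y ◁ g ∘ f ▹ N.
Proof. by rewrite -!actmM !comp1m !compm1. Qed.

Lemma cst_actl X N P (e : N = P) :
  X ◁ cst e = cst (congr1 (fun Q => X ▷ Q) e).
Proof. by case: P / e; rewrite actm1. Qed.

Lemma cst_actr X Y N (e : X = Y) :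
  cst e ▹ N = cst (congr1 (fun Z => Z ▷ N) e).
Proof. by case: Y / e; rewrite actm1. Qed.

Lemma actl_cstK X N P (e : N = P) (e' : P = N) : X ◁ cst e' ∘ X ◁ cst e = idm _.
Proof. by rewrite -actlM cstK actm1. Qed.

Lemma actA_nat X X' Y Y' N N' (f : hom C X X') (g : hom C Y Y') (h : hom M N N') :
  cst (actA X' Y' N') ∘ (f ⊠ g) ▶ h = f ▶ (g ▶ h) ∘ cst (actA X Y N).
Proof. exact: actmA. Qed.

Lemma actA_natl X Y N N' (h : hom M N N') :
  cst (actA X Y N') ∘ (X ⊗ Y) ◁ h = X ◁ (Y ◁ h) ∘ cst (actA X Y N).
Proof. by rewrite -actmA tensm1. Qed.

Lemma tens_actl X Y N N' (h : hom M N N') :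
  (X ⊗ Y) ◁ h = cst (esym (actA X Y N')) ∘ X ◁ (Y ◁ h) ∘ cst (actA X Y N).
Proof. by rewrite -compA -actA_natl cstKA. Qed.

Lemma actAi_natl X Y N N' (h : hom M N N')
    (e' : X ▷ Y ▷ N' = (X ⊗ Y) ▷ N') :
  cst e' ∘ X ◁ (Y ◁ h) = (X ⊗ Y) ◁ h ∘ cst (esym (actA X Y N)).
Proof.
apply: (iso_mono (iso_cst (actA X Y N'))); rewrite cstKA compA actA_natl.
by rewrite -compA cstK compm1.
Qed.

Lemma act1_nat N N' (h : hom M N N') :
  cst (act1 N') ∘ tunit ◁ h = h ∘ cst (act1 N).
Proof. exact: actm1l. Qed.

Lemma act1i_nat N N' (h : hom M N N') (e' : N' = tunit ▷ N') :
  cst e' ∘ h = tunit ◁ h ∘ cst (esym (act1 N)).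
Proof.
apply: (iso_mono (iso_cst (act1 N'))); rewrite cstKA compA actm1l.
by rewrite -compA cstK compm1.
Qed.

Lemma tens_act X X' Y Y' N N' (f : hom C X X') (g : hom C Y Y') (h : hom M N N') :
  (f ⊠ g) ▶ h = cst (esym (actA X' Y' N')) ∘ f ▶ (g ▶ h) ∘ cst (actA X Y N).
Proof. by rewrite -compA -actmA cstKA. Qed.

Lemma cst_tensA_act X Y Z N :
  cst (tensA X Y Z) ▹ N = cst (esym (actA X (Y ⊗ Z) N)) ∘ X ◁ cst (esym (actA Y Z N))
    ∘ cst (actA X Y (Z ▷ N)) ∘ cst (actA (X ⊗ Y) Z N).
Proof. by rewrite cst_actr cst_actl !cst_trans; apply: cst_pi. Qed.

Lemma cst_tensAi_act X Y Z N (e : X ⊗ Y ⊗ Z = (X ⊗ Y) ⊗ Z) :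
  cst e ▹ N = cst (esym (actA (X ⊗ Y) Z N)) ∘ cst (esym (actA X Y (Z ▷ N)))
    ∘ X ◁ cst (actA Y Z N) ∘ cst (actA X (Y ⊗ Z) N).
Proof. by rewrite cst_actr cst_actl !cst_trans; apply: cst_pi. Qed.

Lemma cst_tens1l_act X N :
  cst (tens1l X) ▹ N = cst (act1 (X ▷ N)) ∘ cst (actA tunit X N).
Proof. by rewrite cst_actr !cst_trans; apply: cst_pi. Qed.

Lemma cst_tens1r_act X N :
  cst (tens1r X) ▹ N = X ◁ cst (act1 N) ∘ cst (actA X tunit N).
Proof. by rewrite cst_actr cst_actl !cst_trans; apply: cst_pi. Qed.

Lemma cst_tens1li_act X N (e : X = tunit ⊗ X) :
  cst e ▹ N = cst (esym (actA tunit X N)) ∘ cst (esym (act1 (X ▷ N))).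
Proof. by rewrite cst_actr !cst_trans; apply: cst_pi. Qed.

Lemma cst_tens1ri_act X N (e : X = X ⊗ tunit) :
  cst e ▹ N = cst (esym (actA X tunit N)) ∘ X ◁ cst (esym (act1 N)).
Proof. by rewrite cst_actr cst_actl !cst_trans; apply: cst_pi. Qed.

(* Morphisms of C are made to act in front of an arbitrary tail N, between
   right-nested objects X ▷ Y ▷ N; the strictness casts then stay inside these
   definitions, which are locked so that rewriting with associativity does not
   look inside them. *)
Definition cap X Y (t : hom C (X ⊗ Y) tunit) N : hom M (X ▷ Y ▷ N) N :=
  locked (cst (act1 N) ∘ t ▹ N ∘ cst (esym (actA X Y N))).

Lemma capE X Y (t : hom C (X ⊗ Y) tunit) N :
  cap t N = cst (act1 N) ∘ t ▹ N ∘ cst (esym (actA X Y N)).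
Proof. by rewrite /cap -lock. Qed.

Definition cup X Y (t : hom C tunit (X ⊗ Y)) N : hom M N (X ▷ Y ▷ N) :=
  locked (cst (actA X Y N) ∘ t ▹ N ∘ cst (esym (act1 N))).

Lemma cupE X Y (t : hom C tunit (X ⊗ Y)) N :
  cup t N = cst (actA X Y N) ∘ t ▹ N ∘ cst (esym (act1 N)).
Proof. by rewrite /cup -lock. Qed.

Definition mul2 X Y Z (t : hom C (X ⊗ Y) Z) N : hom M (X ▷ Y ▷ N) (Z ▷ N) :=
  locked (t ▹ N ∘ cst (esym (actA X Y N))).

Lemma mul2E X Y Z (t : hom C (X ⊗ Y) Z) N :
  mul2 t N = t ▹ N ∘ cst (esym (actA X Y N)).
Proof. by rewrite /mul2 -lock. Qed.

Definition elt X (t : hom C tunit X) N : hom M N (X ▷ N) :=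
  locked (t ▹ N ∘ cst (esym (act1 N))).

Lemma eltE X (t : hom C tunit X) N :
  elt t N = t ▹ N ∘ cst (esym (act1 N)).
Proof. by rewrite /elt -lock. Qed.

Definition form X (t : hom C X tunit) N : hom M (X ▷ N) N :=
  locked (cst (act1 N) ∘ t ▹ N).

Lemma formE X (t : hom C X tunit) N :
  form t N = cst (act1 N) ∘ t ▹ N.
Proof. by rewrite /form -lock. Qed.

Lemma cap_nat X Y (t : hom C (X ⊗ Y) tunit) N P (f : hom M N P) :
  cap t P ∘ X ◁ (Y ◁ f) = f ∘ cap t N.
Proof.
rewrite !capE -!compA actAi_natl (reA (act_swap _ _)) compA act1_nat.
by rewrite -compA.
Qed.

Lemma cup_nat X Y (t : hom C tunit (X ⊗ Y)) N P (f : hom M N P) :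
  cup t P ∘ f = X ◁ (Y ◁ f) ∘ cup t N.
Proof.
rewrite !cupE -!compA act1i_nat (reA (act_swap _ _)) !compA.
by rewrite actA_natl.
Qed.

Lemma mul2_nat X Y Z (t : hom C (X ⊗ Y) Z) N P (f : hom M N P) :
  mul2 t P ∘ X ◁ (Y ◁ f) = Z ◁ f ∘ mul2 t N.
Proof. by rewrite !mul2E -!compA actAi_natl (reA (act_swap _ _)). Qed.

Lemma mul2_comp X Y Z W (s : hom C Z W) (t : hom C (X ⊗ Y) Z) N :
  mul2 (s ∘ t) N = s ▹ N ∘ mul2 t N.
Proof. by rewrite !mul2E actrM compA. Qed.

Lemma mul2_tens X X' Y Z (t : hom C (X ⊗ Y) Z) (f : hom C X' X) N :
  mul2 (t ∘ (f ⊠ idm Y)) N = mul2 t N ∘ f ▹ (Y ▷ N).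
Proof.
rewrite !mul2E actrM tens_act actm1 -!compA; congr (_ ∘ (_ ∘ _)).
by rewrite cstK compm1.
Qed.

Lemma mul2_tensr X Y Y' Z (t : hom C (X ⊗ Y) Z) (g : hom C Y' Y) N :
  mul2 (t ∘ (idm X ⊠ g)) N = mul2 t N ∘ X ◁ (g ▹ N).
Proof.
rewrite !mul2E actrM tens_act -!compA; congr (_ ∘ (_ ∘ _)).
by rewrite cstK compm1.
Qed.

Lemma cap_tens X X' Y (t : hom C (X ⊗ Y) tunit) (f : hom C X' X) N :
  cap (t ∘ (f ⊠ idm Y)) N = cap t N ∘ f ▹ (Y ▷ N).
Proof.
rewrite !capE actrM tens_act actm1 -!compA; congr (_ ∘ (_ ∘ (_ ∘ _))).
by rewrite cstK compm1.
Qed.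

Lemma mul2_inj X Y Z (t t' : hom C (X ⊗ Y) Z) N :
  mul2 t N = mul2 t' N -> t ▹ N = t' ▹ N.
Proof. by rewrite !mul2E => e; apply: (iso_epi (iso_cst _) e). Qed.

Lemma elt_nat X (t : hom C tunit X) N P (f : hom M N P) :
  elt t P ∘ f = X ◁ f ∘ elt t N.
Proof. by rewrite !eltE -!compA act1i_nat (reA (act_swap _ _)). Qed.

End ModuleCategory.
Arguments actl_eq {k C M X N P P' Q g f g' f'} _.
Arguments actl_eq1 {k C M X N P Q g f h} _.
Arguments actl_eqid {k C M X N P g f} _.

Section Regular.
Variables (k : fieldType) (C : moncat k).

Definition regmod : modcat C.
Proof.
exists (mon_kcat C) (@tens k C) (@tensm k C) (@tensA k C) (@tens1l k C).
- exact: tensm1.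
- exact: tensmM.
- exact: tensm_linr.
- exact: tensm_linl.
- exact: tensmA.
- exact: tensm1l.
Defined.

(** The tail [tunit] loses nothing since X ⊗ 1 = X; equalities in C may therefore be checked in the
    tail calculus, with C acting on itself. *)
Lemma tens_faithful X Y (f g : hom C X Y) :
  (f : hom C X Y) ▶ idm (tunit : regmod) = g ▶ idm (tunit : regmod) -> f = g.
Proof.
move=> e; apply: (iso_epi (iso_cst (tens1r X))).
by rewrite -!tensm1r; congr (_ ∘ _).
Qed.

Lemma tens_faithfulP X Y (f g : hom C X Y) :
  (forall Z : regmod, f ▹ Z = g ▹ Z) -> f = g.
Proof. by move=> e; apply: tens_faithful. Qed.

End Regular.
Arguments regmod {k} C.

(* Expands a whiskered composite into right-nested form, then merges the
   casts, which all relate right-nested objects. *)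
Ltac nest :=
  rewrite ?actrM ?tens_act;
  repeat progress rewrite ?actlM ?actrM ?tens_act;
  rewrite ?cst_tensA_act ?cst_tensAi_act ?cst_tens1l_act ?cst_tens1r_act
    ?cst_tens1li_act ?cst_tens1ri_act ?actm1 ?actlM.
Ltac cst_merge :=
  rewrite ?cst_actl ?cst_actr -?compA;
  rewrite ?(reA1 (cst_trans _ _)) ?cst_trans ?cst_id ?comp1m ?compm1.
Ltac cst_eq :=
  cst_merge; repeat first [reflexivity | exact: cst_pi | congr (_ ∘ _)].

Section TailsOfTails.
Variables (k : fieldType) (C : moncat k) (M : modcat C).
Implicit Types (X Y Z W : C) (N : M).

Lemma cap_act X Y (t : hom C (X ⊗ Y) tunit) W N :
  (cap t (W : regmod C) : hom C (X ⊗ Y ⊗ W) W) ▹ N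
  = cap t (W ▷ N) ∘ (X ◁ cst (actA Y W N) ∘ cst (actA X (Y ⊗ W) N)).
Proof. by rewrite !capE; nest; cst_eq. Qed.

End TailsOfTails.

Section Balanced.
Variables (k : fieldType) (C : moncat k).
Variables (N B V W : C) (h : hom C (N ⊗ V) W) (r : hom C (N ⊗ B) N) (l : hom C (B ⊗ V) V).

(** The tail form is the one that computations consume and produce; the single equation in C is the
    one that can be tested by evaluation or whiskered with a morphism. *)
Lemma balancedP :
  h ∘ (r ⊠ idm V) = h ∘ (idm N ⊠ l) ∘ cst (tensA N B V) <->
  forall Z : regmod C, mul2 h Z ∘ mul2 r (V ▷ Z) = mul2 h Z ∘ N ◁ mul2 l Z.
Proof.
have eR (Z : regmod C) : mul2 h Z ∘ N ◁ mul2 l Z =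
   (h ∘ (idm N ⊠ l) ∘ cst (tensA N B V)) ▹ Z ∘ cst (esym (actA _ _ _)) ∘ cst (esym (actA _ _ _)).
  by rewrite !mul2E; nest; cst_eq.
have eL (Z : regmod C) : mul2 h Z ∘ mul2 r (V ▷ Z) =
   (h ∘ (r ⊠ idm V)) ▹ Z ∘ cst (esym (actA _ _ _)) ∘ cst (esym (actA _ _ _)).
  by rewrite !mul2E; nest; cst_eq.
split=> [e Z|e]; first by rewrite eR eL e.
apply: tens_faithfulP => Z; move: (e Z); rewrite eR eL.
by move/(iso_epi (iso_cst _))/(iso_epi (iso_cst _)).
Qed.

End Balanced.

(** * Duality *)

Section DualPairs.
Variables (k : fieldType) (C : moncat k) (M : modcat C).
Variables (L X : C) (e : hom C (L ⊗ X) tunit) (c : hom C tunit (X ⊗ L)).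
Hypothesis ecP : dual_pair e c.

Lemma dual_zig1 (N : M) : X ◁ cap e N ∘ cup c (X ▷ N) = idm (X ▷ N).
Proof.
have [/(congr1 (fun f => f ▹ N)) + _] := ecP.
rewrite !actrM cst_tens1r_act !tens_act cst_tensA_act cst_tens1l_act actm1.
rewrite !capE !cupE !actlM -!compA !cstKA => h.
apply: (iso_epi (iso_comp (iso_cst (act1 (X ▷ N))) (iso_cst (actA tunit X N)))).
by rewrite comp1m -[RHS]h -!compA !cstKA.
Qed.

Lemma dual_zig2 (N : M) : cap e (L ▷ N) ∘ L ◁ cup c N = idm (L ▷ N).
Proof.
have [_ /(congr1 (fun f => f ▹ N))] := ecP.
rewrite !actrM cst_tens1r_act !tens_act cst_tensAi_act cst_tens1l_act actm1.
rewrite !capE !cupE !actlM -!compA !cstKA => h.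
apply: (iso_epi (iso_comp (iso_cst (congr1 (act L) (act1 N))) (iso_cst (actA L tunit N)))).
rewrite comp1m -cst_actl -[RHS]h -!compA.
by rewrite !(reAid (actl_cstK _ _ _)).
Qed.

End DualPairs.

Section Duals.
Variables (k : fieldType) (C : fintens k) (M : modcat C).
Implicit Types (X Y Z W : C) (N P Q : M).

Definition evN X N : hom M (ldual X ▷ X ▷ N) N := cap (ev X) N.
Definition coevN X N : hom M N (X ▷ ldual X ▷ N) := cup (coev X) N.

Lemma evN_nat X N P (f : hom M N P) :
  evN X P ∘ ldual X ◁ (X ◁ f) = f ∘ evN X N.
Proof. exact: cap_nat. Qed.

Lemma coevN_nat X N P (f : hom M N P) :
  coevN X P ∘ f = X ◁ (ldual X ◁ f) ∘ coevN X N.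
Proof. exact: cup_nat. Qed.

Lemma zig1 X N : X ◁ evN X N ∘ coevN X (X ▷ N) = idm (X ▷ N).
Proof. exact: dual_zig1 (ldualP X) N. Qed.

Lemma zig2 X N : evN X (ldual X ▷ N) ∘ ldual X ◁ coevN X N = idm (ldual X ▷ N).
Proof. exact: dual_zig2 (ldualP X) N. Qed.

Lemma transp_act Z X (t : hom C (Z ⊗ X) tunit) N :
  transp t ▹ N = cap t (ldual X ▷ N) ∘ Z ◁ coevN X N.
Proof.
rewrite /transp !actrM cst_tens1l_act !tens_act cst_tensAi_act cst_tens1ri_act.
rewrite /coevN !cupE !capE actm1 !actlM -!compA !cstKA.
by [].
Qed.

Lemma evN_transp Z X (t : hom C (Z ⊗ X) tunit) N :
  evN X N ∘ transp t ▹ (X ▷ N) = cap t N.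
Proof.
rewrite transp_act compA -cap_nat -compA -!actlM zig1 !actm1.
by rewrite compm1.
Qed.

(* A morphism into X^* is recovered from its pairing with X. *)
Lemma ldual_act Z X (a : hom C Z (ldual X)) N :
  a ▹ N = (evN X (ldual X ▷ N) ∘ a ▹ (X ▷ ldual X ▷ N)) ∘ Z ◁ coevN X N.
Proof. by rewrite -compA act_swap compA zig2 comp1m. Qed.

End Duals.

Section DualMorphisms.
Variables (k : fieldType) (C : fintens k).
Implicit Types (X Y Z W : C).

Lemma ldual_inj Z X (a b : hom C Z (ldual X)) :
  (forall N : regmod C, evN X N ∘ a ▹ (X ▷ N) = evN X N ∘ b ▹ (X ▷ N)) ->
  a = b.
Proof. by move=> e; apply: tens_faithfulP => N; rewrite (ldual_act a) (ldual_act b) e. Qed.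

Variable M : modcat C.
Implicit Types (N : M).

Lemma evN_dualm X Y (f : hom C X Y) N :
  evN X N ∘ dualm f ▹ (X ▷ N) = evN Y N ∘ ldual Y ◁ (f ▹ N).
Proof.
rewrite evN_transp /evN !capE actrM tens_act -!compA cstK compm1.
by [].
Qed.

End DualMorphisms.

Section DualPairUniqueness.
Variables (k : fieldType) (C : fintens k).
Implicit Types (X Y Z W V : C).

(** Transposition for the adjunction - ⊗ X ⊣ - ⊗ X^*; [lcur] is the one for X^* ⊗ - ⊣ X ⊗ -. *)
Definition rcur W X V (s : hom C (W ⊗ X) V) : hom C W (V ⊗ ldual X) :=
  (s ⊠ idm (ldual X)) ∘ cst (esym (tensA W X (ldual X))) ∘ (idm W ⊠ coev X)
    ∘ cst (esym (tens1r W)).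

Definition lcur X W V (s : hom C (ldual X ⊗ W) V) : hom C W (X ⊗ V) :=
  (idm X ⊠ s) ∘ cst (tensA X (ldual X) W) ∘ (coev X ⊠ idm W)
    ∘ cst (esym (tens1l W)).

Lemma rcur_act (M : modcat C) W X V (s : hom C (W ⊗ X) V) (N : M) :
  cst (actA V (ldual X) N) ∘ rcur s ▹ N = mul2 s (ldual X ▷ N) ∘ W ◁ coevN X N.
Proof.
rewrite /rcur /coevN mul2E cupE. nest; cst_eq.
Qed.

Lemma lcur_act (M : modcat C) X W V (s : hom C (ldual X ⊗ W) V) (N : M) :
  cst (actA X V N) ∘ lcur s ▹ N = X ◁ mul2 s N ∘ coevN X (W ▷ N).
Proof.
rewrite /lcur /coevN mul2E cupE. nest; cst_eq.
Qed.

(** Uniqueness of left duals: the inverse is the same transposition with the two dual pairs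
    exchanged. *)
Lemma dual_pair_iso (L X : C) (e : hom C (L ⊗ X) tunit)
    (c : hom C tunit (X ⊗ L)) : dual_pair e c -> iso (transp e).
Proof.
move=> ecP.
pose g : hom C (ldual X) L := cst (tens1l L) ∘ (ev X ⊠ idm L)
  ∘ cst (esym (tensA (ldual X) X L)) ∘ (idm (ldual X) ⊠ c)
  ∘ cst (esym (tens1r (ldual X))).
have gE (N : regmod C) : g ▹ N = evN X (L ▷ N) ∘ ldual X ◁ cup c N.
  by rewrite /g /evN !capE cupE; nest; cst_eq.
apply: (@iso_intro _ _ _ _ _ g); last first.
  apply: ldual_inj => N; rewrite actrM compA evN_transp gE compA -cap_nat.
  by rewrite -compA -actlM (dual_zig1 ecP) !actm1.
apply: tens_faithfulP => N; rewrite actrM gE -compA -act_swap compA.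
by rewrite evN_transp (dual_zig2 ecP) actm1.
Qed.

(** The nested coevaluation. With [evM] it exhibits Y^* ⊗ X^* as a left dual of X ⊗ Y, and [dualM],
    being the transpose of [evM], is invertible for that reason. *)
Definition coevM X Y : hom C tunit ((X ⊗ Y) ⊗ ldual Y ⊗ ldual X) :=
  cst (esym (tensA X Y (ldual Y ⊗ ldual X))) ∘ (idm X ⊠ cst (tensA Y (ldual Y) (ldual X)))
   ∘ (idm X ⊠ (coev Y ⊠ idm (ldual X))) ∘ (idm X ⊠ cst (esym (tens1l (ldual X))))
   ∘ coev X.

Lemma coevM_act (M : modcat C) X Y (N : M) :
  cup (coevM X Y) N = (X ⊗ Y) ◁ cst (esym (actA (ldual Y) (ldual X) N)) ∘
    (cst (esym (actA X Y _)) ∘ (X ◁ coevN Y (ldual X ▷ N) ∘ coevN X N)).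
Proof.
rewrite /coevM /coevN !cupE; nest; cst_eq.
Qed.

Definition evM X Y : hom C ((ldual Y ⊗ ldual X) ⊗ X ⊗ Y) tunit :=
  ev Y ∘ (idm (ldual Y) ⊠ (cst (tens1l Y) ∘ (ev X ⊠ idm Y)
            ∘ cst (esym (tensA (ldual X) X Y))))
          ∘ cst (tensA (ldual Y) (ldual X) (X ⊗ Y)).

Lemma evM_act (M : modcat C) X Y (N : M) :
  cap (evM X Y) N = evN Y N ∘ (ldual Y ◁ evN X (Y ▷ N) ∘
    (cst (actA (ldual Y) (ldual X) (X ▷ Y ▷ N)) ∘
     (ldual Y ⊗ ldual X) ◁ cst (actA X Y N))).
Proof.
rewrite /evM /evN !capE; nest; cst_eq.
Qed.

Lemma evN_dualM (M : modcat C) X Y (N : M) :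
  evN (X ⊗ Y) N ∘ dualM X Y ▹ ((X ⊗ Y) ▷ N)
  = evN Y N ∘ (ldual Y ◁ evN X (Y ▷ N) ∘
    (cst (actA (ldual Y) (ldual X) (X ▷ Y ▷ N)) ∘
     (ldual Y ⊗ ldual X) ◁ cst (actA X Y N))).
Proof. by rewrite evN_transp -/(evM X Y) evM_act. Qed.

Lemma dual_pair_intro (L X : C) (e : hom C (L ⊗ X) tunit) (c : hom C tunit (X ⊗ L)) :
  (forall Z : regmod C, X ◁ cap e Z ∘ cup c (X ▷ Z) = idm (X ▷ Z)) ->
  (forall Z : regmod C, cap e (L ▷ Z) ∘ L ◁ cup c Z = idm (L ▷ Z)) ->
  dual_pair e c.
Proof.
move=> z1 z2; split; apply: tens_faithfulP => Z; nest.
  apply: (iso_epi (iso_cst (esym (actA tunit X Z)))).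
  apply: (iso_epi (iso_cst (esym (act1 (X ▷ Z))))).
  by move: (z1 Z); rewrite capE cupE; nest; cst_merge => h; apply: etrans _ h; cst_eq.
apply: (iso_epi (iso_cst (esym (actA L tunit Z)))).
apply: (iso_epi (iso_cst (congr1 (act L) (esym (act1 Z))))).
by move: (z2 Z); rewrite capE cupE; nest; cst_merge => h; apply: etrans _ h; cst_eq.
Qed.

Lemma dualM_iso X Y : iso (dualM X Y).
Proof.
apply: (@dual_pair_iso _ _ _ (coevM X Y)); apply: dual_pair_intro => Z.
  rewrite (evM_act X Y Z) coevM_act.
  apply: (iso_epi (iso_cst (esym (actA X Y Z)))).
  rewrite -!compA coevN_nat (reA (actl_eq (coevN_nat _ _))) !tens_actl !actlM.
  rewrite -!compA; cst_merge.
  rewrite -(reA (actl_eq (coevN_nat _ _))) zig1 compm1.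
  by rewrite (actl_eqid (zig1 _ _)) compm1.
rewrite (evM_act X Y) coevM_act.
apply: (iso_mono (iso_cst (actA (ldual Y) (ldual X) Z))).
apply: (iso_epi (iso_cst (esym (actA (ldual Y) (ldual X) Z)))).
rewrite -!compA -(reA (evN_nat _ _)) -(reA (actl_eq (evN_nat _ _))).
rewrite !tens_actl !actlM -!compA; cst_merge.
rewrite (reA (actl_eq (evN_nat _ _))).
by rewrite (actl_eqid (zig2 _ _)) compm1 zig2 cstK.
Qed.

(* The canonical pairing of X with X^*, in the order opposite to that of ev. *)
Definition pivN (p : pivotal C) (M : modcat C) X (N : M) :
    hom M (X ▷ ldual X ▷ N) N :=
  locked (evN (ldual X) N ∘ p X ▹ (ldual X ▷ N)).

Lemma pivNE (p : pivotal C) (M : modcat C) X (N : M) :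
  pivN p X N = evN (ldual X) N ∘ p X ▹ (ldual X ▷ N).
Proof. by rewrite /pivN -lock. Qed.

Lemma pivN_nat (p : pivotal C) (M : modcat C) X (N P : M) (f : hom M N P) :
  pivN p X P ∘ X ◁ (ldual X ◁ f) = f ∘ pivN p X N.
Proof. by rewrite !pivNE -!compA act_swap compA evN_nat -compA. Qed.

(** The inverse of [dualM X Y] hidden in [ddualM X Y] cancels against the explicit [dualM X Y], so
    that only nested evaluations remain. *)
Lemma evN_ddualM (M : modcat C) X Y (N : M) :
  evN (ldual (X ⊗ Y)) N ∘ ddualM X Y ▶ (dualM X Y ▹ N)
  = evN (ldual X) N ∘ (ldual (ldual X) ◁ evN (ldual Y) (ldual X ▷ N)
    ∘ (cst (actA _ _ _) ∘ _ ◁ cst (actA _ _ N))).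
Proof.
rewrite act_lr /ddualM actrM -!compA (reA (evN_dualm _ _)).
rewrite act_swap (reAid (actl_eqid _)); last first.
  by rewrite -actrM (invmK (dualM_iso X Y)) actm1.
by rewrite evN_dualM.
Qed.

(** Monoidality of p, read on pairings: X ⊗ Y is paired with Y^* ⊗ X^* by contracting Y first, then
    X. *)
Lemma pivN_dualM (p : pivotal C) (M : modcat C) X Y (N : M) :
  pivN p (X ⊗ Y) N ∘ (X ⊗ Y) ◁ (dualM X Y ▹ N)
  = pivN p X N ∘ X ◁ pivN p Y (ldual X ▷ N)
    ∘ (cst (actA _ _ _) ∘ _ ◁ cst (actA _ _ N)).
Proof.
rewrite !pivNE pivM actrM -!compA act_swap (reA1 (esym (act_lr _ _))).
rewrite (reA1 (evN_ddualM _ _ _)) -!compA -act_swap.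
rewrite (reA (actA_nat _ _ _)) (act_lr (piv p X)) -!compA.
by rewrite -(reA (act_swap _ _)) !actlM -!compA.
Qed.

End DualPairUniqueness.

(** * Internal Homs *)

Section RightTensor.
Variables (k : fieldType) (C : fintens k).
Implicit Types (X Y Z W V L : C).

Definition runcur W L V (u : hom C W (V ⊗ ldual L)) : hom C (W ⊗ L) V :=
  cst (tens1r V) ∘ (idm V ⊠ ev L) ∘ cst (tensA V (ldual L) L) ∘ (u ⊠ idm L).

Lemma rcurK W L V (s : hom C (W ⊗ L) V) : runcur (rcur s) = s.
Proof.
apply: tens_faithfulP => N; rewrite /runcur; nest.
apply: (iso_epi (iso_cst (esym (actA W L N)))); rewrite -!compA cstK compm1.
have -> : rcur s ▹ (L ▷ N) = cst (esym (actA V (ldual L) (L ▷ N))) ∘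
   (mul2 s (ldual L ▷ L ▷ N) ∘ W ◁ coevN L (L ▷ N)).
  by rewrite -rcur_act cstKA.
have -> : s ▹ N ∘ cst (esym (actA W L N)) = mul2 s N by rewrite mul2E.
rewrite -[RHS]compm1 -(actm1 W) -(zig1 L N) actlM (reA (mul2_nat _ _)).
by rewrite /evN capE -!compA; nest; cst_eq.
Qed.

Lemma rcur_comp W W' L V (s : hom C (W ⊗ L) V) (f : hom C W' W) :
  rcur (s ∘ (f ⊠ idm L)) = rcur s ∘ f.
Proof.
apply: tens_faithfulP => N; apply: (iso_mono (iso_cst (actA _ _ _))).
rewrite rcur_act actrM compA rcur_act -compA -act_swap compA !mul2E actrM.
by nest; cst_eq.
Qed.

Lemma runcur_comp W W' L V (u : hom C W (V ⊗ ldual L)) (f : hom C W' W) :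
  runcur (u ∘ f) = runcur u ∘ (f ⊠ idm L).
Proof. by rewrite /runcur tensmMl !compA. Qed.

Lemma rdual_inj W L V (x y : hom C W (V ⊗ ldual L)) :
  (forall Z : regmod C,
    V ◁ evN L Z ∘ (cst (actA V (ldual L) (L ▷ Z)) ∘ x ▹ (L ▷ Z))
    = V ◁ evN L Z ∘ (cst (actA V (ldual L) (L ▷ Z)) ∘ y ▹ (L ▷ Z))) -> x = y.
Proof.
move=> e; apply: tens_faithfulP => Z; apply: (iso_mono (iso_cst (actA _ _ _))).
have xE (z : hom C W (V ⊗ ldual L)) : cst (actA V (ldual L) Z) ∘ z ▹ Z
    = V ◁ evN L (ldual L ▷ Z) ∘ (cst (actA V (ldual L) _) ∘ z ▹ _) ∘ W ◁ coevN L Z.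
  rewrite -!compA act_swap (reA (actA_natl _ _ _)).
  by rewrite (reAid (actl_eqid (zig2 _ _))).
by rewrite !xE e.
Qed.

Lemma runcurK W L V (u : hom C W (V ⊗ ldual L)) : rcur (runcur u) = u.
Proof.
apply: rdual_inj => Z.
rewrite rcur_act compA -mul2_nat -compA (actl_eqid (zig1 _ _)) compm1.
by rewrite /runcur mul2E /evN capE; nest; cst_eq.
Qed.

Lemma rcur0 W L V : rcur (0 : hom C (W ⊗ L) V) = 0.
Proof. by rewrite /rcur (linear_zero (tensm_linl _)) !comp0m. Qed.

(** The functor - ⊗ L is left adjoint to - ⊗ L^*, hence preserves cokernels. *)
Lemma rtens_coker X Y Z L (f : hom C X Y) (c : hom C Y Z) :
  is_coker f c -> is_coker (f ⊠ idm L) (c ⊠ idm L).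
Proof.
move=> [cf U]; apply: is_coker_intro.
- by rewrite -tensmMl cf (linear_zero (tensm_linl _)).
- move=> W a b e; rewrite -(rcurK a) -(rcurK b); congr runcur.
  by apply: (is_coker_epi (conj cf U)); rewrite -!rcur_comp e.
- move=> W h hf; have [|u [uE _]] := U _ (rcur h).
    by rewrite -rcur_comp hf rcur0.
  by exists (runcur u); rewrite -runcur_comp uE rcurK.
Qed.

End RightTensor.

Section InternalHoms.
Variables (k : fieldType) (C : fintens k) (M : modcat C) (H : ihom M).
Implicit Types (X Y Z W : C) (N P Q : M).

Lemma icur_inj X P N (f g : hom C X (H P N)) :
  iev H P N ∘ f ▹ P = iev H P N ∘ g ▹ P -> f = g.
Proof. by move=> e; rewrite -(ievK f) -(ievK g) e. Qed.

Lemma iev_ihomr P N N' (f : hom M N N') :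
  iev H P N' ∘ ihomr H P f ▹ P = f ∘ iev H P N.
Proof. exact: icurK. Qed.

Lemma iev_ihoml P P' N (f : hom M P P') :
  iev H P N ∘ ihoml H N f ▹ P = iev H P' N ∘ H P' N ◁ f.
Proof. exact: icurK. Qed.

Lemma iev_ihA X P N :
  iev H P (X ▷ N) ∘ ihA H X P N ▹ P = X ◁ iev H P N ∘ cst (actA X (H P N) P).
Proof. exact: icurK. Qed.

Lemma iev_ihB P N X :
  iev H (X ▷ P) N ∘ ihB H P N X ▹ (X ▷ P)
  = iev H P N ∘ H P N ◁ evN X P ∘ cst (actA (H P N) (ldual X) (X ▷ P)).
Proof. by rewrite /ihB icurK /evN capE. Qed.

Lemma ihomrM P N N' N'' (g : hom M N' N'') (f : hom M N N') :
  ihomr H P (g ∘ f) = ihomr H P g ∘ ihomr H P f.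
Proof. exact: (fmapM (ihomF H P)). Qed.

Lemma ihomr1 P N : ihomr H P (idm N) = idm (H P N).
Proof. exact: (fmap1 (ihomF H P)). Qed.

Lemma ihomlM P P' P'' N (g : hom M P' P'') (f : hom M P P') :
  ihoml H N (g ∘ f) = ihoml H N f ∘ ihoml H N g.
Proof.
apply: icur_inj; rewrite actrM compA !iev_ihoml actlM compA.
by rewrite -(compA (iev H P' N)) -act_swap compA iev_ihoml.
Qed.

Lemma ihoml1 P N : ihoml H N (idm P) = idm (H P N).
Proof. by apply: icur_inj; rewrite iev_ihoml. Qed.

Lemma iso_ihomr P N N' (f : hom M N N') : iso f -> iso (ihomr H P f).
Proof. exact: (fmap_iso (ihomF H P)). Qed.

Lemma iso_ihoml P P' N (f : hom M P P') : iso f -> iso (ihoml H N f).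
Proof.
by move=> fI; apply: (@iso_intro _ _ _ _ _ (ihoml H N (invm f)));
  rewrite -ihomlM ?invmK ?invmVK // ihoml1.
Qed.

Lemma ihB_natr P N N' X (f : hom M N N') :
  ihomr H (X ▷ P) f ∘ ihB H P N X = ihB H P N' X ∘ ihomr H P f ⊠ idm (ldual X).
Proof.
apply: icur_inj; rewrite !actrM compA iev_ihomr -compA iev_ihB [RHS]compA iev_ihB -!compA actA_nat actm1.
by rewrite -(reA (act_swap _ _)) (reA (iev_ihomr _ _)).
Qed.

(** The inverse is the transpose of the map X^* ⊗ Hom(P, X ▷ N) -> Hom(P, N) that contracts X^* with
    the value. *)
Lemma ihA_iso X P N : iso (ihA H X P N).
Proof.
pose t : hom C (ldual X ⊗ H P (X ▷ N)) (H P N) :=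
  icur H (evN X N ∘ (ldual X ◁ iev H P (X ▷ N) ∘ cst (actA _ _ _))).
have tE : iev H P N ∘ mul2 t P = evN X N ∘ ldual X ◁ iev H P (X ▷ N).
  by rewrite mul2E compA icurK -!compA cstK compm1.
apply: (@iso_intro _ _ _ _ _ (lcur t)); last first.
  apply: icur_inj; rewrite actrM compA iev_ihA -compA lcur_act compA -actlM tE.
  by rewrite actlM -compA -coevN_nat compA zig1 actm1 comp1m compm1.
have e : t ∘ (idm (ldual X) ⊠ ihA H X P N) = evN X (H P N : regmod C).
  apply: icur_inj; rewrite actrM compA icurK /evN cap_act -!compA.
  rewrite -(reA (cap_nat _ _)) actA_nat (reA1 (actl_eq1 (iev_ihA _ _ _))).
  by rewrite actlM -!compA.
apply: tens_faithfulP => Z; apply: (iso_mono (iso_cst (actA _ _ _))).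
rewrite actrM compA lcur_act -compA coevN_nat compA -actlM.
have -> : mul2 t Z ∘ ldual X ◁ (ihA H X P N ▹ Z)
   = evN X (H P N ▷ Z) ∘ ldual X ◁ cst (actA X (H P N) Z).
  apply: (iso_epi (iso_cst (actA (ldual X) (X ⊗ H P N) Z))).
  have := congr1 (fun f => f ▹ Z) e.
  by rewrite actrM tens_act /evN cap_act mul2E -!compA.
by rewrite actlM -compA -coevN_nat (reAid (zig1 _ _)) actm1 compm1.
Qed.

(** The inverse is the transpose of the map Hom(X ▷ P, N) ⊗ X -> Hom(P, N) that fills in the
    argument X. *)
Lemma ihB_iso P N X : iso (ihB H P N X).
Proof.
pose t : hom C (H (X ▷ P) N ⊗ X) (H P N) :=
  icur H (iev H (X ▷ P) N ∘ cst (actA _ _ _)).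
have tE : iev H P N ∘ mul2 t P = iev H (X ▷ P) N.
  by rewrite mul2E compA icurK -!compA cstK compm1.
apply: (@iso_intro _ _ _ _ _ (rcur t)); last first.
  apply: icur_inj; rewrite actrM compA iev_ihB -2!compA rcur_act.
  rewrite (reA (esym (mul2_nat _ _))) (reA1 tE).
  by rewrite (actl_eqid (zig1 _ _)) actm1.
have e : t ∘ (ihB H P N X ⊠ idm X) = cst (tens1r _) ∘ (idm (H P N) ⊠ ev X) ∘ cst (tensA _ _ _).
  apply: icur_inj; rewrite actrM compA icurK -compA actA_nat actm1 compA iev_ihB.
  by rewrite /evN !capE; nest; cst_eq.
apply: tens_faithfulP => Z; apply: (iso_mono (iso_cst (actA _ _ _))).
rewrite actrM compA rcur_act -compA -act_swap compA.
have -> : mul2 t (ldual X ▷ Z) ∘ ihB H P N X ▹ (X ▷ ldual X ▷ Z)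
   = H P N ◁ evN X (ldual X ▷ Z) ∘ cst (actA _ _ _).
  have := congr1 (fun f => f ▹ (ldual X ▷ Z)) e.
  rewrite actrM tens_act /evN capE mul2E -!compA; nest; cst_merge => h.
  apply: (iso_epi (iso_cst (actA (H P N ⊗ ldual X) X (ldual X ▷ Z)))).
  by rewrite -!compA h; cst_eq.
by rewrite -compA actA_natl (reAid (actl_eqid (zig2 _ _))) actm1 compm1.
Qed.

(** Hom(P,-) is a right adjoint, so half of C-projectivity is automatic. *)
Lemma ihomF_ker P N N' N'' (i : hom M N N') (g : hom M N' N'') :
  is_ker i g -> is_ker (ihomr H P i) (ihomr H P g).
Proof.
move=> [gi U]; apply: is_ker_intro.
- by rewrite -ihomrM gi; apply: (fmap0 (ihomF H P)).
- move=> W f f' e; apply: icur_inj; apply: (is_ker_mono (conj gi U)).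
  by rewrite !compA -!iev_ihomr -!compA -!actrM e.
- move=> W f gf; have [|u [uE _]] := U _ (iev H P N' ∘ f ▹ P).
    by rewrite compA -iev_ihomr -compA -actrM gf (linear_zero (actm_linl _)) compm0.
  exists (icur H u); apply: icur_inj.
  by rewrite actrM compA iev_ihomr -compA icurK.
Qed.

(** By [ihB], Hom(X ▷ P, -) is Hom(P,-) ⊗ X^*, and tensoring with X^* on the right preserves
    cokernels. *)
Lemma cproj_act X P : cproj H P -> cproj H (X ▷ P).
Proof.
move=> Pc N N' N'' f g fg; have [kf cg] := Pc _ _ _ _ _ fg.
split; first exact: ihomF_ker fg.1.
apply: (is_coker_iso (ihB_iso _ _ _) (ihB_iso _ _ _) (ihB_iso _ _ _) _ _ (rtens_coker (ldual X) cg)).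
  exact: esym (ihB_natr _ _ _).
exact: esym (ihB_natr _ _ _).
Qed.

End InternalHoms.

(** * Modules over a Frobenius algebra *)

Section ModuleTails.
Variables (k : fieldType) (C : moncat k) (A : algebra C).
Implicit Types (N P : rmodule A) (X Y : C) (Z : regmod C).

Definition reg_rmod : rmodule A := RModule (algmA A) (algm1r A).

Lemma rho_assoc N Z :
  mul2 (rho N) Z ∘ mul2 (rho N) (A ▷ Z) = mul2 (rho N) Z ∘ N ◁ mul2 (algm A) Z.
Proof.
apply: (iso_epi (iso_cst (actA N A (A ▷ Z)))).
apply: (iso_epi (iso_cst (actA (N ⊗ A) A Z))).
move: (congr1 (fun f => f ▹ Z) (rhoA N)); rewrite !mul2E; nest; cst_merge => h.
by apply: etrans (etrans h _); cst_eq.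
Qed.

Lemma rho_unit N Z : mul2 (rho N) Z ∘ N ◁ elt (algu A) Z = idm (N ▷ Z).
Proof.
apply: (iso_epi (iso_cst (congr1 (act (N : C)) (act1 Z)))).
apply: (iso_epi (iso_cst (actA N tunit Z))).
move: (congr1 (fun f => f ▹ Z) (rho1 N)); rewrite mul2E eltE; nest; cst_merge => h.
by apply: etrans (etrans h _); cst_eq.
Qed.

Lemma algm_assoc Z :
  mul2 (algm A) Z ∘ mul2 (algm A) (A ▷ Z) = mul2 (algm A) Z ∘ A ◁ mul2 (algm A) Z.
Proof. exact: (rho_assoc reg_rmod). Qed.

Lemma algm_unit Z : mul2 (algm A) Z ∘ A ◁ elt (algu A) Z = idm (A ▷ Z).
Proof. exact: (rho_unit reg_rmod). Qed.

Lemma rmod_linear N P (f : hom (rmod_modcat A) N P) :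
  slval f ∘ rho N = rho P ∘ (slval f ⊠ idm (A : C)).
Proof. by case: f => f /= /eqP. Qed.

Lemma rmod_linear_tail N P (f : hom (rmod_modcat A) N P) Z :
  slval f ▹ Z ∘ mul2 (rho N) Z = mul2 (rho P) Z ∘ slval f ▹ (A ▷ Z).
Proof.
apply: (iso_epi (iso_cst (actA N A Z))).
move: (congr1 (fun f => f ▹ Z) (rmod_linear f)); rewrite !mul2E; nest; cst_merge => h.
by apply: etrans (etrans h _); cst_eq.
Qed.

Lemma rmod_linear_intro N P (u : hom C N P) :
  (forall Z, u ▹ Z ∘ mul2 (rho N) Z = mul2 (rho P) Z ∘ u ▹ (A ▷ Z)) ->
  u \in @is_rmodm _ _ A N P.
Proof.
move=> h; apply/eqP; apply: tens_faithfulP => Z.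
apply: (iso_epi (iso_cst (esym (actA N A Z)))).
move: (h Z); rewrite !mul2E; nest; cst_merge => e.
by apply: etrans (etrans e _); cst_eq.
Qed.

Lemma slval_comp N P Q (g : hom (rmod_modcat A) P Q) (f : hom (rmod_modcat A) N P) :
  slval (g ∘ f) = slval g ∘ slval f.
Proof. by []. Qed.

Lemma slval_actA X Y N :
  slval (cst (actA X Y (N : rmod_modcat A))) = cst (tensA X Y N).
Proof. exact: slval_cst. Qed.

Lemma slval_cap X Y (t : hom C (X ⊗ Y) tunit) N :
  slval (cap t (N : rmod_modcat A)) = cap t (rmod N : regmod C) :> hom C (X ⊗ Y ⊗ N) N.
Proof.
rewrite !capE !slval_comp.
rewrite (slval_cst _ (tens1l N : rmod (rmod_act tunit N) = rmod N)).
by rewrite (slval_cst _ (esym (tensA X Y N) : rmod (rmod_act X (rmod_act Y N))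
  = rmod (rmod_act (X ⊗ Y) N))).
Qed.

Lemma rmod_act_linear X P N (u : hom (rmod_modcat A) (X ▷ (P : rmod_modcat A)) N) Z :
  mul2 (slval u : hom C (X ⊗ P) N) Z ∘ X ◁ mul2 (rho P) Z
  = mul2 (rho N) Z ∘ mul2 (slval u) (A ▷ Z).
Proof.
apply: (iso_epi (iso_cst (congr1 (act (X : C)) (actA P A Z)))).
apply: (iso_epi (iso_cst (actA X (P ⊗ A) Z))).
apply: (iso_epi (iso_cst (congr1 (fun Y => Y ▷ Z) (tensA X P A)))).
have e : slval u ∘ act_rho X P = rho N ∘ ((slval u : hom C _ _) ⊠ idm (A : C)).
  exact: rmod_linear u.
move: (congr1 (fun f => f ▹ Z) e); rewrite /act_rho !mul2E; nest; cst_merge => h.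
by apply: etrans (etrans h _); cst_eq.
Qed.

Lemma act_rho_tail X N Z :
  cst (actA X N Z) ∘ mul2 (act_rho X N) Z
  = X ◁ mul2 (rho N) Z ∘ cst (actA X N (A ▷ Z)).
Proof. by rewrite /act_rho !mul2E; nest; cst_eq. Qed.

End ModuleTails.

Section FrobeniusModules.
Variables (k : fieldType) (C : fintens k) (A : algebra C) (lam : hom C A tunit).
Hypothesis lamI : iso (frob_iso lam).
Implicit Types (N P : rmodule A) (X Y W : C) (Z : regmod C).

Definition pairing Z : hom (regmod C) (A ▷ A ▷ Z) Z := cap (lam ∘ algm A) Z.

Lemma pairingE Z : pairing Z = form lam Z ∘ mul2 (algm A) Z.
Proof. by rewrite /pairing capE formE mul2E; nest; cst_eq. Qed.

Lemma pairing_frob_iso Z : evN A Z ∘ frob_iso lam ▹ (A ▷ Z) = pairing Z.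
Proof. exact: evN_transp. Qed.

Lemma pairing_assoc Z :
  pairing Z ∘ mul2 (algm A) (A ▷ Z) = pairing Z ∘ A ◁ mul2 (algm A) Z.
Proof. by rewrite pairingE -!compA algm_assoc. Qed.

Lemma pairing_unit Z : pairing Z ∘ A ◁ elt (algu A) Z = form lam Z.
Proof. by rewrite pairingE -compA algm_unit compm1. Qed.

(** Nondegeneracy: feeding a coevaluation into the pairing turns it into [frob_iso lam], which is
    invertible. *)
Lemma pairing_inj Z V (x y : hom (regmod C) V (A ▷ Z)) :
  pairing (ldual A ▷ Z) ∘ (A ◁ coevN A Z ∘ x)
  = pairing (ldual A ▷ Z) ∘ (A ◁ coevN A Z ∘ y) -> x = y.
Proof.
have e (f : hom (regmod C) V (A ▷ Z)) :
    pairing (ldual A ▷ Z) ∘ (A ◁ coevN A Z ∘ f) = frob_iso lam ▹ Z ∘ f.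
  by rewrite -pairing_frob_iso -!compA (reA (act_swap _ _)) (reAid (zig2 _ _)).
rewrite !e => /iso_mono; apply.
apply: (@iso_intro _ _ _ _ _ (invm (frob_iso lam) ▹ Z)); rewrite -actrM.
  by rewrite invmK // actm1.
by rewrite invmVK // actm1.
Qed.

(* t is determined by lam (t x * a) = q (x a). *)
Lemma frob_lift (W : rmodule A) (q : hom C W tunit) :
  exists t : hom (rmod_modcat A) W (reg_rmod A), lam ∘ slval t = q.
Proof.
pose t : hom C W A := invm (frob_iso lam) ∘ transp (q ∘ rho W).
have tE Z : pairing Z ∘ t ▹ (A ▷ Z) = form q Z ∘ mul2 (rho W) Z.
  rewrite -pairing_frob_iso -compA -actrM /t compA invmVK // comp1m evN_transp.
  by rewrite capE formE mul2E; nest; cst_eq.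
(* For x in W: λ(t(x b) a) = q(x b a) = λ(t(x) b a), and nondegeneracy removes the pairing with
   a. *)
have tL : t \in @is_rmodm _ _ A W (reg_rmod A).
  apply: rmod_linear_intro => Z; apply: pairing_inj.
  rewrite -(reA (act_swap _ _)) (reA (tE _)) -mul2_nat (reA (rho_assoc _ _)).
  rewrite -(reA (mul2_nat _ _)) (reA (pairing_assoc _)) -act_swap.
  by rewrite -(reA (act_swap _ _)) (reA (tE _)).
have e Z : form lam Z ∘ t ▹ Z = form q Z.
  by rewrite -pairing_unit -compA -act_swap compA tE -compA rho_unit compm1.
exists (SubL _ tL); apply: tens_faithfulP => Z; apply: (iso_mono (iso_cst (act1 Z))).
by move: (e Z); rewrite !formE -compA -actrM.
Qed.

(* An A-linear map t into X ▷ A is determined by (id ⊗ lam) ∘ t. *)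
Lemma pairing_uniq (W : rmodule A) X
    (t t' : hom (rmod_modcat A) W (X ▷ (reg_rmod A : rmod_modcat A))) :
  (forall Z, X ◁ form lam Z ∘ cst (actA X A Z) ∘ (slval t : hom C W (X ⊗ A)) ▹ Z
    = X ◁ form lam Z ∘ cst (actA X A Z) ∘ (slval t' : hom C W (X ⊗ A)) ▹ Z) ->
  t = t'.
Proof.
move=> e; apply: val_inj => /=; apply: tens_faithfulP => Z.
apply: (iso_mono (iso_cst (actA X A Z))).
(* A-linearity gives λ(s(x) a) = λ(s(x a)): the whole pairing of s with A, and by [tI] then s
   itself, depends only on its composite with λ. *)
have tP (s : hom (rmod_modcat A) W (X ▷ (reg_rmod A : rmod_modcat A))) Z' :
  X ◁ pairing Z' ∘ (cst (actA X A (A ▷ Z')) ∘ (slval s : hom C W (X ⊗ A)) ▹ (A ▷ Z'))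
  = X ◁ form lam Z' ∘ cst (actA X A Z') ∘ (slval s : hom C W (X ⊗ A)) ▹ Z' ∘ mul2 (rho W) Z'.
  have lin : (slval s : hom C W (X ⊗ A)) ▹ Z' ∘ mul2 (rho W) Z'
      = mul2 (act_rho X (reg_rmod A)) Z' ∘ (slval s : hom C W (X ⊗ A)) ▹ (A ▷ Z').
    exact: rmod_linear_tail s Z'.
  rewrite -compA lin pairingE actlM -!compA.
  by rewrite (reA (act_rho_tail X (reg_rmod A) Z')).
have tI (s : hom (rmod_modcat A) W (X ▷ (reg_rmod A : rmod_modcat A))) :
  X ◁ (frob_iso lam ▹ Z) ∘ (cst (actA X A Z) ∘ (slval s : hom C W (X ⊗ A)) ▹ Z)
  = X ◁ pairing (ldual A ▷ Z) ∘ (cst (actA X A _) ∘ (slval s : hom C W (X ⊗ A)) ▹ _)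
     ∘ W ◁ coevN A Z.
  rewrite -!compA act_swap (reA (actA_natl _ _ _)) -pairing_frob_iso actlM -!compA.
  rewrite [in RHS](reA (actl_eq (act_swap _ _))).
  by rewrite (reAid (actl_eqid (zig2 _ _))).
have lamZ : iso (X ◁ (frob_iso lam ▹ Z)).
  apply: (@iso_intro _ _ _ _ _ (X ◁ (invm (frob_iso lam) ▹ Z))).
    by apply: actl_eqid; rewrite -actrM invmK // actm1.
  by apply: actl_eqid; rewrite -actrM invmVK // actm1.
by apply: (iso_mono lamZ); rewrite !tI !tP e.
Qed.

End FrobeniusModules.

(** * The left A-module P^* and its canonical pairing with P *)

Section LeftAction.
Variables (k : fieldType) (C : fintens k) (A : algebra C) (lam : hom C A tunit).
(* A name for frob_iso lam that rewriting does not unfold. *)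
Variable Phi : hom C A (ldual A).
Hypothesis PhiE : frob_iso lam = Phi.
Hypothesis PhiI : iso Phi.
Implicit Types (N P : rmodule A) (X Y W : C) (Z : regmod C).
Let RA := rmod_modcat A.

Variable (P : rmodule A) (tau : hom RA (ldual P ▷ (P : RA)) (reg_rmod A)).
Hypothesis tauP : lam ∘ slval tau = ev P.

Definition tauC : hom C (ldual P ⊗ P) A := slval tau.

Definition tauN Z : hom (regmod C) (ldual P ▷ P ▷ Z) (A ▷ Z) :=
  mul2 tauC Z.

Lemma tauN_nat Z Z' (f : hom (regmod C) Z Z') :
  tauN Z' ∘ ldual P ◁ ((P : C) ◁ f) = A ◁ f ∘ tauN Z.
Proof. exact: mul2_nat. Qed.

Lemma tauN_form Z : form lam Z ∘ tauN Z = evN P Z.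
Proof.
rewrite /tauN formE mul2E /evN capE; have := congr1 (fun f => f ▹ Z) tauP.
by move=> <-; rewrite actrM -!compA.
Qed.

Lemma tauN_linear Z :
  tauN Z ∘ ldual P ◁ mul2 (rho P) Z = mul2 (algm A) Z ∘ tauN (A ▷ Z).
Proof. exact: rmod_act_linear tau Z. Qed.

Lemma tauN_pairing Z :
  pairing lam Z ∘ tauN (A ▷ Z) = evN P Z ∘ ldual P ◁ mul2 (rho P) Z.
Proof. by rewrite pairingE -compA -tauN_linear compA tauN_form. Qed.

Lemma pairing_Phi Z : evN A Z ∘ Phi ▹ (A ▷ Z) = pairing lam Z.
Proof. by rewrite -PhiE pairing_frob_iso. Qed.

(* P^* is a left A-module: A acts through the Frobenius pairing. *)
Definition lact : hom C (A ⊗ ldual P) (ldual P) :=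
  transp (lam ∘ algm A ∘ (idm (A : C) ⊠ tauC) ∘ cst (tensA A (ldual P) P)).

Lemma lact_pairing Z :
  evN P Z ∘ mul2 lact (P ▷ Z) = pairing lam Z ∘ A ◁ tauN Z.
Proof.
rewrite /lact mul2E compA evN_transp /pairing /tauN !capE mul2E.
by nest; cst_eq.
Qed.

(** Left linearity of τ, by nondegeneracy: λ(τ(aq ⊗ x) b) = (aq)(x b) = λ(a τ(q ⊗ x b)) = λ(a τ(q ⊗
    x) b). *)
Lemma tauN_lact Z :
  tauN Z ∘ mul2 lact (P ▷ Z) = mul2 (algm A) Z ∘ A ◁ tauN Z.
Proof.
have lamI : iso (frob_iso lam) by rewrite PhiE.
apply: (pairing_inj lamI).
rewrite -(reA (tauN_nat _)) (reA (tauN_pairing _)) -mul2_nat -(reA (mul2_nat _ _)).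
rewrite (reA (lact_pairing _)) (reA (actl_eq (tauN_linear _))) (actl_eq (tauN_nat _)).
by rewrite -[in RHS](reA (mul2_nat _ _)) (reA (pairing_assoc _ _)).
Qed.

Variable p : pivotal C.
Hypothesis symA : dualm Phi ∘ p A = Phi.

(** Φ(b) is the functional λ(b -); symmetry says that contracting it with a from the other side,
    through p, gives λ(a b). *)
Lemma pivN_pairing Z : pivN p A Z ∘ A ◁ (Phi ▹ Z) = pairing lam Z.
Proof.
rewrite !pivNE -compA act_swap compA -evN_dualm -compA -actrM symA.
exact: pairing_Phi.
Qed.

Lemma pivN_dualm X Y (f : hom C X Y) Z :
  pivN p Y Z ∘ f ▹ (ldual Y ▷ Z) = pivN p X Z ∘ X ◁ (dualm f ▹ Z).
Proof.
by rewrite !pivNE -!compA act_swap -actrM piv_nat actrM (reA (evN_dualm _ _)).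
Qed.

Lemma mul2_frob_tau Z :
  mul2 (Phi ∘ tauC) Z = Phi ▹ Z ∘ tauN Z.
Proof. exact: mul2_comp. Qed.

(** Since q(x a) = λ(τ(q ⊗ x) a), the transposed action P^* -> (P ⊗ A)^* can be written with τ and Φ
    alone. *)
Lemma dualm_rho : dualm (rho P) = dualM P A ∘ rcur (Phi ∘ tauC).
Proof.
apply: ldual_inj => Z; rewrite evN_dualm actrM compA evN_dualM -!compA -act_swap.
rewrite (reA (rcur_act _ _)). rewrite mul2_frob_tau -!compA -(reA (act_swap _ _)).
rewrite -(reA (tauN_nat _)) (reAid (actl_eqid (zig1 _ _))).
rewrite (reA1 (pairing_Phi _)) (reA (tauN_pairing _)).
by rewrite mul2E -!actlM -!compA cstK compm1.
Qed.

(* The canonical pairing of P with P^* is A-balanced; this is where the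
   symmetry of A enters. *)
Lemma pivN_balanced Z :
  pivN p P Z ∘ mul2 (rho P) (ldual P ▷ Z) = pivN p P Z ∘ P ◁ mul2 lact Z.
Proof.
set r := rcur (Phi ∘ tauC).
have rE Z' : A ◁ (ldual A ◁ evN P Z') ∘
     (A ◁ (cst (actA (ldual A) (ldual P) _) ∘ r ▹ _)) = A ◁ (Phi ▹ Z' ∘ tauN Z').
  rewrite rcur_act mul2_frob_tau -!actlM -!compA -(reA (act_swap _ _)).
  by rewrite -(reA (tauN_nat _)) (actl_eqid (zig1 _ _)) compm1.
(* By [pivN_pairing], hence by symmetry, a q is obtained by contracting a through p with the
   A^*-component of r(q). *)
have lE : mul2 lact Z = pivN p A (ldual P ▷ Z) ∘ A ◁ (cst (actA (ldual A) (ldual P) Z) ∘ r ▹ Z).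
  rewrite -[RHS]comp1m -[LHS]comp1m -(zig2 P Z) -!compA -mul2_nat.
  have rN : A ◁ (ldual A ◁ (ldual P ◁ coevN P Z)) ∘ A ◁ (cst (actA (ldual A) (ldual P) Z) ∘ r ▹ Z)
     = A ◁ (cst (actA (ldual A) (ldual P) _) ∘ r ▹ _) ∘ A ◁ (ldual P ◁ coevN P Z).
    by rewrite -!actlM -!compA act_swap (reA (actA_natl _ _ _)).
  rewrite (reA (lact_pairing _)) -(reA (pivN_nat _ _ _)) rN -(reA (pivN_nat _ _ _)).
  by rewrite (reA1 (rE _)) actlM -!compA (reA1 (pivN_pairing _)).
(* Naturality of p moves the action from P to P^*, where it is [dualm (rho P)]; the nested pairing
   of P ⊗ A then reproduces the formula [lE]. *)
rewrite lE mul2E compA pivN_dualm dualm_rho actrM actlM -/r compA pivN_dualM.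
by rewrite !tens_actl !actlM -!compA; cst_eq.
Qed.

End LeftAction.

(** * Hom_A(P,N) as a tensor product over A *)

Section Theta.
Variables (k : fieldType) (C : fintens k) (A : algebra C).
Implicit Types (N P Q : rmodule A) (X Y W V : C) (Z : regmod C).
Let RA := rmod_modcat A.
Variable H : ihom RA.

Definition iv Q N : hom C (H Q N ⊗ Q) N := slval (iev H Q N).
Definition ivN Q N Z : hom (regmod C) (H Q N ▷ Q ▷ Z) (N ▷ Z) := mul2 (iv Q N) Z.

Lemma ivN_nat Q N Z Z' (f : hom (regmod C) Z Z') :
  ivN Q N Z' ∘ H Q N ◁ ((Q : C) ◁ f) = (N : C) ◁ f ∘ ivN Q N Z.
Proof. exact: mul2_nat. Qed.

Lemma ivN_inj Q N X (f g : hom C X (H Q N)) :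
  (forall Z, ivN Q N Z ∘ f ▹ (Q ▷ Z) = ivN Q N Z ∘ g ▹ (Q ▷ Z)) -> f = g.
Proof.
move=> e; apply: (icur_inj (H := H)); apply: val_inj; apply: tens_faithfulP => Z.
by apply: mul2_inj; rewrite [LHS]mul2_tens [RHS]mul2_tens; apply: e.
Qed.

Lemma ivN_icur Q N X (f : hom RA (X ▷ (Q : RA)) N) Z :
  ivN Q N Z ∘ icur H f ▹ (Q ▷ Z) = mul2 (slval f : hom C (X ⊗ Q) N) Z.
Proof.
by rewrite /ivN -mul2_tens; congr (mul2 _ Z); rewrite -[in RHS](icurK H f).
Qed.

Lemma ivN_ihomr Q N N' (f : hom RA N N') Z :
  ivN Q N' Z ∘ ihomr H Q f ▹ (Q ▷ Z) = slval f ▹ Z ∘ ivN Q N Z.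
Proof. by rewrite ivN_icur -mul2_comp. Qed.

Lemma ivN_ihoml Q Q' N (f : hom RA Q Q') Z :
  ivN Q N Z ∘ ihoml H N f ▹ (Q ▷ Z) = ivN Q' N Z ∘ H Q' N ◁ (slval f ▹ Z).
Proof.
rewrite ivN_icur /ivN !mul2E /= !actrM -!compA; congr (_ ∘ _).
by apply: (iso_epi (iso_cst (actA _ _ _))); rewrite -!compA cstK compm1 tens_act; cst_eq.
Qed.

Lemma ivN_ihA X Q N Z :
  ivN Q (X ▷ (N : RA)) Z ∘ ihA H X Q N ▹ (Q ▷ Z)
  = cst (esym (actA X N Z)) ∘ X ◁ ivN Q N Z ∘ cst (actA X (H Q N) (Q ▷ Z)).
Proof.
rewrite ivN_icur slval_comp slval_actA /ivN !mul2E.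
change (slval (X ◁ iev H Q N)) with (idm X ⊠ iv Q N).
by nest; cst_eq.
Qed.

Lemma ivN_ihB X Q N Z :
  ivN (X ▷ (Q : RA)) N Z ∘ ihB H Q N X ▹ ((X ⊗ Q) ▷ Z)
  = ivN Q N Z ∘ H Q N ◁ (evN X (Q ▷ Z) ∘ ldual X ◁ cst (actA X Q Z))
      ∘ cst (actA (H Q N) (ldual X) _).
Proof.
have e : iv (X ▷ (Q : RA)) N ∘ (ihB H Q N X ⊠ idm (X ⊗ Q)) =
    iv Q N ∘ (idm (H Q N) ⊠ cap (ev X) (rmod Q : regmod C))
      ∘ cst (tensA (H Q N) (ldual X) (X ⊗ Q)).
  have := congr1 (@slval _ _ _ _) (iev_ihB H (Q : RA) N X).
  by rewrite !slval_comp slval_actA /evN -slval_cap.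
rewrite /ivN -mul2_tens e !mul2E !actrM tens_act cap_act /evN !actlM.
by nest; cst_eq.
Qed.

(** The free cover N ⊗ A -> N. The unit of A splits it in C ([rho_splitC]), though in general not in
    C_A. *)
Definition rho_mod N : hom RA (rmod N ▷ (reg_rmod A : RA)) N.
Proof.
exists (rho N); apply/eqP; change (rho N ∘ act_rho N (reg_rmod A) = rho N ∘ (rho N ⊠ idm (A : C))).
by rewrite rhoA compA.
Defined.

Lemma rho_splitC N : exists s : hom C N (N ⊗ A), rho N ∘ s = idm (N : C).
Proof.
exists ((idm (N : C) ⊠ algu A) ∘ cst (esym (tens1r N))).
by rewrite compA rho1 cstK.
Qed.

Hypothesis kerC :
  forall (X Y : C) (g : hom C X Y), exists K (i : hom C K X), is_ker i g.

(** The kernel in C receives an action from its universal property, and every axiom is checked after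
    the monomorphism i. *)
Lemma rmod_ker N N' (g : hom RA N N') :
  exists (K : rmodule A) (i : hom RA K N), is_ker i g /\ is_ker (slval i) (slval g).
Proof.
have [K [i iK]] := kerC (slval g); have iM := is_ker_mono iK.
have [|r [rE _]] := iK.2 _ (rho N ∘ (i ⊠ idm (A : C))).
  rewrite compA rmod_linear -compA -tensmMl iK.1.
  by rewrite (linear_zero (tensm_linl _)) compm0.
have rA : r ∘ (r ⊠ idm (A : C)) = r ∘ (idm K ⊠ algm A) ∘ cst (tensA K A A).
  apply: iM; rewrite !compA rE -[LHS]compA -tensmMl rE tensmMl compA rhoA.
  rewrite -!compA tensmA tensm1; congr (_ ∘ _); rewrite !compA; congr (_ ∘ _).
  by rewrite -!tensmM !comp1m !compm1.
have r1 : r ∘ (idm K ⊠ algu A) = cst (tens1r K).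
  apply: iM; rewrite compA rE -compA -tensmM comp1m compm1.
  rewrite -[i in LHS]comp1m -[algu A]compm1 tensmM compA rho1.
  by rewrite tensm1r.
have iL : i \in @is_rmodm _ _ A (RModule rA r1) N by apply/eqP; rewrite /= rE.
exists (RModule rA r1), (SubL _ iL); split=> //.
apply: is_ker_intro.
- by apply: val_inj; apply: iK.1.
- move=> W f f' e; apply: val_inj; apply: iM.
  exact: (congr1 (@slval _ _ _ _) e).
- move=> W f gf.
  have [|u [uE _]] := iK.2 _ (slval f); first exact: (congr1 (@slval _ _ _ _) gf).
  have uL : u \in @is_rmodm _ _ A W (RModule rA r1).
    apply/eqP; apply: iM; rewrite /= !compA uE rE rmod_linear -uE.
    by rewrite -compA -tensmMl.
  by exists (SubL _ uL); apply: val_inj.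
Qed.

(** If s splits [rho N] in C, then id - s ∘ [rho N] factors through the kernel in C, so h factors as
    (h ∘ s) ∘ [rho N]; linearity of h ∘ s is tested after the split epimorphism [rho N] ⊗ A. *)
Lemma rho_mod_coker N (K : rmodule A) (i : hom RA K (rmod N ▷ (reg_rmod A : RA))) :
  is_ker i (rho_mod N) -> is_ker (slval i) (slval (rho_mod N)) ->
  is_coker i (rho_mod N).
Proof.
move=> iK iKC; have [s sE] := rho_splitC N.
apply: is_coker_intro; first exact: iK.1.
  move=> W f f' e; apply: val_inj => /=.
  rewrite -[LHS]compm1 -[RHS]compm1 -sE !compA; congr (_ ∘ _).
  exact: (congr1 (@slval _ _ _ _) e).
move=> W h hi; have [u uE] : exists u : hom C N W, u ∘ rho N = slval h.
  exists ((slval h : hom C (N ⊗ A) W) ∘ s).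
  have [|x [xE _]] := iKC.2 _ (idm (N ⊗ A) - s ∘ rho N).
    by rewrite compmB compm1 compA [slval _ ∘ s]sE comp1m subrr.
  have : slval h ∘ (idm (N ⊗ A) - s ∘ rho N) = 0.
    by rewrite -xE compA -slval_comp hi comp0m.
  by rewrite compmB compm1 compA => /subr0_eq.
have uL : u \in @is_rmodm _ _ A N W.
  apply/eqP.
  have sE2 : (rho N ⊠ idm (A : C)) ∘ (s ⊠ idm (A : C)) = idm (N ⊗ A).
    by rewrite -tensmMl sE tensm1.
  rewrite -[LHS]compm1 -[RHS]compm1 -sE2 !compA; congr (_ ∘ _).
  rewrite -compA rhoA -!compA -tensmMl uE (compA u) uE.
  exact: (rmod_linear h).
by exists (SubL _ uL); apply: val_inj.
Qed.

Variables (lam : hom C A tunit) (Phi : hom C A (ldual A)).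
Hypothesis PhiE : frob_iso lam = Phi.
Hypothesis PhiI : iso Phi.

Section FixedModule.
Variables (P : rmodule A) (tau : hom RA (ldual P ▷ (P : RA)) (reg_rmod A)).
Hypothesis tauP : lam ∘ slval tau = ev P.

Definition free_comp X : hom C (X ⊗ ldual P) (H P (X ▷ (reg_rmod A : RA))) :=
  icur H (X ◁ tau ∘ cst (actA X (ldual P) (P : RA))).

Lemma ivN_free_comp X Z :
  ivN P (X ▷ (reg_rmod A : RA)) Z ∘ mul2 (free_comp X) (P ▷ Z)
  = cst (esym (actA X A Z)) ∘ X ◁ tauN tau Z.
Proof.
rewrite mul2E compA ivN_icur slval_comp slval_actA /tauN !mul2E.
change (slval (X ◁ tau)) with (idm X ⊠ tauC tau).
by nest; cst_eq.
Qed.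

Lemma ivN_free_comp_act X Z :
  ivN P (X ▷ (reg_rmod A : RA)) Z ∘ free_comp X ▹ (P ▷ Z)
    = cst (esym (actA X A Z)) ∘ X ◁ tauN tau Z ∘ cst (actA X (ldual P) (P ▷ Z)).
Proof.
apply: (iso_epi (iso_cst (esym (actA X (ldual P) (P ▷ Z))))).
by rewrite -!compA -mul2E ivN_free_comp cstK compm1.
Qed.

(** A Frobenius form makes the free module X ⊗ A cofree: composing with id ⊗ λ matches A-linear maps
    P -> X ⊗ A with maps P -> X, that is, with X ⊗ P^*. *)
Lemma free_comp_iso X : iso (free_comp X).
Proof.
pose g : hom C (H P (X ▷ (reg_rmod A : RA))) (X ⊗ ldual P) :=
  rcur (cst (tens1r X) ∘ (idm X ⊠ lam) ∘ (iv P (X ▷ (reg_rmod A : RA)) : hom C _ (X ⊗ A))).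
have gE Z : X ◁ evN P Z ∘ (cst (actA X (ldual P) (P ▷ Z)) ∘ g ▹ (P ▷ Z))
   = X ◁ form lam Z ∘ cst (actA X A Z) ∘ ivN P (X ▷ (reg_rmod A : RA)) Z.
  rewrite rcur_act compA -mul2_nat -compA (actl_eqid (zig1 _ _)) compm1.
  by rewrite !mul2_comp formE; nest; cst_eq.
have lamI : iso (frob_iso lam) by rewrite PhiE.
apply: (@iso_intro _ _ _ _ _ g).
  apply: rdual_inj => Z; rewrite actrM (compA (cst _)) (compA (X ◁ _)) gE.
  apply: (iso_epi (iso_cst (esym (actA X (ldual P) (P ▷ Z))))).
  rewrite -!compA -mul2E ivN_free_comp cstKA actm1 comp1m cstK compm1.
  by apply: actl_eq1; apply: tauN_form.
apply: (icur_inj (H := H)); apply: (pairing_uniq (W := rmod_act _ P) lamI) => Z.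
apply: (iso_epi (iso_cst (esym (actA (H P (X ▷ (reg_rmod A : RA))) P Z)))).
have vE f : (slval (iev H P (X ▷ (reg_rmod A : RA)) ∘ f ▹ (P : RA)) : hom C _ (X ⊗ A)) ▹ Z
    ∘ cst (esym (actA (H P (X ▷ (reg_rmod A : RA))) P Z))
    = ivN P (X ▷ (reg_rmod A : RA)) Z ∘ f ▹ (P ▷ Z).
  by rewrite -mul2E; apply: mul2_tens.
rewrite -!compA !vE actm1 compm1 actrM (compA (ivN _ _ _)).
rewrite ivN_free_comp_act -!compA cstKA (reA1 (actl_eq1 (tauN_form tauP Z))).
by rewrite gE -!compA.
Qed.

(* theta (n ⊗ q) is the A-linear map x |-> n * tau (q ⊗ x). *)
Definition theta N : hom C (N ⊗ ldual P) (H P N) :=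
  locked (ihomr H P (rho_mod N) ∘ free_comp N).

Lemma thetaE N : theta N = ihomr H P (rho_mod N) ∘ free_comp N.
Proof. by rewrite /theta -lock. Qed.

Definition thetaN N Z : hom (regmod C) (N ▷ ldual P ▷ Z) (H P N ▷ Z) :=
  mul2 (theta N) Z.

Lemma thetaN_nat N Z Z' (f : hom (regmod C) Z Z') :
  thetaN N Z' ∘ (N : C) ◁ (ldual P ◁ f) = H P N ◁ f ∘ thetaN N Z.
Proof. exact: mul2_nat. Qed.

Lemma ivN_theta N Z :
  ivN P N Z ∘ thetaN N (P ▷ Z) = mul2 (rho N) Z ∘ N ◁ tauN tau Z.
Proof.
rewrite /thetaN thetaE mul2_comp compA ivN_ihomr -compA ivN_free_comp.
by rewrite compA -mul2E.
Qed.

(** Left linearity of τ: (n a) τ(q ⊗ x) = n τ(a q ⊗ x). *)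
Lemma theta_balanced N Z :
  thetaN N Z ∘ mul2 (rho N) (ldual P ▷ Z) = thetaN N Z ∘ N ◁ mul2 (lact lam tau) Z.
Proof.
have lamI : iso (frob_iso lam) by rewrite PhiE.
move: Z; apply/balancedP; apply: ivN_inj => Z.
apply: (iso_epi (iso_cst (esym (actA (N ⊗ A) (ldual P) (P ▷ Z))))).
apply: (iso_epi (iso_cst (esym (actA N A (ldual P ▷ P ▷ Z))))).
rewrite -!compA; transitivity (ivN P N Z ∘ (thetaN N (P ▷ Z) ∘ mul2 (rho N) (ldual P ▷ P ▷ Z))).
  by rewrite /thetaN !mul2E; nest; cst_eq.
transitivity (ivN P N Z ∘ (thetaN N (P ▷ Z) ∘ N ◁ mul2 (lact lam tau) (P ▷ Z))); last first.
  by rewrite /thetaN !mul2E; nest; cst_eq.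
rewrite !(reA (ivN_theta _ _)) -mul2_nat (reA (rho_assoc _ _)).
by rewrite (actl_eq1 (tauN_lact PhiE PhiI tauP Z)) actlM.
Qed.

Hypothesis Pc : cproj H P.

(* N is the cokernel of a map between free modules, on which theta is bijective,
   and Hom_A(P,-) preserves this presentation. *)
Lemma ihomr_rho_coker N : exists (K : rmodule A) (i : hom RA K (rmod N ▷ (reg_rmod A : RA))),
  rho_mod N ∘ i = 0 /\ is_coker (ihomr H P i) (ihomr H P (rho_mod N)).
Proof.
have [K [i [iK iKC]]] := rmod_ker (rho_mod N); exists K, i; split; first exact: iK.1.
by case: (Pc (conj iK (rho_mod_coker iK iKC))).
Qed.

Lemma theta_epi N V (u v : hom C (H P N) V) :
  u ∘ theta N = v ∘ theta N -> u = v.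
Proof.
rewrite !thetaE !compA => /(iso_epi (free_comp_iso _)) e.
by have [K [i [_ /is_coker_epi]]] := ihomr_rho_coker N; apply.
Qed.

(** Since Hom_A(P, N) is a cokernel, it suffices that h kills what comes from K. This is tested
    after the epimorphism [theta] of K: there h is applied to i(k) ⊗ q with the A-factor acting on
    q, and balance lets it act on N instead, where [rho N] ∘ i = 0. *)
Lemma theta_coker N V (h : hom C (N ⊗ ldual P) V) :
  (forall Z, mul2 h Z ∘ mul2 (rho N) (ldual P ▷ Z) = mul2 h Z ∘ N ◁ mul2 (lact lam tau) Z) ->
  exists u, u ∘ theta N = h.
Proof.
move=> /balancedP hB; have [K [i [rhoi0 iC]]] := ihomr_rho_coker N.
have bI := free_comp_iso N.
have [|u [uE _]] := iC.2 _ (h ∘ invm (free_comp N)); last first.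
  by exists u; rewrite thetaE compA uE -compA invmK // compm1.
apply: theta_epi; rewrite comp0m.
have -> : h ∘ invm (free_comp N) ∘ ihomr H P i ∘ theta K =
  h ∘ (idm (N : C) ⊠ lact lam tau) ∘ cst (tensA _ _ _) ∘ ((slval i : hom C K (N ⊗ A)) ⊠ idm (ldual P)).
  rewrite -!compA; congr (h ∘ _); apply: (iso_mono bI); rewrite (reAid (invmVK bI)).
  apply: ivN_inj => Z; apply: (iso_epi (iso_cst (esym (actA K (ldual P) (P ▷ Z))))).
  rewrite !actrM [in LHS]compA ivN_ihomr -[in LHS]compA -[in LHS]compA -mul2E -/(thetaN K _).
  rewrite ivN_theta [in RHS]compA ivN_free_comp_act.
  transitivity (cst (esym (actA N A Z)) ∘ (N ◁ tauN tau Z ∘ (N ◁ mul2 (lact lam tau) (P ▷ Z)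
     ∘ (cst (actA N A (ldual P ▷ P ▷ Z)) ∘ (slval i : hom C K (N ⊗ A)) ▹ (ldual P ▷ P ▷ Z))))).
    rewrite (reA (actl_eq (tauN_lact PhiE PhiI tauP Z))) -(reA (actA_natl _ _ _)) -act_swap.
    have lin : (slval i : hom C K (N ⊗ A)) ▹ Z ∘ mul2 (rho K) Z
      = mul2 (act_rho N (reg_rmod A)) Z ∘ (slval i : hom C K (N ⊗ A)) ▹ (A ▷ Z).
      exact: rmod_linear_tail i Z.
    apply: (iso_mono (iso_cst (actA N A Z))); rewrite cstKA (reA lin).
    by rewrite (reA (act_rho_tail N (reg_rmod A) Z)).
  by rewrite mul2E; nest; cst_eq.
rewrite -hB -compA -tensmMl.
have -> : rho N ∘ (slval i : hom C K (N ⊗ A)) = 0 by exact: (congr1 (@slval _ _ _ _) rhoi0).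
by rewrite (linear_zero (tensm_linl _)) compm0.
Qed.

End FixedModule.
End Theta.

(** * The Serre isomorphism of C_A *)

Section Phi.
Variables (k : fieldType) (C : fintens k) (p : pivotal C) (A : algebra C).
Implicit Types (N P Q : rmodule A) (X Y W V : C) (Z : regmod C).
Let RA := rmod_modcat A.
Variable H : ihom RA.
Hypothesis kerC :
  forall (X Y : C) (g : hom C X Y), exists K (i : hom C K X), is_ker i g.
Variables (lam : hom C A tunit) (Phi : hom C A (ldual A)).
Hypothesis PhiE : frob_iso lam = Phi.
Hypothesis PhiI : iso Phi.
Hypothesis symA : dualm Phi ∘ p A = Phi.
Variable tau : forall P, hom RA (ldual P ▷ (P : RA)) (reg_rmod A).
Hypothesis tauP : forall P, lam ∘ slval (tau P) = ev P.

Let lamI : iso (frob_iso lam).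
Proof. by rewrite PhiE. Qed.

Notation th P N Z := (thetaN H (tau P) N Z).

(** Paired with a through λ, both sides become q(g(x a)), so independently chosen τ are
    automatically compatible; [tauN_dualM] follows the same principle. *)
Lemma tauN_dualm P P' (g : hom RA P P') Z :
  tauN (tau P) Z ∘ dualm (slval g) ▹ (P ▷ Z) = tauN (tau P') Z ∘ ldual P' ◁ (slval g ▹ Z).
Proof.
apply: (pairing_inj lamI).
rewrite -!(reA (tauN_nat _ _)) !(reA (tauN_pairing (tauP _) _)).
rewrite -!act_swap -(reA (act_swap _ _)) (reA (evN_dualm _ _)).
rewrite -[in RHS](actl_eq (act_swap (slval g) _)).
by rewrite (reA (actl_eq (rmod_linear_tail g _))).
Qed.

Lemma tauN_dualM X P Z :
  tauN (tau (rmod_act X P)) Z ∘ dualM X P ▹ ((X ⊗ P) ▷ Z)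
  = tauN (tau P) Z ∘ ldual P ◁ evN X (P ▷ Z)
    ∘ (cst (actA _ _ _) ∘ _ ◁ cst (actA X P Z)).
Proof.
apply: (pairing_inj lamI).
rewrite -(reA (tauN_nat (tau (rmod_act X P)) _)) (reA (tauN_pairing (tauP (rmod_act X P)) _)).
change (rmod (rmod_act X P)) with (X ⊗ P).
rewrite -act_swap -(reA (act_swap _ _)) (reA (evN_dualM _ _ _)) -!compA.
rewrite (reA (actl_eq (act_rho_tail X P _))) (actl_eq (actA_natl _ _ _)).
rewrite !(reA (actA_natl _ _ _)) !(reA (actl_eq (evN_nat _ _))).
by rewrite -[in RHS](reA (tauN_nat _ _)) [in RHS](reA (tauN_pairing (tauP P) _)).
Qed.

Lemma theta_natr P N N' (f : hom RA N N') Z :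
  ihomr H P f ▹ Z ∘ th P N Z = th P N' Z ∘ slval f ▹ (ldual P ▷ Z).
Proof.
have e : ihomr H P f ∘ theta H (tau P) N = theta H (tau P) N' ∘ (slval f ⊠ idm (ldual P)).
  apply: ivN_inj => Z'; apply: (iso_epi (iso_cst (esym (actA N (ldual P) (P ▷ Z'))))).
  transitivity (ivN H P N' Z' ∘ (ihomr H P f ▹ (P ▷ Z') ∘ th P N (P ▷ Z'))).
    by rewrite /thetaN mul2E actrM -!compA.
  transitivity (ivN H P N' Z' ∘ (th P N' (P ▷ Z') ∘ slval f ▹ (ldual P ▷ P ▷ Z'))); last first.
    by rewrite /thetaN mul2E; nest; cst_eq.
  rewrite (reA (ivN_ihomr _ _ _ _)) (reA (ivN_theta _ _ _ _)) ivN_theta.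
  by rewrite (reA (rmod_linear_tail f _)) act_swap.
by rewrite /thetaN -mul2_comp e mul2_tens.
Qed.

Lemma theta_natl P P' N (g : hom RA P P') Z :
  ihoml H N g ▹ Z ∘ th P' N Z = th P N Z ∘ N ◁ (dualm (slval g) ▹ Z).
Proof.
have e : ihoml H N g ∘ theta H (tau P') N
    = theta H (tau P) N ∘ (idm (N : C) ⊠ dualm (slval g)).
  apply: ivN_inj => Z'; apply: (iso_epi (iso_cst (esym (actA N (ldual P') (P ▷ Z'))))).
  transitivity (ivN H P N Z' ∘ (ihoml H N g ▹ (P ▷ Z') ∘ th P' N (P ▷ Z'))).
    by rewrite /thetaN mul2E actrM -!compA.
  transitivity (ivN H P N Z' ∘ (th P N (P ▷ Z') ∘ N ◁ (dualm (slval g) ▹ (P ▷ Z')))); last first.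
    by rewrite /thetaN mul2E; nest; cst_eq.
  rewrite (reA (ivN_ihoml _ _ _ _)) (reA (ivN_theta _ _ _ _)) (actl_eq (tauN_dualm _ _)).
  by rewrite -(thetaN_nat _ _ _ (slval g ▹ Z')) (reA (ivN_theta _ _ _ _)).
rewrite /thetaN -mul2_comp e !mul2E; nest; cst_eq.
Qed.

Lemma theta_act X P N :
  theta H (tau P) (rmod_act X N) = ihA H X P N ∘ (idm X ⊠ theta H (tau P) N) ∘ cst (tensA X N (ldual P)).
Proof.
apply: ivN_inj => Z; apply: (iso_epi (iso_cst (esym (actA (X ⊗ N) (ldual P) (P ▷ Z))))).
transitivity (ivN H P (rmod_act X N) Z ∘ th P (rmod_act X N) (P ▷ Z)).
  by rewrite /thetaN mul2E -!compA.
transitivity (cst (esym (actA X N Z)) ∘ (X ◁ (ivN H P N Z ∘ th P N (P ▷ Z))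
   ∘ cst (actA X N (ldual P ▷ P ▷ Z)))).
  rewrite !ivN_theta; apply: (iso_mono (iso_cst (actA X N Z))); rewrite cstKA compA.
  by rewrite (act_rho_tail X N Z) -compA actA_natl compA actlM.
have e := ivN_ihA H X P N Z.
rewrite -(compA (ihA _ _ _ _)) actrM -!compA [in RHS]compA e /thetaN mul2E.
by nest; cst_eq.
Qed.

Lemma theta_dualM X P N :
  ihB H P N X ∘ (theta H (tau P) N ⊠ idm (ldual X)) =
  theta H (tau (rmod_act X P)) N ∘ (idm (N : C) ⊠ dualM X P) ∘ cst (tensA N (ldual P) (ldual X)).
Proof.
apply: ivN_inj => Z; change (rmod (rmod_act X P)) with (X ⊗ P).
apply: (iso_epi (iso_cst (esym (actA (N ⊗ ldual P) (ldual X) ((X ⊗ P) ▷ Z))))).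
apply: (iso_epi (iso_cst (esym (actA N (ldual P) (ldual X ▷ (X ⊗ P) ▷ Z))))).
have e := ivN_ihB H X P N Z.
transitivity (ivN H P N Z ∘ (H P N ◁ (evN X (P ▷ Z) ∘ ldual X ◁ cst (actA X P Z))
    ∘ th P N (ldual X ▷ (X ⊗ P) ▷ Z))).
  rewrite actrM -!compA [in LHS]compA e /thetaN mul2E.
  by nest; cst_eq.
transitivity (ivN H (rmod_act X P) N Z ∘ (th (rmod_act X P) N ((X ⊗ P) ▷ Z)
  ∘ (N ◁ (dualM X P ▹ ((X ⊗ P) ▷ Z)) ∘ N ◁ cst (esym (actA (ldual P) (ldual X) ((X ⊗ P) ▷ Z)))))); last first.
  rewrite /thetaN mul2E; nest; cst_eq.
rewrite -thetaN_nat (reA (ivN_theta _ _ _ _)) [in RHS](reA (ivN_theta _ _ _ _)).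
rewrite (reA1 (actl_eq1 (tauN_dualM _ _ _))) !actlM -!compA.
by cst_eq.
Qed.

(** X ⊗ [theta] is still an epimorphism: by [theta_act] it is, up to the isomorphism [ihA], the map
    [theta] of X ▷ N. *)
Lemma phi_inj P N (Pc : cproj H P) X (f g : hom C X (ldual (H P N))) :
  (forall Z, evN (H P N) Z ∘ (f ▹ (H P N ▷ Z) ∘ X ◁ th P N Z)
    = evN (H P N) Z ∘ (g ▹ (H P N ▷ Z) ∘ X ◁ th P N Z)) -> f = g.
Proof.
move=> e.
have tE (x : hom C X (ldual (H P N))) :
    (ev (H P N) ∘ (x ⊠ idm (H P N))) ∘ (idm X ⊠ theta H (tau P) N)
    = ev (H P N) ∘ (x ⊠ idm (H P N)) ∘ (invm (ihA H X P N) ∘ theta H (tau P) (rmod_act X N))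
       ∘ cst (esym (tensA X N (ldual P))).
  by rewrite theta_act -!compA cstK compm1 (reAid (invmK (ihA_iso _ _ _ _))).
have h (x : hom C X (ldual (H P N))) Z :
   ((ev (H P N) ∘ (x ⊠ idm (H P N))) ∘ (idm X ⊠ theta H (tau P) N)) ▹ Z
   = cst (esym (act1 Z)) ∘ (evN (H P N) Z ∘ (x ▹ (H P N ▷ Z) ∘ X ◁ th P N Z)) ∘
     cst (etrans (actA X (N ⊗ ldual P) Z) (congr1 (act (X : C)) (actA N (ldual P) Z))).
  by rewrite /evN /thetaN capE mul2E; nest; cst_eq.
have {h} : (ev (H P N) ∘ (f ⊠ idm (H P N))) ∘ (idm X ⊠ theta H (tau P) N) =
   (ev (H P N) ∘ (g ⊠ idm (H P N))) ∘ (idm X ⊠ theta H (tau P) N).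
  by apply: tens_faithfulP => Z; rewrite !h e.
rewrite !tE => /(iso_epi (iso_cst _)); rewrite !compA.
move/(theta_epi kerC PhiE PhiI (tauP P) Pc)/(iso_epi (iso_invm (ihA_iso _ _ _ _))) => h.
by apply: ldual_inj => Z; rewrite /evN -!cap_tens h.
Qed.

(* phi (y) (theta (n ⊗ q)) = q (y n), the pairing of P and P^* involving p. *)
Definition is_phi N P (phi : hom C (H N P) (ldual (H P N))) : Prop :=
  forall Z, evN (H P N) Z ∘ (phi ▹ (H P N ▷ Z) ∘ H N P ◁ th P N Z)
    = pivN p P Z ∘ ivN H N P (ldual P ▷ Z).

(** The functional y ⊗ n ⊗ q ↦ q(y(n)) is balanced for the module Hom(N,P) ⊗ N, because evaluation
    is A-linear and P is paired with P^* in a balanced way; so it factors through [theta] of that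
    module, and [ihA] separates Hom(N,P) from Hom(P,N). *)
Lemma phi_exists N P : cproj H P -> exists phi, @is_phi N P phi.
Proof.
move=> Pc.
pose h : hom C ((H N P ⊗ N) ⊗ ldual P) tunit :=
  ev (ldual P) ∘ (p P ⊠ idm (ldual P)) ∘ (iv H N P ⊠ idm (ldual P)).
have hE Z : cst (act1 Z) ∘ mul2 h Z = pivN p P Z ∘ iv H N P ▹ (ldual P ▷ Z).
  by rewrite /h pivNE /evN capE mul2E; nest; cst_eq.
have [|u uE] := theta_coker kerC PhiE PhiI (tauP P) Pc (N := rmod_act (H N P) N) (h := h).
  move=> Z; apply: (iso_mono (iso_cst (act1 Z))).
  have lin : iv H N P ▹ (ldual P ▷ Z) ∘ mul2 (rho (rmod_act (H N P) N)) (ldual P ▷ Z)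
      = mul2 (rho P) (ldual P ▷ Z) ∘ iv H N P ▹ (A ▷ ldual P ▷ Z).
    exact: rmod_linear_tail (iev H N P) _.
  rewrite !compA hE -!compA lin.
  rewrite (reA (pivN_balanced PhiE (tauP P) symA _)).
  by rewrite -(act_swap (iv H N P)).
exists (transp (u ∘ ihA H (H N P) P N)) => Z.
rewrite compA evN_transp.
have -> : cap (u ∘ ihA H (H N P) P N) Z ∘ H N P ◁ th P N Z =
   cst (act1 Z) ∘ mul2 (u ∘ theta H (tau P) (rmod_act (H N P) N)) Z
    ∘ cst (esym (actA _ _ _)).
  by rewrite theta_act capE /thetaN !mul2E; nest; cst_eq.
by rewrite uE hE -compA -mul2E.
Qed.

Lemma pivN_inj P V Z (x y : hom (regmod C) V (P ▷ Z)) :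
  pivN p P (ldual (ldual P) ▷ Z) ∘ (P ◁ coevN (ldual P) Z ∘ x)
  = pivN p P (ldual (ldual P) ▷ Z) ∘ (P ◁ coevN (ldual P) Z ∘ y) -> x = y.
Proof.
have e (f : hom (regmod C) V (P ▷ Z)) :
    pivN p P (ldual (ldual P) ▷ Z) ∘ (P ◁ coevN (ldual P) Z ∘ f) = p P ▹ Z ∘ f.
  by rewrite pivNE -!compA (reA (act_swap _ _)) (reAid (zig2 _ _)).
rewrite !e => /iso_mono; apply; have pI := piv_iso p P.
apply: (@iso_intro _ _ _ _ _ (invm (p P) ▹ Z)); rewrite -actrM.
  by rewrite (invmK pI) actm1.
by rewrite (invmVK pI) actm1.
Qed.

(** The inverse sends a functional ξ on Hom(P,N) to the map taking n to the element of P whose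
    pairing with each q is ξ(θ(n ⊗ q)); it exists because p is invertible, and is A-linear because θ
    and the pairing of P are balanced. *)
Lemma phi_iso N P (Pc : cproj H P) phi : @is_phi N P phi -> iso phi.
Proof.
move=> phiE.
have [g gE] : exists g : hom C (ldual (H P N) ⊗ N) P, forall Z, pivN p P Z ∘ g ▹ (ldual P ▷ Z)
    = evN (H P N) Z ∘ (ldual (H P N) ◁ th P N Z ∘ cst (actA (ldual (H P N)) N (ldual P ▷ Z))).
  pose s : hom C ((ldual (H P N) ⊗ N) ⊗ ldual P) tunit :=
    ev (H P N) ∘ (idm (ldual (H P N)) ⊠ theta H (tau P) N) ∘ cst (tensA (ldual (H P N)) N (ldual P)).
  exists (invm (p P) ∘ transp s) => Z.
  rewrite pivNE -compA -actrM compA (invmVK (piv_iso p P)) comp1m evN_transp.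
  by rewrite /s /evN !capE /thetaN mul2E; nest; cst_eq.
have gL : g \in @is_rmodm _ _ A (ldual (H P N) ▷ (N : RA)) P.
  apply: (@rmod_linear_intro _ _ _ (rmod_act (ldual (H P N)) N)) => Z; apply: pivN_inj.
  change (rmod (rmod_act (ldual (H P N)) N)) with (ldual (H P N) ⊗ N).
  rewrite -(reA (act_swap _ _)) (reA (gE _)) -mul2_nat -compA.
  rewrite (reA (act_rho_tail (ldual (H P N)) N _)) (reA (actl_eq (theta_balanced H PhiE PhiI (tauP P) N _))).
  rewrite -[in RHS](reA (mul2_nat _ _)) [in RHS](reA (pivN_balanced PhiE (tauP P) symA _)).
  rewrite -[in RHS]act_swap -[in RHS](reA (act_swap _ _)) [in RHS](reA (gE _)) -[in RHS]compA.
  by rewrite [in RHS](reA (actA_natl _ _ _)).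
set psi := icur H (SubL _ gL : hom RA (ldual (H P N) ▷ (N : RA)) P).
have psiE Z : ivN H N P Z ∘ psi ▹ (N ▷ Z) = mul2 g Z by apply: ivN_icur.
have gE2 Z : pivN p P Z ∘ mul2 g (ldual P ▷ Z) = evN (H P N) Z ∘ ldual (H P N) ◁ th P N Z.
  by rewrite mul2E compA gE -!compA cstK compm1.
apply: (@iso_intro _ _ _ _ _ psi).
  apply: ivN_inj => Z; rewrite actrM compA psiE actm1 compm1; apply: pivN_inj.
  rewrite -(reA (mul2_nat _ _)) (reA (gE2 _)) -(act_swap phi) -(reA (act_swap phi _)).
  rewrite (compA (phi ▹ _)) (compA (evN _ _)) phiE -compA.
  by rewrite ivN_nat.
apply: (phi_inj Pc) => Z; rewrite actrM -compA act_swap (compA (phi ▹ _)) (compA (evN _ _)).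
by rewrite phiE -compA psiE gE2 actm1 comp1m.
Qed.

Lemma ivN_phi N P (phi : hom C (H N P) (ldual (H P N))) V Z
    (x : hom (regmod C) V _) :
  @is_phi N P phi -> evN (H P N) Z ∘ (phi ▹ (H P N ▷ Z) ∘ (H N P ◁ th P N Z ∘ x))
    = pivN p P Z ∘ (ivN H N P (ldual P ▷ Z) ∘ x).
Proof. by move=> h; rewrite (compA (phi ▹ _)) (compA (evN _ _)) h -compA. Qed.

Lemma phi_nat_ihoml N N' P (f : hom RA N N') (phi : hom C (H N P) (ldual (H P N)))
    (phi' : hom C (H N' P) (ldual (H P N'))) :
  cproj H P -> @is_phi N P phi -> @is_phi N' P phi' ->
  phi ∘ ihoml H P f = dualm (ihomr H P f) ∘ phi'.
Proof.
move=> Pc phiE phiE'; apply: (phi_inj Pc) => Z.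
rewrite (actrM _ phi) (actrM _ (dualm _)) -!compA act_swap (ivN_phi _ phiE) ivN_ihoml.
rewrite (reA (evN_dualm _ _)).
rewrite -(reA (act_swap phi' _)).
rewrite (actl_eq (theta_natr _ _ _)) (ivN_phi _ phiE').
by [].
Qed.

Lemma phi_nat_ihomr N P P' (g : hom RA P P') (phi : hom C (H N P) (ldual (H P N)))
    (phi' : hom C (H N P') (ldual (H P' N))) :
  cproj H P' -> @is_phi N P phi -> @is_phi N P' phi' ->
  phi' ∘ ihomr H N g = dualm (ihoml H N g) ∘ phi.
Proof.
move=> Pc phiE phiE'; apply: (phi_inj Pc) => Z.
rewrite (actrM _ phi') (actrM _ (dualm _)) -!compA act_swap (ivN_phi _ phiE') ivN_ihomr.
rewrite (reA (pivN_dualm _ _ _)) (reA (evN_dualm _ _)) -(reA (act_swap phi _)).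
rewrite (actl_eq (theta_natl _ _ _)) (ivN_phi _ phiE).
by rewrite ivN_nat.
Qed.

Lemma phi_ihB X N P (phi : hom C (H N P) (ldual (H P N)))
    (phi' : hom C (H (rmod_act X N) P) (ldual (H P (rmod_act X N)))) :
  cproj H P -> @is_phi N P phi -> @is_phi (rmod_act X N) P phi' ->
  phi' ∘ ihB H (N : RA) (P : RA) X
  = dualm (invm (ihA H X (P : RA) (N : RA))) ∘ dualM X (H P N) ∘ (phi ⊠ idm (ldual X)).
Proof.
move=> Pc phiE phiE'; apply: (phi_inj Pc) => Z.
rewrite (actrM _ phi') (actrM _ (dualm _ ∘ _)) (actrM _ (dualm _)) -!compA act_swap (ivN_phi _ phiE').
rewrite (reA (evN_dualm _ _)).
have tE : invm (ihA H X (P : RA) (N : RA)) ▹ Z ∘ th P (rmod_act X N) Z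
   = cst (esym (actA X (H P N) Z)) ∘ (X ◁ th P N Z ∘ cst (actA X N (ldual P ▷ Z))).
  have aI := ihA_iso H X (P : RA) (N : RA).
  rewrite /thetaN -mul2_comp theta_act -!compA (reAid (invmK aI)).
  by rewrite !mul2E; nest; cst_eq.
rewrite -(reA (act_swap (dualM _ _) _)) -(reA (act_swap (phi ⊠ _) _)) -actlM tE.
rewrite (reA (evN_dualM _ _ _)) -?compA -(reA (act_swap (phi ⊠ _) _)) -actlM cstKA.
rewrite (reA (actA_nat _ _ _)) -?compA actm1 -(reA (act_swap phi _)) actlM.
rewrite (reA (actA_natl _ _ _)) (reA (actl_eq (evN_nat _ _))) (ivN_phi _ phiE).
have e := ivN_ihB H X N P (ldual P ▷ Z).
change (rmod (rmod_act X N)) with (X ⊗ N).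
apply: etrans (congr1 (fun u => pivN p P Z ∘ u) e) _.
by rewrite -!compA actlM -!compA actA_natl.
Qed.

Lemma phi_twist X N P (phi : hom C (H N P) (ldual (H P N)))
    (phi' : hom C (H N (rmod_act X P)) (ldual (H (rmod_act X P) N))) :
  cproj H (rmod_act X P) -> @is_phi N P phi -> @is_phi N (rmod_act X P) phi' ->
  phi' ∘ ihomr H (N : RA) (invm (p X) ▹ (P : RA)) ∘ ihA H (ldual (ldual X)) (N : RA) (P : RA)
  = dualm (invm (ihB H (P : RA) (N : RA) X)) ∘ dualM (H P N) (ldual X)
    ∘ (idm (ldual (ldual X)) ⊠ phi).
Proof.
move=> Pc phiE phiE'; apply: (phi_inj Pc) => Z.
have dI : iso (dualM X P ▹ Z).
  apply: (@iso_intro _ _ _ _ _ (invm (dualM X P) ▹ Z)); rewrite -actrM.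
    by rewrite (invmK (dualM_iso X P)) actm1.
  by rewrite (invmVK (dualM_iso X P)) actm1.
have aI Y (V W : regmod C) (f : hom (regmod C) V W) : iso f -> iso (Y ◁ f).
  move=> fI; apply: (@iso_intro _ _ _ _ _ (Y ◁ invm f)).
    exact: actl_eqid (invmK fI).
  exact: actl_eqid (invmVK fI).
(* Testing on P^* ⊗ X^* instead of (X ⊗ P)^* makes [pivN_dualM] and [theta_dualM] applicable. *)
apply: (iso_epi (aI (ldual (ldual X) ⊗ H N P) _ _ _ (aI (N : C) _ _ _ dI))).
rewrite -!(compA phi') (actrM _ phi') (actrM _ (dualm _ ∘ _)) (actrM _ (dualm _)) -!compA.
have pVK : p X ▹ (ldual X ▷ Z) ∘ invm (p X) ▹ (ldual X ▷ Z) = idm _.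
  by rewrite -actrM (invmVK (piv_iso p X)) actm1.
(* Common value of both sides. On the left, the inverse of p in the twist cancels the p that pairs X
   with X^*, which leaves a bare evaluation of X^** on X^*. *)
transitivity (evN (ldual X) Z ∘ (ldual (ldual X) ◁ (pivN p P (ldual X ▷ Z) ∘ ivN H N P (ldual P ▷ ldual X ▷ Z))
  ∘ (cst (actA (ldual (ldual X)) (H N P) (N ▷ ldual P ▷ ldual X ▷ Z)) ∘
    (ldual (ldual X) ⊗ H N P) ◁ (N ◁ cst (actA (ldual P) (ldual X) Z))))).
  have vE (W : regmod C) : ivN H N (rmod_act X P) W
      ∘ (ihomr H (N : RA) (invm (p X) ▹ (P : RA)) ∘ ihA H (ldual (ldual X)) (N : RA) (P : RA)) ▹ (N ▷ W)
      = (invm (p X) ⊠ idm (P : C)) ▹ W ∘ (cst (esym (actA (ldual (ldual X)) P W))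
        ∘ (ldual (ldual X) ◁ ivN H N P W ∘ cst (actA (ldual (ldual X)) (H N P) (N ▷ W)))).
    have e := ivN_ihA H (ldual (ldual X)) N P W.
    rewrite actrM (reA (ivN_ihomr _ _ _ _)); congr (_ ∘ _).
    by apply: etrans e _; rewrite -!compA.
  rewrite (reA (act_swap (ihomr H _ _ ∘ _) _)) (ivN_phi _ phiE') (reA (vE _)) -!compA.
  change (rmod (rmod_act X P)) with (X ⊗ P).
  rewrite !actA_natl (reA (actl_eq (ivN_nat H N P _))) (reA (actAi_natl _ _)).
  rewrite (reA (act_swap (invm _ ⊠ _) _)) (reA (pivN_dualM _ _ _ _)) -!compA.
  rewrite -(reA (act_swap (invm _ ⊠ _) _)) (reA (actA_nat _ _ _)) actm1 (reA (actA_natl _ _ _)) cstKA.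
  rewrite -(reA (actl_eq (ivN_nat H N P _))) -(reA (act_swap (invm _) _)).
  by rewrite (pivNE p X) actlM -!compA (reAid pVK).
rewrite (reA (evN_dualm _ _)).
have bI := ihB_iso H (P : RA) (N : RA) X.
have tE : invm (ihB H (P : RA) (N : RA) X) ▹ Z ∘ (th (rmod_act X P) N Z ∘ N ◁ (dualM X P ▹ Z))
   = cst (esym (actA (H P N) (ldual X) Z)) ∘ (th P N (ldual X ▷ Z) ∘ N ◁ cst (actA (ldual P) (ldual X) Z)).
  have e := theta_dualM X P N.
  have {}e : invm (ihB H (P : RA) (N : RA) X) ∘ (theta H (tau (rmod_act X P)) N ∘ (idm (N : C) ⊠ dualM X P))
    = (theta H (tau P) N ⊠ idm (ldual X)) ∘ cst (esym (tensA N (ldual P) (ldual X))).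
    apply: (iso_epi (iso_cst (tensA N (ldual P) (ldual X)))).
    by rewrite -!compA cstK compm1 (compA (theta _ _ _)) -e (reAid (invmK bI)).
  rewrite /thetaN -mul2_tensr -mul2_comp e !mul2E.
  by nest; cst_eq.
rewrite -(reA (act_swap (dualM _ _) _)) -(reA (act_swap (_ ⊠ phi) _)) -!actlM tE.
rewrite (reA (evN_dualM _ _ _)) -?compA -(reA (act_swap (_ ⊠ phi) _)) -actlM cstKA.
rewrite (reA (actA_nat _ _ _)) actA_natl.
rewrite actA_natl !actlM -!compA.
have h := congr1 (fun u => ldual (ldual X) ◁ u) (phiE (ldual X ▷ Z)).
by move: h; rewrite !actlM => /esym/reA ->; rewrite -!compA.
Qed.

Lemma rmod_serre_iso : exists phi,
  serre_iso (M := RA) (H := H) (S := idF RA) (fun X (N : RA) => invm (p X) ▹ N) phi.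
Proof.
(* [serre_iso] constrains φ at C-projective P only; 0 is the default elsewhere. *)
pose phi (N P : RA) : hom C (H N P) (ldual (H P N)) :=
  if pselect (cproj H P) is left Pc
  then projT1 (cid (phi_exists N Pc)) else 0.
have phiE N P : cproj H P -> @is_phi N P (phi N P).
  by move=> Pc; rewrite /phi; case: pselect => // Pc'; case: cid.
exists phi; split.
- by move=> N P Pc; apply: (phi_iso Pc (phiE N P Pc)).
- by move=> N N' P f Pc; apply: phi_nat_ihoml (phiE _ _ Pc) (phiE _ _ Pc).
- by move=> N P P' g Pc Pc'; apply: phi_nat_ihomr (phiE _ _ Pc) (phiE _ _ Pc').
- by move=> X N P Pc; apply: (phi_ihB _ (phiE _ _ Pc) (phiE (rmod_act X N) _ Pc)).
- move=> X N P Pc; have Pc' : cproj H (rmod_act X P) by apply: cproj_act.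
  exact: (phi_twist _ (phiE _ _ Pc) (phiE _ _ Pc')).
Qed.

End Phi.

(** * Transport along an equivalence of module categories *)

Section DualFunctor.
Variables (k : fieldType) (C : fintens k).

Lemma dualm_comp (X Y Z : C) (g : hom C Y Z) (f : hom C X Y) :
  dualm (g ∘ f) = dualm f ∘ dualm g.
Proof.
apply: ldual_inj => W; rewrite evN_dualm (actrM _ (dualm f)) compA evN_dualm actrM actlM.
by rewrite -[in RHS]compA -act_swap compA [in RHS]compA evN_dualm.
Qed.

End DualFunctor.

Section CanonicalSerre.
Variables (k : fieldType) (C : fintens k) (p : pivotal C).

(* With a pivotal structure, the Serre functor may be taken to be the identity
   functor, its twist being induced by the inverse of p. *)
Definition identity_serre (M : modcat C) : Prop :=
  exists (H : ihom M) phi,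
    serre_iso (H := H) (S := idF M) (fun X (N : M) => invm (p X) ▹ N) phi.

Lemma identity_serre_admits (M : modcat C) :
  identity_serre M -> admits_pivotal_structure p M.
Proof.
move=> [H [phi phiP]].
have pK X := invmK (piv_iso p X); have pVK X := invmVK (piv_iso p X).
have t_iso X N : iso (invm (p X) ▹ (N : M)).
  by apply: (@iso_intro _ _ _ _ _ (p X ▹ N)); rewrite -actrM ?pVK ?pK actm1.
have S_rex : right_exact (idF M) by [].
have t_nat X X' N N' (f : hom C X X') (g : hom M N N') :
    invm (p X') ▹ N' ∘ (ddualm f ▶ g) = (f ▶ g) ∘ invm (p X) ▹ N.
  rewrite -!actmM comp1m compm1; congr (_ ▶ _).
  by apply: (iso_epi (piv_iso p X)); rewrite -(compA _ (ddualm f)) -piv_nat compA pK comp1m -compA pK compm1.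
have t1 N : cst (act1 N) ∘ invm (p tunit) ▹ N ∘ (ddual1 C ▶ idm (N : M)) = cst (act1 N).
  by rewrite -compA -actrM -(piv1 p) pK actm1 compm1.
have tM X Y N : cst (actA X Y N) ∘ invm (p (X ⊗ Y)) ▹ N ∘ (ddualM X Y ▶ idm (N : M))
    = invm (p X) ▹ (Y ▷ N) ∘ (idm (ldual (ldual X)) ▶ (invm (p Y) ▹ N))
        ∘ cst (actA (ldual (ldual X)) (ldual (ldual Y)) N).
  have e : invm (p (X ⊗ Y)) ∘ ddualM X Y = invm (p X) ⊠ invm (p Y).
    have pI : iso (p X ⊠ p Y).
      by apply: (@iso_intro _ _ _ _ _ (invm (p X) ⊠ invm (p Y)));
        rewrite -tensmM ?pK ?pVK tensm1.
    by apply: (iso_epi pI); rewrite -compA -pivM pK -tensmM !pK tensm1.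
  by rewrite -compA -actrM e actA_nat act_lr.
exists H, (@RelSerre k C M H (idF M) S_rex _ t_iso t_nat t1 tM (ex_intro _ phi phiP)).
exists (fun N => idm N); split=> [|X N /=].
  by split=> [N|N N' f]; [apply: iso_id | rewrite comp1m compm1].
by rewrite -actrM pK actm1.
Qed.

Section Transport.
Variables (M N : modcat C) (H : ihom N) (F : functor M N).
Variable xi : forall (X : C) (P : M), hom N (X ▷ F P) (F (X ▷ P)).
Hypothesis FE : is_equivalence F.
Hypothesis xiI : forall X P, iso (xi X P).
Hypothesis xi_nat : forall (X X' : C) (P P' : M) (f : hom C X X') (g : hom M P P'),
  xi X' P' ∘ (f ▶ fmap F g) = fmap F (f ▶ g) ∘ xi X P.
Hypothesis xi1 : forall P, fmap F (cst (act1 P)) ∘ xi tunit P = cst (act1 (F P)).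
Hypothesis xiM : forall (X Y : C) P,
  fmap F (cst (actA X Y P)) ∘ xi (X ⊗ Y) P
    = xi X (Y ▷ P) ∘ (idm X ▶ xi Y P) ∘ cst (actA X Y (F P)).

Lemma xi_natr X X' P (f : hom C X X') : xi X' P ∘ f ▹ F P = fmap F (f ▹ P) ∘ xi X P.
Proof. by rewrite -xi_nat fmap1. Qed.

(** Hom(P,Q) in M will be Hom(F P, F Q) in N; its evaluation is the preimage under the full functor
    F of that of N, corrected by ξ. *)
Lemma pull_iev_ex P Q : exists e : hom M (H (F P) (F Q) ▷ P) Q,
  fmap F e ∘ xi _ P = iev H (F P) (F Q).
Proof.
have [e eE] := equivalence_full FE (iev H (F P) (F Q) ∘ invm (xi _ P)).
by exists e; rewrite eE -compA invmK // compm1.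
Qed.

Definition pull_iev P Q := projT1 (cid (pull_iev_ex P Q)).

Lemma pull_ievE P Q : fmap F (pull_iev P Q) ∘ xi _ P = iev H (F P) (F Q).
Proof. exact: projT2 (cid (pull_iev_ex P Q)). Qed.

Lemma pull_icurK (X : C) P Q (f : hom M (X ▷ P) Q) :
  pull_iev P Q ∘ (icur H (fmap F f ∘ xi X P) ▶ idm P) = f.
Proof.
apply: (equivalence_faithful FE); apply: (iso_epi (xiI X P)).
by rewrite fmapM -compA -xi_natr compA pull_ievE icurK.
Qed.

Lemma pull_ievK (X : C) P Q (g : hom C X (H (F P) (F Q))) :
  icur H (fmap F (pull_iev P Q ∘ (g ▶ idm P)) ∘ xi X P) = g.
Proof. by rewrite fmapM -compA -xi_natr compA pull_ievE ievK. Qed.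

Definition pull_ihom : ihom M := IHom pull_icurK pull_ievK.

Lemma pull_ihomr P Q Q' (f : hom M Q Q') :
  ihomr pull_ihom P f = ihomr H (F P) (fmap F f).
Proof. by rewrite /ihomr /= fmapM -compA pull_ievE. Qed.

Lemma pull_ihoml P P' Q (f : hom M P P') :
  ihoml pull_ihom Q f = ihoml H (F Q) (fmap F f).
Proof. by rewrite /ihoml /= fmapM -compA -xi_nat compA pull_ievE. Qed.

Lemma pull_ihA X P Q :
  ihA pull_ihom X P Q = ihomr H (F P) (xi X Q) ∘ ihA H X (F P) (F Q).
Proof.
apply: (icur_inj (H := H)); rewrite actrM compA iev_ihomr -compA iev_ihA.
rewrite /ihA /= icurK fmapM -compA xiM -!compA (reA (esym (xi_nat _ _))).
by rewrite -pull_ievE actlM -!compA.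
Qed.

Lemma xi_evN X P :
  fmap F (evN X P) ∘ (xi (ldual X) (X ▷ P) ∘ ldual X ◁ xi X P) = evN X (F P).
Proof.
have -> : xi (ldual X) (X ▷ P) ∘ ldual X ◁ xi X P
  = fmap F (cst (actA _ _ _)) ∘ xi (ldual X ⊗ X) P ∘ cst (esym (actA _ _ _)).
  by rewrite xiM -compA cstK compm1.
rewrite /evN !capE !fmapM -!compA.
rewrite (reAid (_ : fmap F (cst (esym _)) ∘ fmap F (cst _) = idm _)); last first.
  by rewrite -fmapM cstK fmap1.
by rewrite (reA (esym (xi_natr _ _))) (reA1 (xi1 P)).
Qed.

Lemma pull_ihB P Q X :
  ihB pull_ihom P Q X = ihoml H (F Q) (invm (xi X P)) ∘ ihB H (F P) (F Q) X.
Proof.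
have e : ihoml H (F Q) (xi X P) ∘ ihB pull_ihom P Q X = ihB H (F P) (F Q) X.
  apply: icur_inj; rewrite actrM compA iev_ihoml -compA -act_swap compA iev_ihB.
  rewrite /ihB /= icurK.
  rewrite -capE -/(evN X P) !fmapM -!compA (reA (xiM _ _ _)) -!compA actA_natl.
  rewrite (reA (esym (xi_nat _ _))) (reA1 (pull_ievE _ _)).
  by rewrite -xi_evN !actlM -!compA.
by rewrite -e compA -ihomlM invmVK // ihoml1 comp1m.
Qed.

(** A short exact sequence in N is carried to M by a quasi-inverse of F, which preserves kernels and
    cokernels, and is recovered up to isomorphism by applying F. *)
Lemma pull_cproj P : cproj pull_ihom P -> cproj H (F P).
Proof.
move=> Pc X Y Z f g [kfg cfg].
have [G GE [_ [eps [epsI epsN]]]] := equivalence_sym FE.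
have [kG cG] : short_exact (ihomr pull_ihom P (fmap G f)) (ihomr pull_ihom P (fmap G g)).
  by apply: Pc; split; [apply: equivalence_ker | apply: equivalence_coker].
rewrite !pull_ihomr in kG cG.
have eI W : iso (ihomr H (F P) (eps W)) by apply: iso_ihomr.
have eN W W' (h : hom N W W') :
    ihomr H (F P) (eps W') ∘ ihomr H (F P) (fmap F (fmap G h))
    = ihomr H (F P) h ∘ ihomr H (F P) (eps W).
  by rewrite -!ihomrM; congr ihomr; apply: epsN.
split.
  exact: is_ker_iso (eI X) (eI Y) (eI Z) (eN _ _ f) (eN _ _ g) kG.
exact: is_coker_iso (eI X) (eI Y) (eI Z) (eN _ _ f) (eN _ _ g) cG.
Qed.

(** The structure maps a and b of the two internal Homs differ by a factor ξ ([pull_ihA],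
    [pull_ihB]); naturality of φ along ξ moves this factor across φ, where it cancels. *)
Lemma pull_serre_iso phi :
  serre_iso (H := H) (S := idF N) (fun X (Q : N) => invm (p X) ▹ Q) phi ->
  serre_iso (H := pull_ihom) (S := idF M) (fun X (Q : M) => invm (p X) ▹ Q)
    (fun P Q => phi (F P) (F Q)).
Proof.
move=> [phiI phiN phiN' phiB phiT]; split.
- by move=> P Q /pull_cproj; apply: phiI.
- by move=> P P' Q f /pull_cproj Qc; rewrite pull_ihoml pull_ihomr; apply: phiN.
- move=> P Q Q' g /pull_cproj Qc /pull_cproj Qc'; rewrite pull_ihoml pull_ihomr.
  exact: phiN'.
- move=> X P Q /pull_cproj Qc; rewrite pull_ihB pull_ihA.
  have aI := ihA_iso H X (F Q) (F P); have xI := iso_ihomr H (F Q) (xiI X P).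
  rewrite invm_comp // dualm_comp (fmap_invm (ihomF H (F Q)) (xiI X P)) compA phiN //.
  by rewrite -(compA (dualm _) (phi _ _)) phiB // !compA.
- move=> X P Q Qc'; have Qc := pull_cproj Qc'.
  have XQc : cproj H (X ▷ F Q) by apply: cproj_act.
  have XQc' : cproj H (F (X ▷ Q)) by apply: pull_cproj; apply: cproj_act.
  have e : ihomr H (F P) (fmap F (invm (p X) ▹ Q)) ∘ ihomr H (F P) (xi (ldual (ldual X)) Q)
      = ihomr H (F P) (xi X Q) ∘ ihomr H (F P) (invm (p X) ▹ F Q).
    by rewrite -!ihomrM -xi_natr.
  have eI : invm (ihoml H (F P) (invm (xi X Q))) = ihoml H (F P) (xi X Q).
    by apply: invm_uniq; rewrite -ihomlM ?invmK ?invmVK // ihoml1.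
  rewrite pull_ihomr pull_ihA pull_ihB invm_comp; last first.
  - exact: ihB_iso.
  - by apply: iso_ihoml; apply: iso_invm.
  rewrite eI dualm_comp compA -(compA (phi _ _)) e (compA (phi _ _)) phiN' //.
  rewrite -(compA (dualm _) (phi _ _)) -(compA (dualm _) (phi _ _ ∘ _)) phiT //.
  by rewrite !compA.
Qed.

End Transport.

Lemma identity_serre_equiv (M N : modcat C) :
  mod_equivalent M N -> identity_serre N -> identity_serre M.
Proof.
move=> [F [xi [FE [xiI xiN] xi1 xiM]]] [H [phi phiP]].
exists (pull_ihom H FE xiI xiN); exists (fun P Q => phi (F P) (F Q)).
exact: pull_serre_iso.
Qed.

End CanonicalSerre.

(** * Internal Homs in C_A, and the converse direction *)

Section IhomExistence.
Variables (k : fieldType) (C : fintens k).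

Lemma ihom_intro (M : modcat C) :
  (forall P N : M, exists (E : C) (e : hom M (E ▷ P) N),
     forall X (f : hom M (X ▷ P) N), exists! g : hom C X E, e ∘ g ▹ P = f) ->
  inhabited (ihom M).
Proof.
move=> ex.
pose E P N := projT1 (cid (ex P N)).
have ex' P N : exists e : hom M (E P N ▷ P) N,
    forall X (f : hom M (X ▷ P) N), exists! g : hom C X (E P N), e ∘ g ▹ P = f.
  exact: projT2 (cid (ex P N)).
pose e P N := projT1 (cid (ex' P N)).
have eP P N X (f : hom M (X ▷ P) N) : exists! g, e P N ∘ g ▹ P = f.
  exact: (projT2 (cid (ex' P N))).
have eP' P N X (f : hom M (X ▷ P) N) : exists g, e P N ∘ g ▹ P = f.
  by have [g [gE _]] := eP P N X f; exists g.
pose c X P N f := projT1 (cid (eP' P N X f)).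
have cK X P N f : e P N ∘ c X P N f ▹ P = f by apply: projT2 (cid (eP' P N X f)).
have eK X P N g : c X P N (e P N ∘ g ▹ P) = g.
  have [g' [_ U]] := eP P N X (e P N ∘ g ▹ P).
  exact: etrans (esym (U _ (cK X P N _))) (U g erefl).
by constructor; apply: (@IHom k C M E e c cK eK).
Qed.

Hypothesis kerC :
  forall (X Y : C) (g : hom C X Y), exists K (i : hom C K X), is_ker i g.

(* Hom_A(P,N) is the kernel, inside N ⊗ P^*, of the obstruction to A-linearity. *)
Lemma rmod_ihom (A : algebra C) : inhabited (ihom (rmod_modcat A)).
Proof.
apply: ihom_intro => P N; pose V := rmod N ⊗ ldual P.
(* q is the generic morphism P -> N. The defect of linearity d is natural in X ([dE]), so the defect
   of any f is that of q precomposed with f. *)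
pose q : hom C (V ⊗ P) N := runcur (idm V).
pose d X (u : hom C (X ⊗ P) N) : hom C (X ⊗ P ⊗ A) N :=
  u ∘ (idm X ⊠ rho P) - rho N ∘ (u ⊠ idm (A : C)) ∘ cst (esym (tensA X P A)).
have dE X (f : hom C X V) : d V q ∘ (f ⊠ idm (rmod P ⊗ A)) = d X (runcur f).
  rewrite /d compBm -[f in RHS](comp1m f) runcur_comp -/q; congr (_ - _).
    by rewrite -!compA -!tensmM !compm1 !comp1m.
  rewrite tensmMl -!compA; congr (_ ∘ (_ ∘ _)).
  apply: (iso_mono (iso_cst (tensA V P A))); rewrite cstKA compA tensmA tensm1.
  by rewrite -compA cstK compm1.
have dP X (u : hom C (X ⊗ P) N) :
    d X u = 0 <-> u \in @is_rmodm _ _ A (rmod_act X P) N.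
  have e1 : d X u ∘ cst (tensA X P A) = u ∘ act_rho X P - rho N ∘ (u ⊠ idm (A : C)).
    by rewrite /d compBm -!compA cstK compm1.
  split=> [d0|/eqP /= e2]; first by apply/eqP/subr0_eq; rewrite -[LHS]e1 d0 comp0m.
  by apply: (iso_epi (iso_cst (tensA X P A))); rewrite e1 comp0m e2 subrr.
have [E [i iK]] := kerC (rcur (d V q)); have iM := is_ker_mono iK.
have zE X (f : hom C X V) : rcur (d V q) ∘ f = 0 <-> d X (runcur f) = 0.
  rewrite -dE -rcur_comp; split=> [h|->]; last exact: rcur0.
  by rewrite -(rcurK (_ ∘ _)) h -(rcur0 X (rmod P ⊗ A) (rmod N)) rcurK.
have iL : runcur i \in @is_rmodm _ _ A (rmod_act E P) N.
  by apply/dP/zE; apply: iK.1.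
exists E, (SubL _ iL) => X f.
have [|g [gE gU]] := iK.2 X (rcur (slval f)).
  by apply/zE; rewrite rcurK; apply/dP; apply: (slP f).
exists g; split.
  apply: val_inj; change (runcur i ∘ (g ⊠ idm (rmod P)) = slval f).
  by rewrite -runcur_comp gE rcurK.
move=> g' g'E; apply: gU.
have {}g'E : runcur i ∘ (g' ⊠ idm (rmod P)) = slval f by rewrite -g'E.
by rewrite -g'E -runcur_comp runcurK.
Qed.

Lemma symmetric_identity_serre (p : pivotal C) (A : frobenius C) :
  symmetric_frobenius p A -> identity_serre p (rmod_modcat A).
Proof.
move=> symA; have [H] := rmod_ihom A.
have lamI : iso (frob_iso (frob_form A)) := frob_formP A.
(* The symmetry condition multiplied by Φ, which removes the inverse contained in the Nakayama
   isomorphism. *)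
have symP : dualm (frob_iso (frob_form A)) ∘ p A = frob_iso (frob_form A).
  apply: (iso_mono (iso_invm lamI)); rewrite (invmK lamI) compA.
  exact: symA.
have ex (P : rmodule A) : exists t : hom (rmod_modcat A) (ldual P ▷ (P : rmod_modcat A)) (reg_rmod A),
    frob_form A ∘ slval t = ev P.
  exact: (frob_lift lamI (W := rmod_act (ldual P) P) (ev P)).
pose tau P := projT1 (cid (ex P)).
have tauP P : frob_form A ∘ slval (tau P) = ev P by apply: projT2 (cid (ex P)).
by exists H; apply: (rmod_serre_iso H kerC erefl lamI symP tauP).
Qed.

Lemma symmetric_frobenius_pivotal (p : pivotal C) (M : modcat C) (A : frobenius C) :
  symmetric_frobenius p A -> mod_equivalent M (rmod_modcat A) ->
  admits_pivotal_structure p M.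
Proof.
move=> symA MA; apply: identity_serre_admits.
exact: identity_serre_equiv MA (symmetric_identity_serre symA).
Qed.

End IhomExistence.

(** * The endomorphism algebra of a generator *)

Section EndAlgebra.
Variables (k : fieldType) (C : fintens k) (M : modcat C) (H : ihom M) (P : M).
Implicit Types (X Y : C) (N Q : M).

Definition icomp N : hom C (H P N ⊗ H P P) (H P N) :=
  icur H (iev H P N ∘ (H P N ◁ iev H P P ∘ cst (actA (H P N) (H P P) P))).

Lemma iev_icomp N : iev H P N ∘ icomp N ▹ P
  = iev H P N ∘ (H P N ◁ iev H P P ∘ cst (actA (H P N) (H P P) P)).
Proof. exact: icurK. Qed.

Lemma icomp_assoc N :
  icomp N ∘ (icomp N ⊠ idm (H P P))
  = icomp N ∘ (idm (H P N) ⊠ icomp P) ∘ cst (tensA (H P N) (H P P) (H P P)).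
Proof.
apply: icur_inj; rewrite !actrM compA iev_icomp [in RHS]compA [in RHS]compA iev_icomp -!compA.
rewrite (actA_nat (icomp N)) actm1 -(reA (act_swap _ _)) (reA (iev_icomp _)) -!compA (reA (actA_natl _ _ _)).
rewrite (reA (actA_nat _ (icomp P) _)) (reA (actl_eq (iev_icomp _))) !actlM -!compA.
by cst_eq.
Qed.

Definition iunit : hom C tunit (H P P) := icur H (cst (act1 P)).

Lemma iev_iunit : iev H P P ∘ iunit ▹ P = cst (act1 P).
Proof. exact: icurK. Qed.

Lemma icomp_unitr N : icomp N ∘ (idm (H P N) ⊠ iunit) = cst (tens1r (H P N)).
Proof.
apply: icur_inj; rewrite actrM compA iev_icomp -!compA (actA_nat _ iunit).
by rewrite (reA1 (actl_eq1 iev_iunit)) cst_tens1r_act.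
Qed.

Lemma icomp_unitl : icomp P ∘ (iunit ⊠ idm (H P P)) = cst (tens1l (H P P)).
Proof.
apply: icur_inj; rewrite actrM compA iev_icomp -!compA (actA_nat iunit) actm1.
rewrite -(reA (act_swap _ _)) (reA1 iev_iunit) (reA (act1_nat _)).
by rewrite cst_tens1l_act.
Qed.

Definition end_alg : algebra C := Algebra (icomp_assoc P) icomp_unitl (icomp_unitr P).

Definition hom_rmod N : rmodule end_alg :=
  @RModule k C end_alg (H P N) (icomp N) (icomp_assoc N) (icomp_unitr N).

Local Notation RA := (rmod_modcat end_alg).

Lemma icomp_ihomr N N' (f : hom M N N') :
  ihomr H P f ∘ icomp N = icomp N' ∘ (ihomr H P f ⊠ idm (H P P)).
Proof.
apply: icur_inj; rewrite !actrM compA iev_ihomr -compA iev_icomp [RHS]compA iev_icomp -!compA.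
by rewrite (actA_nat (ihomr H P f)) actm1 -(reA (act_swap _ _)) (reA (iev_ihomr _ _ _)).
Qed.

Lemma icomp_ihA X N :
  ihA H X P N ∘ ((idm X ⊠ icomp N) ∘ cst (tensA X (H P N) (H P P)))
  = icomp (X ▷ N) ∘ (ihA H X P N ⊠ idm (H P P)).
Proof.
apply: icur_inj; rewrite !actrM compA iev_ihA [RHS]compA iev_icomp -!compA.
rewrite (actA_nat (ihA H X P N)) actm1 -(reA (act_swap _ _)) (reA (iev_ihA _ _ _ _)).
rewrite (reA (actA_nat _ (icomp N) _)) (reA (actl_eq (iev_icomp _))) !actlM -!compA.
by rewrite (reA (actA_natl _ _ _)); cst_eq.
Qed.

Definition hom_functor : functor M RA.
Proof.
exists hom_rmod (fun N N' f => @SubL _ _ _ (@is_rmodm_closed k C end_alg (hom_rmod N) (hom_rmod N'))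
  (ihomr H P f) (introT eqP (icomp_ihomr f))).
- by move=> N; apply: val_inj; apply: ihomr1.
- by move=> N N' N'' g f; apply: val_inj; apply: ihomrM.
- by move=> N N' a f g; apply: val_inj; apply: (fmap_lin (ihomF H P)).
Defined.

Definition hom_functor_act X N : hom RA (X ▷ hom_functor N) (hom_functor (X ▷ N)) :=
  @SubL _ _ _ (@is_rmodm_closed k C end_alg (rmod_act X (hom_rmod N)) (hom_rmod (X ▷ N)))
    (ihA H X P N) (introT eqP (icomp_ihA X N)).

Lemma rmod_iso (N N' : rmodule end_alg) (f : hom RA N N') : iso (slval f) -> iso f.
Proof.
move=> fI.
have gL : invm (slval f) \in @is_rmodm _ _ end_alg N' N.
  apply/eqP; apply: (iso_mono fI); rewrite compA (invmVK fI) comp1m compA rmod_linear.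
  by rewrite -compA -tensmMl (invmVK fI) tensm1 compm1.
by apply: (@iso_intro _ RA _ _ _ (SubL _ gL : hom RA N' N)); apply: val_inj; [apply: invmK | apply: invmVK].
Qed.

Lemma hom_functor_act_iso X N : iso (hom_functor_act X N).
Proof. by apply: rmod_iso; apply: ihA_iso. Qed.

Lemma hom_functor_act_nat X X' N N' (f : hom C X X') (g : hom M N N') :
  hom_functor_act X' N' ∘ (f ▶ fmap hom_functor g)
  = fmap hom_functor (f ▶ g) ∘ hom_functor_act X N.
Proof.
apply: val_inj; change (ihA H X' P N' ∘ (f ⊠ ihomr H P g) = ihomr H P (f ▶ g) ∘ ihA H X P N).
apply: icur_inj; rewrite !actrM compA iev_ihA [RHS]compA iev_ihomr -!compA iev_ihA.
by rewrite actA_nat !compA -!actmM !compm1 comp1m iev_ihomr.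
Qed.

Lemma hom_functor_act1 N :
  fmap hom_functor (cst (act1 N)) ∘ hom_functor_act tunit N = cst (act1 (hom_functor N)).
Proof.
apply: val_inj.
apply: etrans _ (esym (slval_cst (act1 (hom_functor N))
  (tens1l (H P N) : rmod (rmod_act tunit (hom_rmod N)) = rmod (hom_rmod N)))).
change (ihomr H P (cst (act1 N)) ∘ ihA H tunit P N = cst (tens1l (H P N))).
apply: icur_inj; rewrite actrM compA iev_ihomr -compA iev_ihA cst_tens1l_act.
by rewrite [LHS]compA act1_nat -compA.
Qed.

Lemma hom_functor_actM X Y N :
  fmap hom_functor (cst (actA X Y N)) ∘ hom_functor_act (X ⊗ Y) N
  = hom_functor_act X (Y ▷ N) ∘ (idm X ▶ hom_functor_act Y N) ∘ cst (actA X Y (hom_functor N)).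
Proof.
apply: val_inj.
apply: etrans _ (esym (congr1 (fun u => slval (hom_functor_act X (Y ▷ N)
  ∘ (idm X ▶ hom_functor_act Y N)) ∘ u) (slval_actA X Y (hom_rmod N)))).
change (ihomr H P (cst (actA X Y N)) ∘ ihA H (X ⊗ Y) P N =
  ihA H X P (Y ▷ N) ∘ (idm X ⊠ ihA H Y P N) ∘ cst (tensA X Y (H P N))).
apply: icur_inj; rewrite !actrM compA iev_ihomr -compA iev_ihA [RHS]compA [in RHS]compA iev_ihA.
rewrite compA actA_natl -!compA (reA (actA_nat _ (ihA H Y P N) _)).
by rewrite (reA (actl_eq (iev_ihA _ _ _ _))) -?compA; cst_eq.
Qed.

End EndAlgebra.

(** * The equivalence of M with modules over the endomorphism algebra *)

Section Generator.
Variables (k : fieldType) (C : fintens k) (M : finmod C) (H : ihom M) (P : M).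
Implicit Types (X Y : C) (N Q : M).
Hypothesis proj1 : forall (N Q R : M) (f : hom M N Q) (c : hom M Q R) (h : hom M P R),
  is_coker f c -> exists h', c ∘ h' = h.
Hypothesis proj2 : forall (N Q R : M) (f : hom M N Q) (c : hom M Q R) (h : hom M P Q),
  is_coker f c -> c ∘ h = 0 -> exists h', f ∘ h' = h.
Hypothesis gen : forall (N Q : M) (g : hom M N Q),
  (forall h : hom M P Q, exists h', g ∘ h' = h) ->
  exists K (i : hom M K N), is_ker i g /\ is_coker i g.
Local Notation A := (end_alg H P).
Local Notation RA := (rmod_modcat A).

(** Transposition along X ▷ - ⊣ ^*X ▷ -: morphisms out of X ▷ P become morphisms out of P, to which
    projectivity applies, and ^*X ▷ - preserves cokernels. *)
Let radj X N (h : hom M (X ▷ P) N) := rdual X ◁ h ∘ cup (rcoev X) P.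

Let radj_lift X N Q (f : hom M N Q) (h : hom M (X ▷ P) Q) (t : hom M P (rdual X ▷ N)) :
  rdual X ◁ f ∘ t = radj h -> f ∘ (cap (rev X) N ∘ X ◁ t) = h.
Proof.
move=> e; rewrite compA -cap_nat -compA -actlM e /radj actlM compA cap_nat.
by rewrite -compA (dual_zig2 (rdualP X)) compm1.
Qed.

Lemma free_lift X N Q R (f : hom M N Q) (c : hom M Q R) (h : hom M (X ▷ P) R) :
  is_coker f c -> exists h', c ∘ h' = h.
Proof.
move=> /(@fm_rexl _ _ M (rdual X)) fc; have [t tE] := proj1 (radj h) fc.
by exists (cap (rev X) Q ∘ X ◁ t); apply: radj_lift.
Qed.

Lemma free_exact X N Q R (f : hom M N Q) (c : hom M Q R) (h : hom M (X ▷ P) Q) :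
  is_coker f c -> c ∘ h = 0 -> exists h', f ∘ h' = h.
Proof.
move=> /(@fm_rexl _ _ M (rdual X)) fc ch; have [|t tE] := proj2 (h := radj h) fc.
  rewrite /radj compA /= -actlM ch.
  by rewrite (linear_zero (actm_linr _)) comp0m.
by exists (cap (rev X) N ∘ X ◁ t); apply: radj_lift.
Qed.

(* Hom(X ▷ P, -) = Hom(P, rdual X ▷ -) is right exact for all X, so that iev
   lifts along c; this lift splits Hom(P, c). *)
Lemma ihomr_coker N Q R (f : hom M N Q) (c : hom M Q R) :
  is_coker f c -> is_coker (ihomr H P f) (ihomr H P c).
Proof.
move=> fc; have [h' h'E] := free_lift (iev H P R) fc.
pose s := icur H h'.
have sE : ihomr H P c ∘ s = idm (H P R).
  by apply: icur_inj; rewrite actrM compA iev_ihomr -compA icurK h'E actm1 compm1.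
pose u := iev H P Q ∘ (idm (H P Q) - s ∘ ihomr H P c) ▹ P.
have [|v vE] := free_exact (h := u) fc.
  rewrite /u compA -iev_ihomr -compA -actrM compmB compm1 compA sE comp1m subrr.
  by rewrite (linear_zero (actm_linl _)) compm0.
apply: (split_coker (s := s) (h := icur H v)) => //.
  by rewrite -ihomrM fc.1; apply: (fmap0 (ihomF H P)).
by apply: icur_inj; rewrite actrM compA iev_ihomr -compA icurK.
Qed.

Lemma generator_cproj : cproj H P.
Proof. by move=> N Q R f g [fg gf]; split; [apply: ihomF_ker | apply: ihomr_coker]. Qed.

(** Any h : P -> N is the evaluation at the element 1 -> Hom(P,N) that it names, so all of them lift
    along [iev H P N] and the generator property applies. *)
Lemma iev_normal N : exists K (i : hom M K (H P N ▷ P)),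
  is_ker i (iev H P N) /\ is_coker i (iev H P N).
Proof.
apply: gen => h; exists (icur H (h ∘ cst (act1 P)) ▹ P ∘ cst (esym (act1 P))).
by rewrite compA icurK -compA cstK compm1.
Qed.

Lemma iev_epi N Q (f g : hom M N Q) : f ∘ iev H P N = g ∘ iev H P N -> f = g.
Proof. by have [K [i [_ /is_coker_epi]]] := iev_normal N; apply. Qed.

Lemma hom_functor_faithful : faithful (hom_functor H P).
Proof.
move=> N Q f g /(congr1 (@slval _ _ _ _)) e.
by apply: iev_epi; rewrite -!iev_ihomr; congr (_ ∘ _ ▹ P).
Qed.

Lemma hom_functor_full : full (hom_functor H P).
Proof.
move=> N Q t; pose t' : hom C (H P N) (H P Q) := slval t.
have tL : t' ∘ icomp H P N = icomp H P Q ∘ (t' ⊠ idm (H P P)) by apply: (rmod_linear t).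
have [K [i [iK iC]]] := iev_normal N.
have [|u [uE _]] := iC.2 _ (iev H P Q ∘ t' ▹ P).
  apply: iev_epi; rewrite comp0m.
  (* a is i seen through Hom(P, Hom(P,N) ▷ P) = Hom(P,N) ⊗ A. Composition kills it since evaluation
     kills i, and A-linearity of t' transfers this to the target. *)
  pose a := invm (ihA H (H P N) P P) ∘ ihomr H P i.
  have aE : i ∘ iev H P K = H P N ◁ iev H P P ∘ (cst (actA _ _ _) ∘ a ▹ P).
    rewrite -iev_ihomr compA -iev_ihA -compA -actrM /a.
    by rewrite compA (invmVK (ihA_iso _ _ _ _)) comp1m.
  have a0 : icomp H P N ∘ a = 0.
    apply: icur_inj; rewrite actrM compA iev_icomp -!compA -aE compA iK.1 comp0m.
    by rewrite (linear_zero (actm_linl _)) compm0.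
  transitivity (iev H P Q ∘ (icomp H P Q ∘ (t' ⊠ idm (H P P)) ∘ a) ▹ P); last first.
    by rewrite -tL -compA a0 compm0 (linear_zero (actm_linl _)) compm0.
  rewrite -!compA aE actrM [in RHS]compA iev_icomp (actrM _ (t' ⊠ _)) -!compA.
  by rewrite (reA (actA_nat t' _ _)) actm1 (reA (act_swap _ _)).
exists u; apply: val_inj; change (ihomr H P u = t').
by apply: icur_inj; rewrite iev_ihomr uE.
Qed.

Hypothesis cokers : forall (N Q : M) (f : hom M N Q), exists R (c : hom M Q R), is_coker f c.

(** The preimage of L is L ⊗_A P, the cokernel of the difference between the action of A on L and
    its evaluation on P. Hom(P,-) preserves this cokernel and turns it into L ⊗ A ⊗ A -> L ⊗ A -> L,
    where the action is split in C by the unit. *)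
Lemma hom_functor_ess_surj : ess_surj (hom_functor H P).
Proof.
move=> L; change (rmodule A) in L; pose d := rho L ▹ P - L ◁ iev H P P ∘ cst (actA L (H P P) P).
have [N [c cC]] := cokers d; have cHC := ihomr_coker cC.
have cE : c ∘ rho L ▹ P = c ∘ (L ◁ iev H P P ∘ cst (actA L (H P P) P)).
  by apply/eqP; rewrite -subr_eq0 -compmB; apply/eqP; apply: cC.1.
pose q : hom C L (H P N) := icur H c.
have qA : q ∘ rho L = ihomr H P c ∘ ihA H L P P.
  apply: icur_inj; rewrite !actrM compA icurK cE [RHS]compA iev_ihomr -!compA.
  by rewrite iev_ihA.
have qL : q \in @is_rmodm _ _ A L (hom_rmod H P N).
  apply/eqP; change (q ∘ rho L = icomp H P N ∘ (q ⊠ idm (H P P))); rewrite qA.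
  apply: icur_inj; rewrite !actrM compA iev_ihomr -compA iev_ihA [RHS]compA iev_icomp -!compA.
  by rewrite (actA_nat q) actm1 -(reA (act_swap _ _)) (reA1 (icurK H c)).
have aI := ihA_iso H L P P; have aI' := ihA_iso H (rmod L ⊗ H P P) P P.
have dE : ihomr H P d ∘ ihA H (rmod L ⊗ H P P) P P
    = ihA H L P P ∘ (rho L ⊠ idm (H P P) - (idm (rmod L) ⊠ icomp H P P) ∘ cst (tensA L (H P P) (H P P))).
  apply: icur_inj; rewrite !actrM compA iev_ihomr -compA iev_ihA [RHS]compA iev_ihA -compA.
  rewrite (linear_sub _ _ (actm_linl _)) compmB compmB /d compBm; congr (_ - _).
    by rewrite (actA_nat (rho L)) actm1 (reA (act_swap _ _)).
  rewrite -!compA (reA (actA_natl _ _ _)) actrM (reA (actA_nat _ (icomp H P P) _)).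
  by rewrite (reA (actl_eq (iev_icomp _ _ _))) !actlM -!compA; cst_eq.
have [|u [uE _]] := cHC.2 _ (rho L ∘ invm (ihA H L P P)).
  apply: (iso_epi aI'); rewrite comp0m -!compA dE (reAid (invmK aI)).
  by rewrite compmB compA (rhoA L) subrr.
exists N; suff qI : iso q.
  have qI' : iso (SubL _ qL : hom RA L (hom_rmod H P N)) by apply: rmod_iso.
  by exists (invm (SubL _ qL : hom RA L (hom_rmod H P N))); apply: iso_invm.
have [s sE] : exists s : hom C L (L ⊗ H P P), rho L ∘ s = idm (rmod L).
  exists ((idm (rmod L) ⊠ iunit H P) ∘ cst (esym (tens1r L))).
  by rewrite compA (rho1 L) cstK.
apply: (@iso_intro _ _ _ _ _ u).
  have e : u ∘ q ∘ rho L = rho L by rewrite -compA qA compA uE -compA invmK // compm1.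
  by rewrite -[LHS]compm1 -[in LHS]sE compA e sE.
apply: (is_coker_epi cHC); rewrite -compA uE compA qA -compA invmVK //.
by rewrite compm1 comp1m.
Qed.

Lemma hom_functor_mod_equivalent : mod_equivalent M RA.
Proof.
exists (hom_functor H P), (hom_functor_act H P); split.
- apply: equivalence_intro; [exact: hom_functor_full | exact: hom_functor_faithful |].
  exact: hom_functor_ess_surj.
- by split; [apply: hom_functor_act_iso | apply: hom_functor_act_nat].
- exact: hom_functor_act1.
- exact: hom_functor_actM.
Qed.

End Generator.

(** * The Frobenius form *)

Section TraceForm.
Variables (k : fieldType) (C : fintens k) (p : pivotal C) (M : modcat C).
Variables (H : ihom M) (S : rel_serre H) (pt : forall N, hom M N (S N)).
Hypothesis ptP : is_pivotal_structure p pt.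
Variable phi : forall N Q, hom C (H N (S Q)) (ldual (H Q N)).
Hypothesis phiP : serre_iso (twist S) phi.
Variable P : M.
Hypothesis Pc : cproj H P.
Implicit Types (N Q : M) (Z : regmod C).
Local Notation A := (H P P).
Local Notation m := (icomp H P P).

(** Precomposition with the evaluation A ▷ P -> P is composition with A, transposed. This is how
    naturality along one morphism of M comes to speak of the product of A. *)
Lemma ihoml_iev N :
  ihoml H N (iev H P P) = ihB H P N A ∘ rcur (icomp H P N).
Proof.
apply: icur_inj; rewrite iev_ihoml actrM compA iev_ihB -2!compA rcur_act.
have e : iev H P N ∘ mul2 (icomp H P N) P = iev H P N ∘ H P N ◁ iev H P P.
  by rewrite mul2E compA iev_icomp -!compA cstK compm1.
by rewrite -(reA (mul2_nat _ _)) (actl_eqid (zig1 _ _)) compm1 e.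
Qed.

Lemma ihomr_iev : ihomr H P (iev H P P) ∘ ihA H A P P = m.
Proof. by apply: icur_inj; rewrite actrM compA iev_ihomr -compA iev_ihA iev_icomp. Qed.

Definition trace_pairing Z : hom (regmod C) (H P (S P) ▷ A ▷ Z) Z :=
  locked (evN A Z ∘ phi P P ▹ (A ▷ Z)).

Lemma trace_pairingE Z : trace_pairing Z = evN A Z ∘ phi P P ▹ (A ▷ Z).
Proof. by rewrite /trace_pairing -lock. Qed.

(* Naturality of phi in its first variable, in its enriched form. *)
Lemma trace_pairing_comp Z :
  trace_pairing Z ∘ mul2 (icomp H P (S P)) (A ▷ Z) = trace_pairing Z ∘ H P (S P) ◁ mul2 m Z.
Proof.
have [_ phiN _ phiB _] := phiP.
have [u uE] : exists u, u = dualM A A ∘ (phi P P ⊠ idm (ldual A)) ∘ rcur (icomp H P (S P)).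
  by exists (dualM A A ∘ (phi P P ⊠ idm (ldual A)) ∘ rcur (icomp H P (S P))).
have e1 : phi (A ▷ P) P ∘ ihoml H (S P) (iev H P P) = dualm (invm (ihA H A P P)) ∘ u.
  by rewrite ihoml_iev compA phiB // uE !compA.
have aI := ihA_iso H A P P.
have aK : invm (ihA H A P P) ▹ Z ∘ ihA H A P P ▹ Z = idm _ by rewrite -actrM invmK // actm1.
(* Naturality along the evaluation, paired with Hom(P, A ▷ P) = A ⊗ A, reads φ(y a)(b) = φ(y)(a
   b). *)
have := congr1 (fun v => evN (H P (A ▷ P)) Z ∘ v ▹ (H P (A ▷ P) ▷ Z)
   ∘ H P (S P) ◁ (ihA H A P P ▹ Z ∘ cst (esym (actA A A Z)))) (phiN (A ▷ P) P P (iev H P P) Pc).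
rewrite e1 !(actrM _ (dualm _)) -!compA !(reA (evN_dualm _ _)).
rewrite -!(reA (act_swap _ _)) -!actlM (compA (invm _ ▹ _)) aK comp1m.
rewrite (compA (ihomr _ _ _ ▹ _)) -(actrM _ (ihomr _ _ _)) ihomr_iev -mul2E.
rewrite uE (actrM _ (dualM A A ∘ _)) (actrM _ (dualM A A)) -!compA (reA (evN_dualM _ _ _)).
rewrite -!compA act_swap -(reA (act_swap (phi P P ⊠ _) _)) (reAid (actl_cstK _ _ _)).
rewrite (reA (actA_nat _ _ _)) actm1 rcur_act -(reA (act_swap (phi P P) _)).
rewrite -(reA (mul2_nat _ _)) (actl_eqid (zig1 _ _)) compm1 => e.
by rewrite !trace_pairingE -!compA.
Qed.

Local Notation f := (iev H P P).

(** Naturality in the second variable along the same evaluation; the twist relation then expresses φ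
    at A ▷ P through φ at P. *)
Lemma phi_serre_iev :
  phi P P ∘ (ihomr H P (fmap S f ∘ twist S A P) ∘ ihA H (ldual (ldual A)) P (S P))
  = dualm (rcur m) ∘ (dualM A (ldual A) ∘ (idm (ldual (ldual A)) ⊠ phi P P)).
Proof.
have [_ _ phiN _ phiT] := phiP.
have APc : cproj H (A ▷ P) by apply: cproj_act.
rewrite ihomrM -compA compA phiN // -compA (compA (phi _ _)) phiT //.
have bI := ihB_iso H P P A.
have e : rcur m = invm (ihB H P P A) ∘ ihoml H P f.
  by rewrite ihoml_iev (reAid (invmK bI)).
by rewrite e dualm_comp !compA.
Qed.

Definition pt_elt : hom C tunit (H P (S P)) := icur H (pt P ∘ cst (act1 P)).

Definition Phi_tr : hom C A (ldual A) := phi P P ∘ ihomr H P (pt P).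

(* lambda (c) = phi (pt_P) (c). *)
Definition trace_form : hom C A tunit :=
  ev A ∘ ((phi P P ∘ pt_elt) ⊠ idm A) ∘ cst (esym (tens1l A)).

Lemma trace_formE Z : form trace_form Z = trace_pairing Z ∘ elt pt_elt (A ▷ Z).
Proof.
rewrite trace_pairingE /trace_form /evN formE capE eltE.
by nest; rewrite !actrM; cst_eq.
Qed.

Lemma pt_elt_comp Z :
  mul2 (icomp H P (S P)) Z ∘ elt pt_elt (A ▷ Z) = ihomr H P (pt P) ▹ Z.
Proof.
have <- : icomp H P (S P) ∘ (pt_elt ⊠ idm A) ∘ cst (esym (tens1l A)) = ihomr H P (pt P).
  apply: icur_inj; rewrite iev_ihomr !actrM compA [in LHS]compA iev_icomp -!compA.
  rewrite (reA (actA_nat _ _ _)) actm1 -(reA (act_swap pt_elt _)) (reA (icurK H _)).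
  rewrite (reA (act1_nat _)) cst_tens1li_act.
  by rewrite !cstKA cstK compm1.
by rewrite mul2E eltE; nest; cst_eq.
Qed.

Lemma Phi_tr_pairing Z : evN A Z ∘ Phi_tr ▹ (A ▷ Z) = cap (trace_form ∘ m) Z.
Proof.
rewrite /Phi_tr actrM compA -trace_pairingE -pt_elt_comp compA trace_pairing_comp.
rewrite -compA -elt_nat compA -trace_formE.
by rewrite capE formE mul2E; nest; cst_eq.
Qed.

Lemma Phi_trE : frob_iso (A := end_alg H P) trace_form = Phi_tr.
Proof. by apply: ldual_inj => Z; rewrite evN_transp Phi_tr_pairing. Qed.

Lemma Phi_tr_iso : iso Phi_tr.
Proof.
have [phiI _ _ _ _] := phiP; apply: iso_comp; first exact: phiI.
by apply: iso_ihomr; apply: ptP.1.1.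
Qed.

Lemma Phi_tr_symmetric : dualm Phi_tr ∘ p A = Phi_tr.
Proof.
have ptM := ptP.2; have ptN : forall N Q (g : hom M N Q), pt Q ∘ g = fmap S g ∘ pt N := ptP.1.2.
(* The twist applied to p and pt at P is pt at A ▷ P, and naturality of pt moves it past the
   evaluation, which leaves a ↦ pt ∘ a. *)
have e1 : ihomr H P (fmap S f ∘ twist S A P) ∘ ihA H (ldual (ldual A)) P (S P)
    ∘ ((p A ⊠ pt_elt) ∘ cst (esym (tens1r A))) = ihomr H P (pt P).
  apply: icur_inj; rewrite !actrM -compA compA iev_ihomr -!compA iev_ihomr.
  rewrite (reA (iev_ihA _ _ _ _)) (reA (actA_nat _ _ _)).
  have e : ldual (ldual A) ◁ iev H P (S P) ∘ p A ▶ (pt_elt ▹ P)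
     = p A ▶ pt P ∘ A ◁ cst (act1 P).
    by rewrite -!actmM comp1m compm1 icurK.
  rewrite (reA e) (reA1 (esym (ptM A P))) (reA (esym (ptN _ _ _))) cst_tens1ri_act.
  by rewrite cstKA actl_cstK compm1.
have e2 : Phi_tr = dualm (rcur m) ∘ (dualM A (ldual A) ∘ (p A ⊠ (phi P P ∘ pt_elt))
   ∘ cst (esym (tens1r A))).
  rewrite /Phi_tr -e1 compA [phi P P ∘ (_ ∘ _)]phi_serre_iev.
  rewrite -!(compA (dualm _)); congr (_ ∘ _).
  rewrite -[LHS](compA (dualM _ _)) -[RHS](compA (dualM _ _)); congr (_ ∘ _).
  by rewrite compA -tensmM comp1m.
(* As Φ is the transpose of λ ∘ m ([Phi_trE]), this composite is again Φ; inserted into [e2], it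
   yields Φ = Φ^* ∘ p. *)
have e3 Z : evN A (ldual A ▷ Z) ∘ (phi P P ▹ (A ▷ ldual A ▷ Z)
    ∘ (elt pt_elt (A ▷ ldual A ▷ Z) ∘ (mul2 m (ldual A ▷ Z) ∘ A ◁ coevN A Z))) = Phi_tr ▹ Z.
  rewrite -Phi_trE transp_act (compA (evN _ _)) -trace_pairingE.
  rewrite (compA (trace_pairing _)) -trace_formE compA; congr (_ ∘ _).
  by rewrite capE formE mul2E; nest; cst_eq.
rewrite [RHS]e2; apply: ldual_inj => Z.
rewrite !(actrM _ (dualm _)) !compA !evN_dualm (actrM _ (dualM A (ldual A) ∘ _)).
rewrite (actrM _ (dualM A (ldual A))) -!compA -(reA (act_swap (dualM _ _) _)).
rewrite (reA (evN_dualM _ _ _)) -!compA.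
rewrite (reA (actl_eq (rcur_act _ _))) -!(reA (act_swap (p A ⊠ _) _)).
rewrite (reA (actA_nat _ _ _)) !(reA (actA_natl _ _ _)) cst_tens1ri_act cstKA.
rewrite (act_lr (p A) ((phi P P ∘ pt_elt) ▹ _)) -[in RHS]compA -(reA (act_swap (p A) _)) -(act_swap (p A)).
congr (_ ∘ (_ ∘ _)); rewrite -!actlM; congr (A ◁ _).
by rewrite -e3 eltE actrM -!compA !(reA (act1i_nat _ _)) act1i_nat.
Qed.

Definition trace_frobenius : frobenius C.
Proof.
exists (end_alg H P) trace_form.
by rewrite /frobenius_form Phi_trE; apply: Phi_tr_iso.
Defined.

Lemma trace_frobenius_symmetric : symmetric_frobenius p trace_frobenius.
Proof.
rewrite /symmetric_frobenius /nakayama /= Phi_trE -compA Phi_tr_symmetric.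
exact: invmK Phi_tr_iso.
Qed.

End TraceForm.

Lemma pivotal_symmetric_frobenius (k : fieldType) (C : fintens k) (p : pivotal C)
    (M : finmod C) :
  admits_pivotal_structure p M ->
  exists A : frobenius C, symmetric_frobenius p A /\ mod_equivalent M (rmod_modcat A).
Proof.
move=> [H [S [pt ptP]]]; have [phi phiP] := serre_phi S.
have [P [proj1 proj2 gen]] := finite_abelian_generator (fm_finite M).
have Pc : cproj H P by apply: generator_cproj.
exists (trace_frobenius ptP phiP Pc); split.
  exact: trace_frobenius_symmetric.
exact: hom_functor_mod_equivalent proj1 proj2 gen (@finite_abelian_coker _ _ (fm_finite M)).
Qed.

Theorem theorem6p4 (k : fieldType) (C : fintens k) (p : pivotal C)
    (M : finmod C) :
  admits_pivotal_structure p M <->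
  exists A : frobenius C,
    symmetric_frobenius p A /\ mod_equivalent M (rmod_modcat A).
Proof.
split; first exact: pivotal_symmetric_frobenius.
move=> [A [symA MA]].
exact: (symmetric_frobenius_pivotal (@finite_abelian_ker _ _ (ft_finite C)) symA MA).
Qed.
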